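(* Let $y\in\mathbb{R}$ and suppose that $\alpha,\beta:[0,T]^2\times\mathbb{R}\times\mathbb{M}\to\mathbb{R}$ satisfy: (a) $\alpha$ and $\beta$ are locally bounded and Borel-measurable; (b) there exists a constant $C$ such that for all $z\in[0,T]^2$, $y_1,y_2\in\mathbb{R}$, $\mu,\mu'\in\mathbb{M}$, $$|\alpha(z,y_1,\mu)-\alpha(z,y_2,\mu')|+|\beta(z,y_1,\mu)-\beta(z,y_2,\mu')|\le C\big(|y_1-y_2|+\|\mu-\mu'\|_{\mathbb{M}}\big),$$ and $\mathbb{E}\int_{R_z}\big(|\alpha(\zeta,0,\delta_0)|^2+|\beta(\zeta,0,\delta_0)|^2\big)\,d\zeta<\infty$ for all $z\in[0,T]^2$, where $\delta_0$ is the Dirac measure at $0$. Then the McKean-Vlasov SPDE $$\frac{\partial^2}{\partial t\,\partial x}Y(t,x)=\alpha(t,x,Y(t,x),\mu_{t,x})+\beta(t,x,Y(t,x),\mu_{t,x})\diamond\overset{\bullet}{B}(t,x),\qquad Y(0,0)=y,$$ where $\mu_{t,x}$ is the probability distribution of $Y(t,x)$, has a unique strong solution.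
   Context: $T>0$ is fixed. $B=\{B(t,x)\}$ is a Brownian sheet on a complete probability space $(\Omega,\mathcal{F},P)$, and $\mathcal{F}_{t,x}$ is the completed $\sigma$-field generated by $B(s,a)$, $s\le t$, $a\le x$. For $z=(t,x)\in\mathbb{R}_+^2$, $R_z=[0,t]\times[0,x]$. $\overset{\bullet}{B}$ is time-space white noise and $\diamond$ the Wick product; the SPDE means the integral equation $$Y(z)=y+\int_{R_z}\alpha(\zeta,Y(\zeta),\mu_\zeta)\,d\zeta+\int_{R_z}\beta(\zeta,Y(\zeta),\mu_\zeta)\,B(d\zeta),$$ with $\mu_\zeta$ the law of $Y(\zeta)$, the last integral being the two-parameter Itô integral with respect to the given Brownian sheet; a strong solution is an $(\mathcal{F}_{t,x})$-adapted process $Y$ on the given probability space satisfying this equation. $\mathbb{M}$ is the completion of the pre-Hilbert space of random measures $\mu$ on $\mathbb{R}$ with inner product $\langle\mu,\eta\rangle_{\mathbb{M}}=\mathbb{E}\big[\int_{\mathbb{R}}\operatorname{Re}(\overline{\hat\mu(y)}\hat\eta(y))e^{-y^2}dy\big]$ and norm $\|\mu\|_{\mathbb{M}}^2=\mathbb{E}\big[\int_{\mathbb{R}}|\hat\mu(y)|^2e^{-y^2}dy\big]$, where $\hat\mu(y)=\int_{\mathbb{R}}e^{-ixy}\mu(dx)$. *)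

(* Defs.v *)
From Stdlib Require List.
From HB Require Import structures.
From mathcomp Require Import all_boot all_order all_algebra.
From mathcomp Require Import complex.
From mathcomp Require Import all_classical all_reals all_analysis.
From mathcomp Require Import measurable_realfun.

Set Implicit Arguments.
Unset Strict Implicit.
Unset Printing Implicit Defensive.

Import Order.TTheory GRing.Theory Num.Theory.
Import numFieldNormedType.Exports.

Local Open Scope classical_set_scope.
Local Open Scope ring_scope.

(* Lebesgue measure, re-typed so that its sigma-algebra is the one inferred
   by default on R and R * R (convertible, but with another display). *)
Section lebesgue.
Variable R : realType.

Definition leb1 : set R -> \bar R := @lebesgue_measure R.

HB.instance Definition _ := isMeasure.Build default_measure_display R R leb1
  (measure0 (@lebesgue_measure R)) (measure_ge0 (@lebesgue_measure R))
  (@measure_semi_sigma_additive _ _ _ (@lebesgue_measure R)).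

HB.instance Definition _ := @Measure_isSigmaFinite.Build _ _ _ leb1
  (sigma_finiteT (@lebesgue_measure R)).

Definition leb2 : set (R * R) -> \bar R := (leb1 \x leb1)%E.

HB.instance Definition _ := Measure.on leb2.

Lemma leb2_sigma_finite : sigma_finite setT leb2.
Proof.
have /sigma_finiteP[F [TF ndF Foo]] := sigma_finiteT leb1.
exists (fun n => F n `*` F n).
  rewrite -setXTT TF predeqE => -[x y]; split.
    move=> [/= [n _ Fnx] [k _ Gky]]; exists (maxn n k) => //; split.
    - by move: x Fnx; exact/subsetPset/ndF/leq_maxl.
    - by move: y Gky; exact/subsetPset/ndF/leq_maxr.
  by move=> [n _ []/= ? ?]; split; exists n.
move=> k; have [mF oF] := Foo k.
split; first exact: measurableX.
by rewrite /leb2 product_measure1E// lte_mul_pinfty// ge0_fin_numE.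
Qed.

HB.instance Definition _ :=
  @Measure_isSigmaFinite.Build _ _ _ leb2 leb2_sigma_finite.

End lebesgue.
Arguments leb1 {R}.
Arguments leb2 {R}.

Section signed_measures.
Context {R : realType}.

(* Integral of f against a finite signed measure nu, through the Jordan
   decomposition; it does not depend on the Hahn decomposition that is chosen. *)
Definition charge_integral (nu : {charge set R -> \bar R}) (f : R -> R) : R :=
  let PN := cid (Hahn_decomposition nu) in
  let N := cid (projT2 PN) in
  \int[jordan_pos (projT2 N)]_x f x - \int[jordan_neg (projT2 N)]_x f x.

Definition fourier (nu : {charge set R -> \bar R}) (y : R) : R[i] :=
  Complex (charge_integral nu (fun x => cos (x * y)))
          (- charge_integral nu (fun x => sin (x * y))).

End signed_measures.

Section random_measures.
Context {d : measure_display} {Omega : measurableType d} {R : realType}.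
Variable P : probability Omega R.

(* Random measures are finite and signed, so that they form a vector space. *)
Definition random_measure : Type := Omega -> {charge set R -> \bar R}.

Definition rm_inner (m n : random_measure) : \bar R :=
  (\int[P]_w \int[leb1]_y
     (complex.Re (conjc (fourier (m w) y) * fourier (n w) y)
        * expR (- y ^+ 2))%:E)%E.

(* The pre-Hilbert space; rm_inner m m is the squared norm of m. *)
Definition preM (m : random_measure) : Prop :=
  (forall A : set R, measurable A -> measurable_fun setT (fun w => m w A)) /\
  (rm_inner m m < +oo)%E.

(* M is a completion of the pre-Hilbert space preM: a complete normed space with
   a linear isometric map from preM onto a dense subspace.  Such an M is unique
   up to a linear isometry, and its inner product is determined by its norm.
   The value of the map outside preM is irrelevant. *)
Record completionM (M : completeNormedModType R) := CompletionM {
  embedM :> random_measure -> M ;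
  embedM_linear : forall (a : R) (m n p : random_measure),
    preM m -> preM n -> preM p ->
    (forall w (A : set R), measurable A -> p w A = (a%:E * m w A + n w A)%E) ->
    embedM p = a *: embedM m + embedM n ;
  embedM_norm : forall m : random_measure, preM m ->
    (`|embedM m| ^+ 2)%:E = rm_inner m m ;
  embedM_dense : dense (embedM @` preM) }.

Definition law (X : {RV P >-> R}) : random_measure :=
  fun=> charge_of_finite_measure (distribution P X).

Definition rm_dirac0 : random_measure :=
  fun=> charge_of_finite_measure (@dirac _ R (0 : R) R).

End random_measures.

Section brownian_sheet.
Context {d : measure_display} {Omega : measurableType d} {R : realType}.
Variable P : probability Omega R.
Implicit Types (B : R * R -> Omega -> R) (l u z : R * R).

Definition quadrant : set (R * R) := [set z | 0 <= z.1 /\ 0 <= z.2].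

(* ]l.1, u.1] x ]l.2, u.2] *)
Definition rect l u : set (R * R) :=
  [set z | l.1 < z.1 <= u.1 /\ l.2 < z.2 <= u.2].

Definition proper_rect l u : Prop :=
  [/\ quadrant l, l.1 < u.1 & l.2 < u.2].

Definition incr B l u (w : Omega) : R :=
  B u w - B (l.1, u.2) w - B (u.1, l.2) w + B l w.

Definition mutually_independent n (X : 'I_n -> Omega -> R) : Prop :=
  forall A : 'I_n -> set R, (forall i, measurable (A i)) ->
    P (\bigcap_(i in [set: 'I_n]) (X i @^-1` A i)) =
    \big[*%E/1%E]_(i < n) P (X i @^-1` A i).

Record brownian_sheet B : Prop := BrownianSheet {
  sheet_measurable : forall z, quadrant z -> measurable_fun setT (B z) ;
  sheet_axes : forall z, quadrant z -> z.1 = 0 \/ z.2 = 0 ->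
    {ae P, forall w, B z w = 0} ;
  sheet_normal : forall l u, proper_rect l u ->
    forall A : set R, measurable A ->
      P (incr B l u @^-1` A) =
      normal_prob 0 (Num.sqrt ((u.1 - l.1) * (u.2 - l.2))) A ;
  sheet_independent : forall n (l u : 'I_n -> R * R),
    (forall i, proper_rect (l i) (u i)) ->
    (forall i j, i != j -> rect (l i) (u i) `&` rect (l j) (u j) = set0) ->
    mutually_independent (fun i => incr B (l i) (u i)) ;
  sheet_continuous :
    {ae P, forall w, {within quadrant, continuous (fun z => B z w)}} }.

Definition sheet_filtration B z : set (set Omega) :=
  <<s [set A | (exists (s : R * R) (U : set R),
                  [/\ 0 <= s.1 <= z.1, 0 <= s.2 <= z.2, measurable U &
                      A = B s @^-1` U])
               \/ P.-negligible A] >>.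

Definition sheet_measurable_at B z (X : Omega -> R) : Prop :=
  forall U : set R, measurable U -> sheet_filtration B z (X @^-1` U).

(* The random step function coef * \1_(rect lo up). *)
Record step := Step { lo : R * R ; up : R * R ; coef : Omega -> R }.

Definition admissible_step B (e : step) : Prop :=
  [/\ proper_rect (lo e) (up e),
      exists K : R, forall w, `|coef e w| <= K &
      sheet_measurable_at B (lo e) (coef e)].

Definition simple_process (s : seq step) (z : R * R) (w : Omega) : R :=
  \sum_(e <- s) coef e w * \1_(rect (lo e) (up e)) z.

Definition pmin (a b : R * R) : R * R :=
  (Num.min a.1 b.1, Num.min a.2 b.2).

(* R_z = [0, z.1] x [0, z.2] *)
Definition Rz z : set (R * R) := `[0, z.1] `*` `[0, z.2].

(* Integral over R_z; a step clipped to an empty rectangle contributes 0. *)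
Definition simple_integral B (s : seq step) z (w : Omega) : R :=
  \sum_(e <- s) coef e w * incr B (pmin (lo e) z) (pmin (up e) z) w.

Definition normsq_Rz z (phi : R * R -> Omega -> R) : \bar R :=
  (\int[P]_w \int[leb2]_(x in Rz z) ((phi x w) ^+ 2)%:E)%E.

Record ito_integrand B z (phi : R * R -> Omega -> R) : Prop := ItoIntegrand {
  integrand_measurable :
    measurable_fun (Rz z `*` [set: Omega]) (fun p => phi p.1 p.2) ;
  integrand_adapted : forall x, Rz z x -> sheet_measurable_at B x (phi x) ;
  integrand_L2 : (normsq_Rz z phi < +oo)%E }.

(* J is (a version of) the two-parameter Ito integral of phi over R_z: the limit
   in L^2(P) of the integrals of simple processes converging to phi in
   L^2(R_z x Omega).  The Ito isometry makes J unique up to a null set. *)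
Definition is_ito_integral B z (phi : R * R -> Omega -> R) (J : Omega -> R) :=
  [/\ ito_integrand B z phi, measurable_fun setT J &
      exists S : nat -> seq step,
        [/\ forall n e, List.In e (S n) -> admissible_step B e,
            normsq_Rz z (fun x w => phi x w - simple_process (S n) x w)
              @[n --> \oo] --> 0%E &
            (\int[P]_w ((J w - simple_integral B (S n) z w) ^+ 2)%:E)%E
              @[n --> \oo] --> 0%E]].

End brownian_sheet.

Section mckean_vlasov.
Context {d : measure_display} {Omega : measurableType d} {R : realType}.
Variables (P : probability Omega R) (M : completeNormedModType R).
Variables (iota : completionM P M) (B : R * R -> Omega -> R) (T : R).

Definition square : set (R * R) := Rz (T, T).

(* Coefficients are functions on [0,T]^2 x R x M, extended arbitrarily. *)
Definition coef_domain : set (R * R * R * M) :=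
  [set p | square p.1.1].

Definition uncurry_coef (f : R * R -> R -> M -> R) (p : R * R * R * M) : R :=
  f p.1.1 p.1.2 p.2.

Definition locally_bounded (f : R * R -> R -> M -> R) : Prop :=
  forall p, coef_domain p -> exists K : R,
    \forall q \near p, coef_domain q -> `|uncurry_coef f q| <= K.

(* Borel sets are those generated by the open sets of the product topology;
   coef_domain is closed. *)
Definition borel_coef (f : R * R -> R -> M -> R) : Prop :=
  forall A : set R, measurable A ->
    <<s [set U : set (R * R * R * M) | open U] >>
      (coef_domain `&` uncurry_coef f @^-1` A).

(* The law of Y z is deterministic and enters the coefficients as a constant
   random measure, through iota.  The initial condition Y (0, 0) = y is the
   equation at z = (0, 0). *)
Record strong_solution (alpha beta : R * R -> R -> M -> R) (y : R)
    (Y : R * R -> {RV P >-> R}) : Prop := StrongSolution {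
  solution_measurable :
    measurable_fun (square `*` [set: Omega]) (fun p => Y p.1 p.2) ;
  solution_adapted : forall z, square z -> sheet_measurable_at P B z (Y z) ;
  solution_equation : forall z, square z ->
    exists2 J : Omega -> R,
      is_ito_integral P B z (fun x w => beta x (Y x w) (iota (law (Y x)))) J &
      {ae P, forall w,
        let a x := alpha x (Y x w) (iota (law (Y x))) in
        leb2.-integrable (Rz z) (EFin \o a) /\
        Y z w = y + \int[leb2]_(x in Rz z) a x + J w} }.

End mckean_vlasov.

(* Main.v *)
Require Import Defs.
From HB Require Import structures.
From mathcomp Require Import all_boot all_order all_algebra.
From mathcomp Require Import all_classical all_reals all_analysis.
From mathcomp Require Import measurable_realfun.
From mathcomp Require Import complex.
From mathcomp Require Import ring lra zify.

(** Write m_X(x) for the image in M of the law of X x.  A solution is a fixed point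
    of the map that sends a process X to
      Z(z) = y + int_(R_z) alpha(x, X x, m_X x) dx + int_(R_z) beta(x, X x, m_X x) B(dx),
    and this map is a contraction in mean square.

    The equation is of Lipschitz type even in the law.  In Fourier variables
    |E e^(itX) - E e^(itX')|^2 <= 2 t^2 E (X - X')^2, and t^2 is integrable against
    e^(-t^2); hence |m_X - m_X'|^2 <= c E (X - X')^2 (law_lipschitz), and the norms of
    laws are bounded (law_norm_bounded).  Since the law is deterministic, the dependence
    on it only adds a multiple of the same mean square distance (coef_diff_msq).

    The stochastic integral rests on one identity.  The increment of the sheet over a
    rectangle is independent of the values of the sheet outside the open quarter plane
    above its lower left corner (history_indep), so increments over disjoint rectangles
    with adapted coefficients are orthogonal.  Cutting rectangles until they coincide
    or are separated gives the isometry for simple processes, for two rectangles of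
    integration at once (simple_integral_isometry), and then in the limit for all
    integrals (ito_gap).  The latter yields both the continuity of the integral in z and
    the comparison of two integrands.

    To apply the map to X one needs the coefficients along X to be limits of simple
    processes.  This is arranged by iterating inside the class good of jointly
    measurable adapted processes whose mean square increments are at most linear in the
    distance: freezing X and its law at the corners of a fine grid changes the
    coefficient little, and a coefficient with frozen state is approximated by steps
    through a monotone class argument (approximable_frozen, coef_good_integrand).  The
    image has the same regularity by ito_gap and Cauchy-Schwarz, and processes regular in
    mean square have jointly measurable adapted versions (holder_version, picard_step).
    All limits of processes are taken along fastlim, a pointwise formula that applies
    to sequences converging in mean square at the rate 16^-k; it preserves joint
    measurability and adaptedness.

    With h(x) = E (X x - X' x)^2 the isometry and Cauchy-Schwarz bound
    E (Z z - Z' z)^2 by a constant times the integral of h over R_z, so the map contracts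
    by 1/16 in the norm weighted by e^(lam t) for lam large (solves_contraction,
    picard_contraction).  Picard iteration then gives existence.

    For uniqueness the same contraction applies once the mean square distance of two
    solutions Y, Y' is known to be finite, which is not part of the definition of a
    solution.  The difference of the stochastic integrals is bounded in mean square
    uniformly in z, because their integrands are square integrable.  The drifts are
    integrable for almost every sample point; on a measurable hull of the event that
    their total variation is at most n this bounds E |Y - Y'|^2 and shows that the plane
    integral of |Y - Y'|^2 is finite almost surely.  Truncating at the level n of that
    integral, a Gronwall estimate bounds E |Y - Y'|^2 uniformly in n (square_bound),
    since the part of the drift difference due to the laws is bounded by a constant. *)

Import Order.TTheory GRing.Theory Num.Theory.
Import numFieldNormedType.Exports.
Local Open Scope classical_set_scope.
Local Open Scope ring_scope.
Set Implicit Arguments.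
Unset Strict Implicit.
Unset Printing Implicit Defensive.

(** * Square integrals *)

Section square_integrals.
Context d (T : measurableType d) (R : realType).
Variable mu : {measure set T -> \bar R}.

(** The integral of a nonnegative function is a supremum over the simple
    functions below it, hence monotone for arbitrary functions. Drifts can thus
    be compared before their dependence on the sample point is known to be
    measurable. *)
Lemma ge0_le_integralW (D : set T) (f g : T -> \bar R) :
  (forall x, D x -> 0 <= f x)%E -> (forall x, D x -> f x <= g x)%E ->
  (\int[mu]_(x in D) f x <= \int[mu]_(x in D) g x)%E.
Proof.
move=> f0 fg.
rewrite [leLHS]integral_mkcond [leRHS]integral_mkcond.
have f0' x : (0 <= (f \_ D) x)%E.
  by rewrite patchE; case: ifPn => // /set_mem; exact: f0.
have fg' x : ((f \_ D) x <= (g \_ D) x)%E.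
  by rewrite !patchE; case: ifPn => // /set_mem; exact: fg.
have g0' x : (0 <= (g \_ D) x)%E by exact: le_trans (f0' x) (fg' x).
rewrite !ge0_integralTE//; apply: le_ereal_sup => _ [h hf <-].
by exists h => // x; exact: le_trans (hf x) (fg' x).
Qed.

Definition msq (D : set T) (f : T -> R) : \bar R :=
  (\int[mu]_(x in D) ((f x) ^+ 2)%:E)%E.

Lemma msq_ge0 (D : set T) (f : T -> R) : (0 <= msq D f)%E.
Proof. by apply: integral_ge0 => x _; rewrite lee_fin sqr_ge0. Qed.

Lemma measurable_sqr (D : set T) (f : T -> R) : measurable_fun D f ->
  measurable_fun D (fun x => ((f x) ^+ 2)%:E).
Proof. by move=> mf; apply/measurable_EFinP; exact: measurable_funX. Qed.

Lemma msq_le (D : set T) (f g : T -> R) :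
  (forall x, D x -> `|f x| <= `|g x|) -> (msq D f <= msq D g)%E.
Proof.
move=> fg; apply: ge0_le_integralW => x Dx; rewrite lee_fin ?sqr_ge0//.
by rewrite -[leLHS]real_normK ?num_real// -[leRHS]real_normK ?num_real// lerXn2r ?nnegrE//; exact: fg.
Qed.

Lemma eq_msq (D : set T) (f g : T -> R) :
  (forall x, D x -> f x = g x) -> msq D f = msq D g.
Proof. by move=> fg; apply: eq_integral => x /set_mem Dx; rewrite fg. Qed.

Lemma msqBC (D : set T) (f g : T -> R) :
  msq D (fun x => f x - g x) = msq D (fun x => g x - f x).
Proof. by apply: eq_integral => x _; rewrite -sqrrN opprB. Qed.

Lemma msq_subset (D E : set T) (f : T -> R) : measurable D -> measurable E ->
  measurable_fun E f -> D `<=` E -> (msq D f <= msq E f)%E.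
Proof.
move=> mD mE mf DE; apply: ge0_subset_integral => //.
  exact: measurable_sqr.
by move=> x _; rewrite lee_fin sqr_ge0.
Qed.

Lemma msqZ (D : set T) (k : R) (f : T -> R) : measurable D ->
  measurable_fun D f -> msq D (fun x => k * f x) = ((k ^+ 2)%:E * msq D f)%E.
Proof.
move=> mD mf; rewrite /msq.
under eq_integral do rewrite exprMn EFinM.
rewrite ge0_integralZl_EFin ?sqr_ge0//; first by move=> x _; rewrite lee_fin sqr_ge0.
exact: measurable_sqr.
Qed.

Lemma msqD (D : set T) (f g : T -> R) : measurable D ->
  measurable_fun D f -> measurable_fun D g ->
  (msq D (fun x => f x + g x)%R <= 2%:E * msq D f + 2%:E * msq D g)%E.
Proof.
move=> mD mf mg; rewrite /msq.
rewrite -!ge0_integralZl_EFin//; try by [move=> x _; rewrite lee_fin sqr_ge0 | exact: measurable_sqr].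
rewrite -ge0_integralD//; first last.
- by apply/measurable_EFinP/measurable_funM => //; exact: measurable_funX.
- by move=> x _; rewrite -EFinM lee_fin mulr_ge0 ?sqr_ge0.
- by apply/measurable_EFinP/measurable_funM => //; exact: measurable_funX.
- by move=> x _; rewrite -EFinM lee_fin mulr_ge0 ?sqr_ge0.
apply: ge0_le_integralW => x _; first by rewrite lee_fin sqr_ge0.
rewrite -!EFinM -EFinD lee_fin.
by rewrite -subr_ge0 (_ : _ - _ = (f x - g x) ^+ 2) ?sqr_ge0//; ring.
Qed.

(** The factors 2 replace the square roots of the Minkowski inequality: only
    convergence, and contraction up to a constant, are at stake. *)
Lemma msq_triangle (D : set T) (f g h : T -> R) (a b : R) : measurable D ->
  measurable_fun D f -> measurable_fun D g -> measurable_fun D h ->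
  (msq D (fun x => f x - g x)%R <= a%:E)%E ->
  (msq D (fun x => g x - h x)%R <= b%:E)%E ->
  (msq D (fun x => f x - h x)%R <= (2 * a + 2 * b)%:E)%E.
Proof.
move=> mD mf mg mh fga ghb.
rewrite (eq_msq (g := fun x => (f x - g x) + (g x - h x))); last first.
  by move=> x _; rewrite subrKA.
apply: (le_trans (msqD mD _ _)); [exact: measurable_funB..|].
by rewrite [leRHS]EFinD !EFinM leeD// lee_pmul2l ?lte_fin.
Qed.

(** Termwise integration bounds the integral of the series by c, so the series
    is finite almost everywhere, and each term is at most its sum. *)
Lemma msq_ae_summable (D : set T) (f : nat -> T -> R) (a : nat -> R) (c : R) :
  measurable D -> (forall k, measurable_fun D (f k)) -> (forall k, 0 <= a k) ->
  (forall n, (\sum_(k < n) (a k)%:E * msq D (f k) <= c%:E)%E) ->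
  {ae mu, forall x, D x -> exists K : R, forall k, a k * (f k x) ^+ 2 <= K}.
Proof.
move=> mD mf a0 sc.
pose g k x := (a k * (f k x) ^+ 2)%:E.
have mg k : measurable_fun D (g k).
  by apply/measurable_EFinP/measurable_funM => //; exact: measurable_funX.
have g0 k x : D x -> (0 <= g k x)%E by move=> _; rewrite lee_fin mulr_ge0 ?sqr_ge0.
have mG : measurable_fun D (fun x => \sum_(k <oo) g k x)%E.
  by apply: ge0_emeasurable_sum => // k x Dx _; exact: g0.
have IG : mu.-integrable D (fun x => \sum_(k <oo) g k x)%E.
  apply/integrableP; split => //.
  apply: (@le_lt_trans _ _ c%:E); last exact: ltry.
  under eq_integral => x /set_mem Dx.
    rewrite gee0_abs; last by apply: nneseries_ge0 => k _ _; exact: g0.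
    over.
  rewrite integral_nneseries//; apply: lime_le.
    by apply: is_cvg_nneseries => k _ _; apply: integral_ge0 => x; exact: g0.
  apply: nearW => n; apply: le_trans (sc n); rewrite big_mkord.
  apply: lee_sum => k _; rewrite /g.
  under eq_integral do rewrite EFinM.
  rewrite ge0_integralZl_EFin//; first by move=> x _; rewrite lee_fin sqr_ge0.
  exact: measurable_sqr.
have := integrable_ae mD IG; apply: filterS => x fx Dx.
have sfx := fx Dx.
exists (fine (\sum_(k <oo) g k x)%E) => k.
rewrite -lee_fin fineK//.
rewrite (@nneseriesD1 _ (g ^~ x) k xpredT)//; last by move=> i _; exact: g0.
by rewrite leeDl// nneseries_ge0// => i _ _; exact: g0.
Qed.

End square_integrals.

(** * Limits of rapidly converging sequences *)

(** A limit that is measurable whenever the terms are, for any sigma-algebra and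
    without an exceptional set; so one formula yields versions that are jointly
    measurable and adapted. *)
Definition fastlim (R : realType) T (f : nat -> T -> R) (x : T) : R :=
  fine (limn_esup (fun n => (f n x)%:E)).

Lemma measurable_fastlim d (T : measurableType d) (R : realType) (D : set T)
    (f : nat -> T -> R) :
  (forall n, measurable_fun D (f n)) -> measurable_fun D (fastlim f).
Proof.
move=> mf; apply: (@measurableT_comp _ _ _ _ _ _ (@fine R)) => //.
by apply: measurable_fun_limn_esup => n; apply/measurable_EFinP.
Qed.

Lemma fastlimE (R : realType) T (f : nat -> T -> R) (x : T) (l : R) :
  f ^~ x @ \oo --> l -> fastlim f x = l.
Proof.
move=> fl; rewrite /fastlim.
have [|_ ->] := @cvg_limn_einf_sup _ (fun n => (f n x)%:E) l%:E; last by [].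
by apply: cvg_EFin => //; exact: nearW.
Qed.

(** The increments are dominated by a geometric series of ratio 1/2. *)
Lemma cvg_fast_differences (R : realType) (u : nat -> R) (K : R) :
  (forall k, 4 ^+ k * (u k.+1 - u k) ^+ 2 <= K) -> cvgn u.
Proof.
move=> uK.
have K0 : 0 <= K by apply: le_trans (uK 0%N); rewrite mulr_ge0 ?sqr_ge0.
have du k : `|u k.+1 - u k| <= geometric (K + 1) (2^-1) k.
  rewrite /geometric /= -(@ler_pXn2r _ 2)// ?nnegrE//; last first.
    by rewrite mulr_ge0// ?addr_ge0// exprn_ge0.
  rewrite real_normK ?num_real// exprMn -exprM.
  have -> : (2^-1 : R) ^+ (k * 2) = (4 ^+ k)^-1.
    by rewrite mulnC exprM -exprVn; congr (_ ^+ _); rewrite expr2; field.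
  rewrite ler_pdivlMr ?exprn_gt0// mulrC (le_trans (uK k))//.
  by rewrite sqrrD expr1n mulr1; have := sqr_ge0 K; lra.
have c : cvgn (series (telescope u)).
  apply: normed_cvg; apply: (@series_le_cvg _ _ (geometric (K + 1) 2^-1)).
  - by move=> n /=.
  - by move=> n; rewrite /= mulr_ge0// ?addr_ge0// exprn_ge0.
  - by move=> n; exact: du.
  - by apply: is_cvg_geometric_series; rewrite ger0_norm; lra.
rewrite (_ : u = (fun n => u 0%N + series (telescope u) n)).
  by apply: is_cvgD => //; exact: is_cvg_cst.
by apply/funext => n; rewrite -eq_sum_telescope.
Qed.

Section fast_cauchy.
Context d (T : measurableType d) (R : realType).
Variables (mu : {measure set T -> \bar R}) (D : set T) (mD : measurable D).
Variables (f : nat -> T -> R) (c : R).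
Hypothesis mf : forall n, measurable_fun D (f n).
Hypothesis fc : forall k,
  (msq mu D (fun x => f k.+1 x - f k x)%R <= (c * (16 ^+ k)^-1)%:E)%E.

Let c0 : 0 <= c.
Proof.
have := le_trans (msq_ge0 _ _ _) (fc 0); rewrite lee_fin expr0 invr1 mulr1.
by [].
Qed.

(** The rate 16^-k leaves room for a summable weight, 4^k 16^-k = 4^-k, which
    turns convergence in mean square into almost sure convergence. *)
Lemma fast_cauchy_ae : {ae mu, forall x, D x -> f ^~ x @ \oo --> fastlim f x}.
Proof.
have : {ae mu, forall x, D x -> exists K : R, forall k,
    4 ^+ k * (f k.+1 x - f k x) ^+ 2 <= K}.
  apply: (@msq_ae_summable _ _ _ _ _ (fun k x => f k.+1 x - f k x) _ (2 * c)) => //.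
    by move=> k; exact: measurable_funB.
  move=> n; apply: (@le_trans _ _ (\sum_(k < n) (c * (4 ^+ k)^-1)%:E)%E).
    apply: lee_sum => k _.
    apply: (@le_trans _ _ ((4 ^+ k)%:E * (c * (16 ^+ k)^-1)%:E)%E).
      by apply: lee_wpmul2l; [rewrite lee_fin exprn_ge0|exact: fc].
    rewrite -EFinM lee_fin.
    have -> : (16 : R) = 4 * 4 by ring.
    rewrite exprMn invfM; rewrite le_eqVlt; apply/orP; left; apply/eqP; field.
    by rewrite expf_neq0.
  rewrite sumEFin lee_fin.
  have : \sum_(i < n) c / 4 ^+ i <= 2 * c - 2 * (c / 4 ^+ n).
    elim: n => [|n ih]; first by rewrite big_ord0 expr0; move: c0; lra.
    rewrite big_ord_recr/=; apply: (le_trans (lerD ih (lexx _))).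
    rewrite exprS invfM; set a := (4 ^+ n)^-1.
    have a0 : 0 <= a by rewrite invr_ge0 exprn_ge0.
    have := mulr_ge0 c0 a0; lra.
  move/le_trans; apply; rewrite lerBlDr lerDl mulr_ge0// divr_ge0// exprn_ge0//.
apply: filterS => x fx Dx; have [K /cvg_fast_differences cf] := fx Dx.
by rewrite (fastlimE cf).
Qed.

(** The factor 4 survives the induction because 2 * 4 / 16 + 2 <= 4. *)
Lemma fast_cauchy_msq k n :
  (msq mu D (fun x => f (k + n) x - f k x)%R <= (4 * (c * (16 ^+ k)^-1))%:E)%E.
Proof.
elim: n k => [|n ih] k.
  rewrite (@eq_msq _ _ _ _ _ _ (fun=> 0)) => [|x _]; last by rewrite addn0 subrr.
  rewrite /msq; under eq_integral do rewrite expr0n/=.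
  rewrite integral0 lee_fin mulr_ge0// mulr_ge0 ?invr_ge0 ?exprn_ge0//.
apply: le_trans (msq_triangle mD (mf _) (mf k.+1) (mf k) _ (fc k)) _.
  by rewrite addnS -addSn; exact: ih.
rewrite lee_fin exprS invfM; set a := (16 ^+ k)^-1.
have a0 : 0 <= a by rewrite invr_ge0 exprn_ge0.
have := mulr_ge0 c0 a0; lra.
Qed.

(** Fatou's lemma along the almost everywhere limit. *)
Lemma fast_cauchy_lim k :
  (msq mu D (fun x => fastlim f x - f k x)%R <= (4 * (c * (16 ^+ k)^-1))%:E)%E.
Proof.
pose g n x := ((f (k + n) x - f k x) ^+ 2)%:E.
have mg n : measurable_fun D (g n).
  by apply: measurable_sqr; exact: measurable_funB.
have g0 n x : D x -> (0 <= g n x)%E by rewrite lee_fin sqr_ge0.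
have gl0 x : D x -> (0 <= limn_einf (g ^~ x))%E.
  move=> Dx; rewrite limn_einf_lim; apply: lime_ge; first exact: is_cvg_einfs.
  by apply: nearW => n; apply: le_ereal_inf_tmp => _ [m _ <-]; exact: g0.
apply: (@le_trans _ _ (\int[mu]_(x in D) limn_einf (g ^~ x))%E).
  apply: ae_ge0_le_integral => //.
  - by move=> x _; rewrite lee_fin sqr_ge0.
  - by apply: measurable_sqr; apply: measurable_funB => //; exact: measurable_fastlim.
  - apply: measurableT_comp => //.
    by apply: measurable_fun_limn_esup => n; exact: measurableT_comp.
  - have := fast_cauchy_ae; apply: filterS => x fx Dx; have {}fx := fx Dx.
    suff : g ^~ x @ \oo --> ((fastlim f x - f k x) ^+ 2)%:E.
      by move=> /cvg_limn_einf_sup[-> _].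
    apply: cvg_EFin; first exact: nearW.
    have h : (fun n => f (k + n) x - f k x) @ \oo --> (fastlim f x - f k x).
      apply: cvgB; last exact: cvg_cst.
      have := fx; rewrite -(cvg_shiftn k); apply: cvg_trans.
      by under eq_fun do rewrite addnC.
    rewrite expr2 (_ : _ \o _ = (fun n => (f (k + n) x - f k x) * (f (k + n) x - f k x))).
      exact: cvgM.
    by apply/funext => n; rewrite /g /= expr2.
apply: (le_trans (fatou mu mD mg g0)); rewrite limn_einf_lim.
apply: lime_le; first exact: is_cvg_einfs.
apply: nearW => n; apply: (@le_trans _ _ (\int[mu]_(x in D) g n x)%E).
  by apply: ereal_inf_lbound; exists n => /=.
exact: fast_cauchy_msq.
Qed.

End fast_cauchy.

(** * Moments of the centered normal law *)

Section normal_moments.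
Context (R : realType) (s : R).
Hypothesis s_gt0 : 0 < s.
Notation mu := (@lebesgue_measure R).

(** The normal law has a density, so its moments are Lebesgue integrals. *)
Lemma ge0_integral_normal_prob (f : R -> \bar R) :
  measurable_fun [set: measurableTypeR R] f -> (forall x, 0 <= f x)%E ->
  (\int[normal_prob 0 s]_x f x = \int[mu]_x (f x * (normal_pdf 0 s x)%:E))%E.
Proof.
move=> mf f0.
have dom := normal_prob_dominates (0 : R) s.
rewrite -(Radon_Nikodym_SigmaFinite.change_of_variables dom)//.
apply: ae_eq_integral => //.
- apply: emeasurable_funM => //.
  by apply: (measurable_int mu); exact: Radon_Nikodym_SigmaFinite.f_integrable.
- apply: emeasurable_funM => //; apply/measurable_EFinP.
  exact: measurable_normal_pdf.
- apply: ae_eqe_mul2l; apply: integral_ae_eq => //.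
  + exact: Radon_Nikodym_SigmaFinite.f_integrable.
  + by apply/measurable_EFinP; exact: measurable_normal_pdf.
  + by move=> E _ mE; rewrite -Radon_Nikodym_SigmaFinite.f_integral.
Qed.

Let g (x : R) : R := normal_pdf 0 s x.

Let gE x : g x = normal_peak s * expR (- (s ^+ 2 *+ 2)^-1 * x ^+ 2).
Proof.
rewrite /g /normal_pdf gt_eqF// /normal_fun subr0.
by congr (_ * expR _); ring.
Qed.
(** An antiderivative of x^2 g(x) - s^2 g(x), since g'(x) = - x g(x) / s^2. *)
Let F (x : R) : R := - s ^+ 2 * (x * g x).

Let dg (x : R) : is_derive x 1 g (- x / s ^+ 2 * g x).
Proof.
rewrite (_ : g = (fun x => normal_peak s * expR (- (s ^+ 2 *+ 2)^-1 * x ^+ 2))); last first.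
  by apply/funext => t; exact: gE.
apply: is_derive_eq; rewrite /GRing.scale/=.
by field; rewrite gt_eqF.
Qed.

Let dF (x : R) : is_derive x 1 F (x ^+ 2 * g x - s ^+ 2 * g x).
Proof.
have := dg x => ?.
apply: is_derive_eq; rewrite /GRing.scale/=.
by field; rewrite gt_eqF.
Qed.

Let mg : measurable_fun [set: R] g.
Proof. exact: measurable_normal_pdf. Qed.

Let g_ge0 x : 0 <= g x.
Proof. exact: normal_pdf_ge0. Qed.

Let cg : continuous g.
Proof. by move=> x; apply: differentiable_continuous; apply/derivable1_diffP; have := dg x => -[]. Qed.

Let cF : continuous F.
Proof. by move=> x; apply: differentiable_continuous; apply/derivable1_diffP; have := dF x => -[]. Qed.

Let G (n : nat) : set R := `[- n.+1%:R, n.+1%:R].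

Let bigcupG : \bigcup_n G n = [set: R].
Proof.
apply/seteqP; split => // x _.
exists (Num.truncn `|x|) => //; rewrite /G /= in_itv/=.
by rewrite -ler_norml; apply/ltW; exact: truncnS_gt.
Qed.

Let nondecrG : nondecreasing_seq G.
Proof.
move=> m n mn; rewrite subsetEset; apply: subset_itv; rewrite bnd_simp.
  by rewrite lerN2 ler_nat ltnS.
by rewrite ler_nat ltnS.
Qed.

Let mG n : measurable (G n : set (measurableTypeR R)). Proof. exact: measurable_itv. Qed.

Let intG n : (\int[mu]_(x in G n) (x ^+ 2 * g x - s ^+ 2 * g x)%:E =
  (F n.+1%:R)%:E - (F (- n.+1%:R))%:E)%E.
Proof.
apply: continuous_FTC2.
- by rewrite -subr_gt0 opprK addr_gt0.
- apply: continuous_subspaceT => x; apply: cvgB.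
    by apply: cvgM; [exact: exprn_continuous|exact: cg].
  by apply: cvgM; [exact: cvg_cst|exact: cg].
- split => [x _||].
  + by have := dF x => -[].
  + exact/cvg_at_right_filter/cF.
  + exact/cvg_at_left_filter/cF.
- by move=> x _; rewrite derive1E; have := dF x => -[_ ->].
Qed.

Let intGE n : (\int[mu]_(x in G n) (x ^+ 2 * g x)%:E =
  (s ^+ 2)%:E * (\int[mu]_(x in G n) (g x)%:E) +
  (F n.+1%:R - F (- n.+1%:R))%:E)%E.
Proof.
have ig : mu.-integrable (G n) (EFin \o g).
  by apply: integrableS (integrable_normal_pdf _ _) => //; exact: mG.
have ix : mu.-integrable (G n) (EFin \o (fun x => x ^+ 2 * g x)).
  apply: continuous_compact_integrable; first exact: segment_compact.
  apply: continuous_subspaceT => x.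
  by apply: cvgM; [exact: exprn_continuous|exact: cg].
have igs : mu.-integrable (G n) (EFin \o (fun x => s ^+ 2 * g x)).
  exact: (integrableZl (mG n) (s ^+ 2) ig).
rewrite EFinB -intG.
under [X in (_ = _ + X)%E]eq_integral do rewrite EFinB.
rewrite integralB_EFin//.
under [X in (_ = _ + (_ - X))%E]eq_integral do rewrite EFinM.
rewrite integralZl//.
rewrite addeC subeK//.
by rewrite fin_numM//; apply: integrable_fin_num ig; exact: mG.
Qed.

(** The boundary terms of the integration by parts vanish. *)
Let cvgF : (F n.+1%:R - F (- n.+1%:R)) @[n --> \oo] --> (0 : R).
Proof.
pose b := 2 * s ^+ 2 * normal_peak s * (s ^+ 2 *+ 2).
have b0 : 0 <= b by rewrite /b; apply: mulr_ge0; rewrite ?mulrn_wge0 ?sqr_ge0// mulr_ge0 ?normal_peak_ge0// mulr_ge0// sqr_ge0.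
have Fb n : `|F n.+1%:R - F (- n.+1%:R)| <= b * n.+1%:R^-1.
  rewrite /F !gE sqrrN; set x : R := n.+1%:R.
  have x0 : 0 < x by rewrite ltr0n.
  set e := expR _.
  have e0 : 0 <= e by exact: expR_ge0.
  rewrite (_ : _ - _ = - (2 * s ^+ 2 * normal_peak s * (x * e))); last by ring.
  rewrite normrN ger0_norm; last first.
    by rewrite !mulr_ge0 ?normal_peak_ge0 ?sqr_ge0// ltW.
  rewrite /b -[leRHS]mulrA; apply: ler_wpM2l.
    by rewrite mulr_ge0 ?normal_peak_ge0// mulr_ge0// sqr_ge0.
  have v0 : 0 < s ^+ 2 *+ 2 by rewrite mulrn_wgt0// exprn_gt0.
  rewrite ler_pdivlMr//.
  have : e * (1 + (s ^+ 2 *+ 2)^-1 * x ^+ 2) <= 1.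
    
    rewrite /e mulNr expRN ler_pdivrMl ?expR_gt0// mulr1.
    exact: expR_ge1Dx.
  move=> h.
  have -> : x * e * x = (s ^+ 2 *+ 2) * (e * ((s ^+ 2 *+ 2)^-1 * x ^+ 2)).
    by field; rewrite gt_eqF.
  apply: (ler_piMr (ltW v0)); apply: le_trans h.
  by rewrite mulrDr mulr1 lerDr.
apply/norm_cvg0P.
apply: (@squeeze_cvgr _ _ _ _ (fun=> 0) (fun n => b * n.+1%:R^-1)).
- by apply: nearW => n; rewrite normr_ge0 Fb.
- exact: cvg_cst.
- rewrite -[X in _ --> X](mulr0 b); apply: cvgM; first exact: cvg_cst.
  exact: cvg_harmonic.
Qed.

Lemma normal_second_moment : (\int[normal_prob 0 s]_x (x ^+ 2)%:E = (s ^+ 2)%:E)%E.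
Proof.
rewrite ge0_integral_normal_prob; last 2 first.
- by apply/measurable_EFinP; exact: exprn_measurable.
- by move=> x; rewrite lee_fin sqr_ge0.
under eq_integral do rewrite -EFinM.
have mxg : measurable_fun [set: R] (fun x => (x ^+ 2 * g x)%:E).
  by apply/measurable_EFinP; apply: measurable_funM => //; exact: exprn_measurable.
have h : (\int[mu]_(x in G n) (x ^+ 2 * g x)%:E)%E @[n --> \oo] -->
         (\int[mu]_x (x ^+ 2 * g x)%:E)%E.
  rewrite -bigcupG; apply: ge0_nondecreasing_set_cvg_integral => //.
  - by move=> n; apply: measurable_funTS.
  - by move=> n x _; rewrite lee_fin mulr_ge0 ?sqr_ge0.
rewrite -(cvg_lim _ h)//; apply/cvg_lim => //.
rewrite (_ : (fun n => _) = (fun n => (s ^+ 2)%:E * (\int[mu]_(x in G n) (g x)%:E) +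
  (F n.+1%:R - F (- n.+1%:R))%:E)%E); last by apply/funext => n; exact: intGE.
rewrite [X in _ --> X](_ : _ = (s ^+ 2)%:E * 1 + 0)%E; last by rewrite mule1 adde0.
apply: cvgeD => //; last by apply: cvg_EFin; [exact: nearW|exact: cvgF].
apply: cvgeZl => //.
rewrite -(integral_normal_pdf 0 s) -bigcupG.
apply: ge0_nondecreasing_set_cvg_integral => //.
- by move=> n; apply: measurable_funTS; apply/measurable_EFinP.
- by move=> n x _; rewrite lee_fin.
Qed.

(** The density is even. *)
Lemma normal_pos_neg_part :
  (\int[normal_prob 0 s]_x (Num.max x 0)%:E =
   \int[normal_prob 0 s]_x (Num.max (- x) 0)%:E)%E.
Proof.
rewrite !ge0_integral_normal_prob; last 4 first.
- by apply/measurable_EFinP; apply: measurable_maxr => //; exact: measurable_funN.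
- by move=> x; rewrite lee_fin le_max lexx orbT.
- by apply/measurable_EFinP; exact: measurable_maxr.
- by move=> x; rewrite lee_fin le_max lexx orbT.
rewrite [RHS](_ : _ = \int[pushforward mu (-%R : _ -> measurableTypeR R)]_x
   ((Num.max (- x) 0)%:E * (normal_pdf 0 s x)%:E))%E; last first.
  by apply: eq_measure_integral => A mA _; exact/esym/lebesgue_measureN.
rewrite ge0_integral_pushforward; first last.
- by move=> x _; rewrite -EFinM lee_fin mulr_ge0// le_max lexx orbT.
- apply: emeasurable_funM; last exact/measurable_EFinP.
  by apply/measurable_EFinP; apply: measurable_maxr => //; exact: measurable_funN.
- exact: measurableT.
- exact: oppr_measurable.
rewrite preimage_setT; apply: eq_integral => x _ /=.
by rewrite opprK -/(g x) -/(g (- x)) !gE sqrrN.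
Qed.

End normal_moments.

Section normal_variables.
Context d (T : measurableType d) (R : realType) (P : probability T R) (s : R).
Variable X : T -> R.
Hypotheses (s_gt0 : 0 < s) (mX : measurable_fun [set: T] X).
Hypothesis XN : forall A : set R, measurable A -> P (X @^-1` A) = normal_prob 0 s A.

Lemma integral_normal_var (f : R -> \bar R) :
  measurable_fun [set: measurableTypeR R] f -> (forall x, 0 <= f x)%E ->
  (\int[P]_w f (X w) = \int[normal_prob 0 s]_x f x)%E.
Proof.
move=> mf f0.
transitivity (\int[pushforward P (X : T -> measurableTypeR R)]_x f x)%E.
  by rewrite ge0_integral_pushforward.
by apply: eq_measure_integral => A mA _; exact: XN.
Qed.

Lemma normal_var_msq : msq P [set: T] X = (s ^+ 2)%:E.
Proof.
rewrite -(normal_second_moment s_gt0) -integral_normal_var//.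
- by apply/measurable_EFinP; exact: exprn_measurable.
- by move=> x; rewrite lee_fin sqr_ge0.
Qed.

Lemma normal_var_integral0 : (\int[P]_w (X w)%:E = 0)%E.
Proof.
rewrite integralE.
have -> : (\int[P]_w ((fun w => (X w)%:E)^\+ w) = \int[P]_w (Num.max (X w) 0)%:E)%E.
  by apply: eq_integral => w _; rewrite funeposE/= EFin_max.
have -> : (\int[P]_w ((fun w => (X w)%:E)^\- w) = \int[P]_w (Num.max (- X w) 0)%:E)%E.
  by apply: eq_integral => w _; rewrite funenegE/= EFin_max.
rewrite (@integral_normal_var (fun x => (Num.max x 0)%:E)); last 2 first.
- by apply/measurable_EFinP; exact: measurable_maxr.
- by move=> x; rewrite lee_fin le_max lexx orbT.
rewrite (@integral_normal_var (fun x => (Num.max (- x) 0)%:E)); last 2 first.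
- by apply/measurable_EFinP; apply: measurable_maxr => //; exact: measurable_funN.
- by move=> x; rewrite lee_fin le_max lexx orbT.
rewrite normal_pos_neg_part// subee// ge0_fin_numE; last first.
  by apply: integral_ge0 => x _; rewrite lee_fin le_max lexx orbT.
apply: (@le_lt_trans _ _ (\int[normal_prob 0 s]_x (1 + x ^+ 2)%:E)%E).
  apply: ge0_le_integralW => x _; rewrite lee_fin; first by rewrite le_max lexx orbT.
  rewrite ge_max addr_ge0 ?sqr_ge0// andbT.
  by have := sqr_ge0 (1 + 2 * x); nra.
under eq_integral do rewrite EFinD.
rewrite ge0_integralD//; last 2 first.
- by move=> x _; rewrite lee_fin sqr_ge0.
- by apply/measurable_EFinP; exact: exprn_measurable.
rewrite integral_cst// normal_second_moment//.
by rewrite mul1e [X in (X + _)%E]probability_setT -EFinD ltry.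
Qed.

End normal_variables.

(** * Independence *)

Lemma pi_lambda (T : Type) (G H : set (set T)) :
  setI_closed G -> G `<=` H -> dynkin H -> <<s G >> `<=` H.
Proof.
move=> GI GH /dynkin_lambda_system HD.
exact: (lambda_system_subset GI HD GH (fun X _ => @subsetT _ X)).
Qed.

Section independence.
Context d (T : measurableType d) (R : realType) (P : probability T R).

Lemma probability_ae_eq (A A' : set T) : measurable A -> measurable A' ->
  {ae P, forall w, A w <-> A' w} -> P A = P A'.
Proof.
move=> mA mA' AA'.
rewrite -[A]setIT -[A']setIT -!integral_indic//.
apply: ge0_ae_eq_integral => //.
- by apply/measurable_EFinP; exact: measurable_indic.
- by apply/measurable_EFinP; exact: measurable_indic.
- move: AA'; apply: filterS => x Axx _; congr (_%:E).
  by rewrite !indicE; congr (nat_of_bool _)%:R; apply/idP/idP => /set_mem/Axx/mem_set.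
Qed.

Lemma dynkin_independent (V : set T) : measurable V ->
  dynkin [set A | measurable A /\ P (A `&` V) = (P A * P V)%E].
Proof.
move=> mV; split => /=.
- by split => //; rewrite setTI probability_setT mul1e.
- move=> A [mA AV]; split; first exact: measurableC.
  have -> : P (~` A `&` V) = (P V - P (A `&` V))%E.
    rewrite [in LHS]setIC -setDE (setIC A) measureD//.
    by rewrite (le_lt_trans (probability_le1 _ _)) ?ltry.
  have -> : P (~` A) = (1 - P A)%E by rewrite probability_setC.
  rewrite AV -(fineK (fin_num_measure P A mA)) -(fineK (fin_num_measure P V mV)).
  set a := fine (P A); set v := fine (P V).
  have av : v - a * v = (1 - a) * v by ring.
  exact: (congr1 EFin av).
- move=> F tF FV.
  have mF n : measurable (F n) by have [] := FV n.
  split; first exact: bigcup_measurable.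
  rewrite setI_bigcupl measure_bigcup//; last 2 first.
  + by move=> n _; exact: measurableI.
  + exact: trivIset_setIr.
  rewrite measure_bigcup//.
  rewrite muleC -(fineK (fin_num_measure P V mV)) -nneseriesZl//.
  apply: eq_eseriesr => n _.
  transitivity (P (F n) * P V)%E; first by have [] := FV n.
  by rewrite (fineK (fin_num_measure P V mV)) muleC.
Qed.

(** The joint law of independent variables is a product measure, so Fubini's
    theorem factors the expectation of a product. *)
Lemma independent_mul (X Y : {mfun T >-> R}) :
  (forall A U : set R, measurable A -> measurable U ->
    P (X @^-1` A `&` Y @^-1` U) = (P (X @^-1` A) * P (Y @^-1` U))%E) ->
  P.-integrable [set: T] (EFin \o X) -> P.-integrable [set: T] (EFin \o Y) ->
  P.-integrable [set: T] (EFin \o (X \* Y)) /\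
  (\int[P]_w (X w * Y w)%:E = (\int[P]_w (X w)%:E) * (\int[P]_w (Y w)%:E))%E.
Proof.
move=> XY iX iY.
pose mu1 : probability R R := distribution P X.
pose mu2 : probability R R := distribution P Y.
pose Z w := (X w, Y w).
have mZ : measurable_fun [set: T] Z by exact: measurable_fun_pair.
pose Z' : {mfun T >-> (R * R)%type} := HB.pack Z (isMeasurableFun.Build _ _ _ _ Z mZ).
have mu12E (A : set (R * R)) : measurable A -> (mu1 \x mu2)%E A = pushforward P Z' A.
  move=> mA; apply: (@product_measure_unique _ _ _ _ _ _ _ (distribution P Z')) => // A1 A2; exact: XY.
pose f (p : R * R) : \bar R := (p.1 * p.2)%:E.
have mf : measurable_fun [set: R * R] f.
  by apply/measurable_EFinP; apply: measurable_funM; [exact: measurable_fst|exact: measurable_snd].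
have iX1 : (\int[mu1]_x `|x%:E| = \int[P]_w `|(X w)%:E|)%E.
  rewrite (@ge0_integral_distribution _ _ _ _ _ P X (fun x => `|x%:E|%E))//.
  exact: measurableT_comp.
have iY1 : (\int[mu2]_x `|x%:E| = \int[P]_w `|(Y w)%:E|)%E.
  rewrite (@ge0_integral_distribution _ _ _ _ _ P Y (fun x => `|x%:E|%E))//.
  exact: measurableT_comp.
have /integrableP[_ fX] := iX.
have /integrableP[_ fY] := iY.
have finY : (\int[P]_w `|(Y w)%:E|)%E \is a fin_num.
  by rewrite ge0_fin_numE//; apply: integral_ge0.
have if12 : (mu1 \x mu2)%E.-integrable [set: R * R] f.
  apply/integrable12ltyP => //.
  under eq_integral => x _.
    under eq_integral => y _ do rewrite /f/= normrM EFinM.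
    rewrite ge0_integralZl_EFin//; last by apply/measurable_EFinP.
    rewrite iY1 -(fineK finY) muleC.
    over.
  rewrite ge0_integralZl_EFin//; last 2 first.
  - by apply/measurable_EFinP.
  - by rewrite fine_ge0// integral_ge0.
  by rewrite iX1 lte_mul_pinfty// ?lee_fin ?fine_ge0// integral_ge0.
have iZ : P.-integrable [set: T] (f \o Z).
  apply/integrableP; split; first exact: measurableT_comp.
  have /integrableP[_] := if12; apply: le_lt_trans.
  rewrite (@eq_measure_integral _ _ _ _ (distribution P Z')); last first.
    by move=> A mA _; exact: mu12E.
  rewrite ge0_integral_distribution//.
  exact: measurableT_comp.
split => //.
transitivity (\int[mu1 \x mu2]_z f z)%E.
  rewrite [RHS](@eq_measure_integral _ _ _ _ (distribution P Z')); last first.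
    by move=> A mA _; exact: mu12E.
  by rewrite integral_distribution.
rewrite -integral12_prod_meas1//.
have i1 : mu1.-integrable [set: R] (fun x => x%:E).
  by apply/integrableP; split; [exact: EFin_measurable|rewrite iX1].
have i2 : mu2.-integrable [set: R] (fun x => x%:E).
  by apply/integrableP; split; [exact: EFin_measurable|rewrite iY1].
rewrite -(@integral_distribution _ _ _ _ _ P X EFin)//.
rewrite -(@integral_distribution _ _ _ _ _ P Y EFin)//.
have finEY : (\int[mu2]_x x%:E)%E \is a fin_num by exact: integrable_fin_num.
transitivity (\int[mu1]_x ((fine (\int[mu2]_x x%:E))%:E * x%:E))%E.
  apply: eq_integral => x _; rewrite /fubini_F /f/= (fineK finEY) [RHS]muleC.
  by under eq_integral do rewrite EFinM; rewrite integralZl.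
by rewrite integralZl//= (fineK finEY) muleC.
Qed.

End independence.

(** * The past of a point of the Brownian sheet *)

Section sheet_history.
Context d (Omega : measurableType d) (R : realType) (P : probability Omega R).
Variable B : R * R -> Omega -> R.
Hypotheses (P_complete : measure_is_complete P) (B_sheet : brownian_sheet P B).
Implicit Types (l u s z : R * R) (w : Omega).

Lemma negligible_measurable (A : set Omega) : P.-negligible A -> measurable A.
Proof. exact: P_complete. Qed.

Lemma measurable_incr l u : quadrant l -> quadrant u ->
  measurable_fun [set: Omega] (incr B l u).
Proof.
move=> [l1 l2] [u1 u2]; rewrite /incr.
by apply: measurable_funD; [apply: measurable_funB; [apply: measurable_funB|]|];
  apply: (sheet_measurable B_sheet).
Qed.

(** The complement of the open upper-right quarter plane at l.  The increment of
    the sheet over any rectangle with lower-left corner l is independent of its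
    values there, a stronger property than independence of the filtration at l;
    the stronger form is what makes increments over disjoint rectangles with
    adapted coefficients orthogonal, whatever their relative position. *)
Definition past_region l : set (R * R) :=
  [set s | [/\ 0 <= s.1, 0 <= s.2 & s.1 <= l.1 \/ s.2 <= l.2]].

Definition history l : set (set Omega) :=
  <<s [set A | (exists s (U : set R),
                  [/\ past_region l s, measurable U & A = B s @^-1` U])
               \/ P.-negligible A] >>.

Lemma sheet_filtration_history z l : z.1 <= l.1 \/ z.2 <= l.2 ->
  sheet_filtration P B z `<=` history l.
Proof.
move=> zl; apply: sub_sigma_algebra2 => A [|?]; last by right.
move=> [s [U [/andP[s0 s1] /andP[s2 s3] mU ->]]]; left; exists s, U; split=> //.
by split=> //; case: zl => ?; [left|right]; exact: le_trans (_ : z.1 <= _) || exact: le_trans (_ : z.2 <= _).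
Qed.

Definition cylinder (L : seq ((R * R) * set R)) : set Omega :=
  foldr (fun p E => B p.1 @^-1` p.2 `&` E) setT L.

Lemma cylinder_cat L1 L2 : cylinder (L1 ++ L2) = cylinder L1 `&` cylinder L2.
Proof. by elim: L1 => [|p L1 ih] /=; rewrite ?setTI// ih setIA. Qed.

Section grid.
Variables (l u : R * R) (ts xs : seq R).
Hypotheses (lu : proper_rect l u).
Hypotheses (ts_sorted : sorted <%R ts) (xs_sorted : sorted <%R xs).
Hypotheses (ts0 : 0 \in ts) (xs0 : 0 \in xs).
Hypotheses (ts_ge0 : all (>= 0) ts) (xs_ge0 : all (>= 0) xs).

Let t i := nth 0 ts i.
Let x i := nth 0 xs i.
Let lo_cell (ij : nat * nat) := (t ij.1, x ij.2).
Let up_cell (ij : nat * nat) := (t ij.1.+1, x ij.2.+1).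

(** The cells of the grid that lie in the past of l; rect l u is disjoint from
    them. *)
Let cells : seq (nat * nat) :=
  [seq ij <- [seq (i, j) | i <- index_iota 0 (size ts).-1, j <- index_iota 0 (size xs).-1]
   | (t ij.1.+1 <= l.1) || (x ij.2.+1 <= l.2)].

Let uniq_cells : uniq cells.
Proof. by rewrite filter_uniq// allpairs_uniq ?iota_uniq// => -[? ?] [? ?]. Qed.

Let sorted_nth0 (r : seq R) : sorted <%R r -> 0 \in r -> all (>= 0) r -> nth 0 r 0 = 0.
Proof.
case: r => [//|a r] /= ar; rewrite in_cons => /orP[/eqP<-//|r0] /andP[a0 _].
have := order_path_min lt_trans ar => /allP/(_ _ r0).
by rewrite ltNge a0.
Qed.

Let cell_mem ij : ij \in cells -> (ij.1.+1 < size ts)%N /\ (ij.2.+1 < size xs)%N.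
Proof.
rewrite mem_filter => /andP[_ /allpairsP[[i j]]] /= [].
rewrite !mem_index_iota/= => hi hj ->/=.
by split; [move: hi|move: hj]; case: (size _).
Qed.

Let t_ltn i j : (i < j)%N -> (j < size ts)%N -> t i < t j.
Proof. by move=> ij js; apply: (sorted_ltn_nth lt_trans) => //; rewrite inE// (ltn_trans ij). Qed.
Let x_ltn i j : (i < j)%N -> (j < size xs)%N -> x i < x j.
Proof. by move=> ij js; apply: (sorted_ltn_nth lt_trans) => //; rewrite inE// (ltn_trans ij). Qed.
Let t_leq i j : (i <= j)%N -> (j < size ts)%N -> t i <= t j.
Proof. by rewrite leq_eqVlt => /predU1P[->//|ij js]; exact/ltW/t_ltn. Qed.
Let x_leq i j : (i <= j)%N -> (j < size xs)%N -> x i <= x j.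
Proof. by rewrite leq_eqVlt => /predU1P[->//|ij js]; exact/ltW/x_ltn. Qed.
Let t_ge0 i : 0 <= t i.
Proof.
by rewrite /t; case: (ltnP i (size ts)) => [h|h]; [move/allP: ts_ge0 => /(_ _ (mem_nth 0 h))|rewrite nth_default].
Qed.
Let x_ge0 i : 0 <= x i.
Proof.
by rewrite /x; case: (ltnP i (size xs)) => [h|h]; [move/allP: xs_ge0 => /(_ _ (mem_nth 0 h))|rewrite nth_default].
Qed.

Let Z k := incr B (lo_cell (nth (0, 0)%N cells k)) (up_cell (nth (0, 0)%N cells k)).
Let n := size cells.

Let mZ k : measurable_fun [set: Omega] (Z k).
Proof. by apply: measurable_incr; split => /=. Qed.

Let Lf (k : 'I_n.+1) := if val k is k'.+1 then lo_cell (nth (0, 0)%N cells k') else l.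
Let Uf (k : 'I_n.+1) := if val k is k'.+1 then up_cell (nth (0, 0)%N cells k') else u.

Let proper_f k : proper_rect (Lf k) (Uf k).
Proof.
rewrite /Lf /Uf; case: k => -[//|k] /= kn.
have [c1 c2] := cell_mem (mem_nth (0, 0)%N (kn : (k < size cells)%N)).
by split; [split; [exact: t_ge0|exact: x_ge0]|exact: t_ltn|exact: x_ltn].
Qed.

Let cell_cell_disj c c' : c \in cells -> c' \in cells -> c != c' ->
  rect (lo_cell c) (up_cell c) `&` rect (lo_cell c') (up_cell c') = set0.
Proof.
case: c c' => [i j] [i' j'] /cell_mem/= [ci cj] /cell_mem/= [ci' cj'] cc.
apply/seteqP; split => // -[a b] [] /= [/andP[+ +] /andP[+ +]] [/andP[+ +] /andP[+ +]].
rewrite /lo_cell /up_cell /=.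
have [ii|ii|ii] := ltngtP i i'.
- by have := t_leq ii (ltnW ci'); lra.
- by have := t_leq ii (ltnW ci); lra.
have [jj|jj|jj] := ltngtP j j'.
- by have := x_leq jj (ltnW cj'); lra.
- by have := x_leq jj (ltnW cj); lra.
by move: cc; rewrite ii jj eqxx.
Qed.

Let cell_lu_disj c : c \in cells ->
  rect (lo_cell c) (up_cell c) `&` rect l u = set0.
Proof.
rewrite mem_filter => /andP[/orP h _].
apply/seteqP; split => // -[a b] [] /= [/andP[+ +] /andP[+ +]] [/andP[+ +] /andP[+ +]].
by case: h; rewrite /lo_cell /up_cell /=; lra.
Qed.

Let disj_f i j : i != j -> rect (Lf i) (Uf i) `&` rect (Lf j) (Uf j) = set0.
Proof.
rewrite /Lf /Uf; case: i j => -[|i] ilt [] [|j] jlt //= ij.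
- by rewrite setIC; apply: cell_lu_disj; apply: mem_nth.
- by apply: cell_lu_disj; apply: mem_nth.
- apply: cell_cell_disj; try exact: mem_nth.
  by rewrite nth_uniq//; move: ij; rewrite -val_eqE.
Qed.

(** Events that prescribe the mass of each cell: a pi-system on which the
    independence of the increment over rect l u is part of the definition of the
    sheet. *)
Let Ggen : set (set Omega) := [set E | exists2 A : nat -> set R,
  (forall k, measurable (A k)) & E = \bigcap_(k in [set k | (k < n)%N]) Z k @^-1` A k].

Let Ggen_indep E (U : set R) : measurable U -> Ggen E ->
  P (E `&` incr B l u @^-1` U) = (P E * P (incr B l u @^-1` U))%E.
Proof.
move=> mU [A mA ->].
pose A' (U : set R) (k : 'I_n.+1) := if val k is k'.+1 then A k' else U.
have mA' V : measurable V -> forall k, measurable (A' V k).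
  by move=> mV; rewrite /A' => -[[|k] kn] /=.
have key V : measurable V ->
    P (\bigcap_(k in [set k | (k < n)%N]) Z k @^-1` A k `&` incr B l u @^-1` V) =
    (P (incr B l u @^-1` V) * \big[*%E/1%E]_(k < n) P (Z k @^-1` A k))%E.
  move=> mV.
  have := sheet_independent B_sheet proper_f disj_f (mA' _ mV).
  rewrite big_ord_recl /=; congr (_ = _); congr (P _).
  apply/seteqP; split => w /=.
    move=> h; split; last by have := h ord0 I.
    by move=> k /= kn; have := h (lift ord0 (Ordinal kn)) I.
  move=> [h1 h2] [[|k] kn] _ //=.
  by have := h1 k kn.
rewrite key//; have := key setT measurableT.
rewrite preimage_setT setIT probability_setT mul1e => ->.
by rewrite muleC.
Qed.

Let Ggen_setI : setI_closed Ggen.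
Proof.
move=> _ _ [A mA ->] [A' mA' ->]; exists (fun k => A k `&` A' k).
  by move=> k; exact: measurableI.
apply/seteqP; split => w /=.
  by move=> [h h'] k kn; split; [exact: h|exact: h'].
by move=> h; split=> k kn; have [] := h k kn.
Qed.

Let Ggen_measurable : Ggen `<=` @measurable _ Omega.
Proof.
move=> _ [A mA ->]; apply: bigcap_measurableType => k _.
by rewrite -[X in measurable X]setTI; exact: mZ.
Qed.

Let G_indep E (U : set R) : measurable U -> <<s Ggen >> E ->
  measurable E /\ P (E `&` incr B l u @^-1` U) = (P E * P (incr B l u @^-1` U))%E.
Proof.
move=> mU; move: E; apply: pi_lambda => //.
- by move=> E GE; split; [exact: Ggen_measurable|exact: Ggen_indep].
- apply: dynkin_independent; rewrite -[X in measurable X]setTI.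
  by case: lu => lq l1 l2; apply: measurable_incr => //;
    case: lq => l10 l20; split; exact: ltW (le_lt_trans _ l1) || exact: ltW (le_lt_trans _ l2).
Qed.

(** The value at a grid point is the total mass of the cells below it, up to the
    null event that the sheet does not vanish on the axes. *)
Let Bsum s w := \sum_(i < index s.1 ts) \sum_(j < index s.2 xs)
  incr B (t i, x j) (t i.+1, x j.+1) w.

Let Bsum_ae s : s.1 \in ts -> s.2 \in xs -> {ae P, forall w, B s w = Bsum s w}.
Proof.
move=> s1 s2.
set a := index s.1 ts; set b := index s.2 xs.
have axis p : 0 <= p.1 -> 0 <= p.2 -> p.1 = 0 \/ p.2 = 0 -> {ae P, forall w, B p w = 0}.
  by move=> p1 p2 p0; apply: (sheet_axes B_sheet).
have h1 := axis (t 0%N, x b) (t_ge0 _) (x_ge0 _) (or_introl (sorted_nth0 ts_sorted ts0 ts_ge0)).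
have h2 := axis (t a, x 0%N) (t_ge0 _) (x_ge0 _) (or_intror (sorted_nth0 xs_sorted xs0 xs_ge0)).
have h3 := axis (t 0%N, x 0%N) (t_ge0 _) (x_ge0 _) (or_intror (sorted_nth0 xs_sorted xs0 xs_ge0)).
move: h1 h2 h3; apply: filterS3 => w h1 h2 h3.
have row i : \sum_(j < b) incr B (t i, x j) (t i.+1, x j.+1) w =
    B (t i.+1, x b) w - B (t i, x b) w - (B (t i.+1, x 0%N) w - B (t i, x 0%N) w).
  elim: b {h1} => [|b' ih]; first by rewrite big_ord0; ring.
  by rewrite big_ord_recr/= ih /incr/=; ring.
have all_rows : Bsum s w = B (t a, x b) w - B (t 0%N, x b) w -
    (B (t a, x 0%N) w - B (t 0%N, x 0%N) w).
  rewrite /Bsum -/a -/b; elim: a {h2} => [|a' ih]; first by rewrite big_ord0; ring.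
  by rewrite big_ord_recr/= ih row; ring.
rewrite all_rows h1 h2 h3 !subr0 /t /x /a /b !nth_index//.
by case: (s).
Qed.

Let measurable_Bsum s : past_region l s -> s.1 \in ts -> s.2 \in xs ->
  forall U : set R, measurable U -> <<s Ggen >> (Bsum s @^-1` U).
Proof.
move=> [_ _ ls] s1 s2.
suff : measurable_fun [set: g_sigma_algebraType Ggen] (Bsum s).
  by move=> mB U mU; rewrite -[Bsum s @^-1` U]setTI; exact: mB.
apply: measurable_sum => i; apply: measurable_sum => j.
have ij_cells : (i : nat, j : nat) \in cells.
  have ia : (i < index s.1 ts)%N by [].
  have jb : (j < index s.2 xs)%N by [].
  rewrite mem_filter; apply/andP; split.
    apply/orP; case: ls => h; [left|right]; apply: (le_trans _ h) => /=.
      by rewrite -[leRHS](nth_index 0 s1); apply: t_leq => //; rewrite index_mem.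
    by rewrite -[leRHS](nth_index 0 s2); apply: x_leq => //; rewrite index_mem.
  apply/allpairsP; exists (i : nat, j : nat); split => //=.
    rewrite mem_index_iota/= -ltnS prednK//; first by rewrite (leq_ltn_trans ia) ?index_mem.
    by rewrite (leq_ltn_trans _ (_ : index s.1 ts < _)%N) ?index_mem.
  rewrite mem_index_iota/= -ltnS prednK//; first by rewrite (leq_ltn_trans jb) ?index_mem.
  by rewrite (leq_ltn_trans _ (_ : index s.2 xs < _)%N) ?index_mem.
move=> _ U mU; rewrite setTI.
apply: sub_sigma_algebra.
exists (fun k => if k == index (i : nat, j : nat) cells then U else setT).
  by move=> k; case: ifP.
apply/seteqP; split => w /=.
  move=> wU k kn; case: eqP => // ->.
  by rewrite /Z nth_index.
move=> h; have := h (index (i : nat, j : nat) cells).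
by rewrite /= index_mem ij_cells eqxx /Z nth_index//; apply.
Qed.

Lemma grid_cylinder_indep (L : seq ((R * R) * set R)) (U : set R) :
  List.Forall (fun p => [/\ past_region l p.1, p.1.1 \in ts, p.1.2 \in xs
                          & measurable p.2]) L ->
  measurable U ->
  P (cylinder L `&` incr B l u @^-1` U) = (P (cylinder L) * P (incr B l u @^-1` U))%E.
Proof.
move=> HL mU.
have [E' [GE' mL E'L]] : exists E', [/\ <<s Ggen >> E', measurable (cylinder L) &
    {ae P, forall w, cylinder L w <-> E' w}].
  elim: HL => [|p L' [p1 p2 p3 p4] _ [E' [GE' mL E'L]]] /=.
    by exists setT; split=> //; [exact: (@measurableT _ (g_sigma_algebraType Ggen))|exact: aeW].
  exists (Bsum p.1 @^-1` p.2 `&` E'); split.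
  - apply: (@measurableI _ (g_sigma_algebraType Ggen)) => //.
    exact: measurable_Bsum.
  - apply: measurableI => //; rewrite -[X in measurable X]setTI.
    by apply: (sheet_measurable B_sheet) => //; case: p1.
  - move: (Bsum_ae p2 p3) E'L; apply: filterS2 => w h h'.
    by split => /= -[a b]; split; [rewrite -h|exact/h'|rewrite h|exact/h'].
have [mE' indE'] := G_indep mU GE'.
have mV : measurable (incr B l u @^-1` U).
  rewrite -[X in measurable X]setTI.
  by case: lu => lq l1 l2; apply: measurable_incr => //;
    case: lq => l10 l20; split; exact: ltW (le_lt_trans _ l1) || exact: ltW (le_lt_trans _ l2).
rewrite (probability_ae_eq mL mE' E'L) -indE'; apply: probability_ae_eq.
- exact: measurableI.
- exact: measurableI.
- by move: E'L; apply: filterS => w [h1 h2]; split => -[? ?]; split=> //; [exact: h1|exact: h2].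
Qed.

End grid.

(** Up to null events, the history is generated by cylinders over finite sets of
    points, and the points of a cylinder all lie on one grid. *)
Theorem history_indep l u (A : set Omega) (U : set R) : proper_rect l u ->
  history l A -> measurable U ->
  P (A `&` incr B l u @^-1` U) = (P A * P (incr B l u @^-1` U))%E.
Proof.
move=> lu hA mU.
have mV : measurable (incr B l u @^-1` U).
  rewrite -[X in measurable X]setTI.
  by case: lu => lq l1 l2; apply: measurable_incr => //;
    case: lq => l10 l20; split; exact: ltW (le_lt_trans _ l1) || exact: ltW (le_lt_trans _ l2).
pose good := List.Forall (fun p : (R * R) * set R => past_region l p.1 /\ measurable p.2).
pose pi_sys := [set A | measurable A /\ exists2 L, good L &
  {ae P, forall w, A w <-> cylinder L w}].
have good_cylinder L : good L -> measurable (cylinder L) /\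
    P (cylinder L `&` incr B l u @^-1` U) = (P (cylinder L) * P (incr B l u @^-1` U))%E.
  move=> gL; split.
    elim: gL => [|p L' [p1 p2] _ mL] /=; first exact: measurableT.
    apply: measurableI => //; rewrite -[X in measurable X]setTI.
    by apply: (sheet_measurable B_sheet) => //; case: p1.
  pose ts := sort <=%R (undup (0 :: [seq p.1.1 | p <- L])).
  pose xs := sort <=%R (undup (0 :: [seq p.1.2 | p <- L])).
  have sorted_grid (r : seq R) : sorted <%R (sort <=%R (undup r)).
    by rewrite lt_sorted_uniq_le sort_uniq undup_uniq/=; exact: sort_le_sorted.
  apply: (@grid_cylinder_indep l u ts xs) => //.
  - exact: sorted_grid.
  - exact: sorted_grid.
  - by rewrite mem_sort mem_undup mem_head.
  - by rewrite mem_sort mem_undup mem_head.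
  - rewrite all_sort; apply/allP => r; rewrite mem_undup in_cons => /predU1P[->//|].
    elim: gL => [//|p L' [[p1 p2 p3] _] _ ih] /=.
    by rewrite in_cons => /predU1P[->//|].
  - rewrite all_sort; apply/allP => r; rewrite mem_undup in_cons => /predU1P[->//|].
    elim: gL => [//|p L' [[p1 p2 p3] _] _ ih] /=.
    by rewrite in_cons => /predU1P[->//|].
  - have : {subset [seq p.1.1 | p <- L] <= ts}.
      by move=> r rL; rewrite mem_sort mem_undup in_cons rL orbT.
    have : {subset [seq p.1.2 | p <- L] <= xs}.
      by move=> r rL; rewrite mem_sort mem_undup in_cons rL orbT.
    move: ts xs => ts xs.
    elim: gL => [|p L' [p1 p2] _ ih] /= sxs sts; first exact: List.Forall_nil.
    apply: List.Forall_cons.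
      by split=> //; [apply: sts|apply: sxs]; rewrite mem_head.
    by apply: ih => r rL; [apply: sxs|apply: sts]; rewrite in_cons rL orbT.
have pi_history : history l `<=` <<s pi_sys >>.
  apply: sub_sigma_algebra2 => A' [[s [V [ps mV' ->]]]|nA].
    split; first by rewrite -[X in measurable X]setTI; apply: (sheet_measurable B_sheet) => //; case: ps.
    exists [:: (s, V)]; first by apply: List.Forall_cons => //; exact: List.Forall_nil.
    by apply: aeW => w; split => [?//|[]].
  split; first exact: negligible_measurable.
  exists [:: (l, set0)].
    apply: List.Forall_cons; last exact: List.Forall_nil.
    by split=> //=; case: lu => -[? ?] _ _; split=> //; left.
  apply: negligibleS nA => w /= h; apply: contrapT => nAw; apply: h.
  by split => // -[].
have : [set A | measurable A /\ P (A `&` incr B l u @^-1` U) =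
          (P A * P (incr B l u @^-1` U))%E] A; last by case.
apply: (pi_lambda _ _ _ (pi_history _ hA)).
- move=> A1 A2 [mA1 [L1 gL1 h1]] [mA2 [L2 gL2 h2]]; split; first exact: measurableI.
  exists (L1 ++ L2); first exact/List.Forall_app.
  rewrite cylinder_cat; move: h1 h2; apply: filterS2 => w h1 h2.
  by split => -[/h1 ? /h2 ?].
- move=> A1 [mA1 [L gL h]]; split=> //.
  have [mL indL] := good_cylinder L gL.
  rewrite (probability_ae_eq mA1 mL h) -indL; apply: probability_ae_eq.
  + exact: measurableI.
  + exact: measurableI.
  + by move: h; apply: filterS => w h; split => -[/h ? ?].
- exact: dynkin_independent.
Qed.

End sheet_history.

(** * The isometry for step functions *)

Lemma Rintegral_sum d (T : measurableType d) (R : realType)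
    (mu : {measure set T -> \bar R}) (D : set T) (mD : measurable D)
    (I : Type) (s : seq I) (f : I -> T -> R) :
  (forall i, List.In i s -> mu.-integrable D (EFin \o f i)) ->
  \int[mu]_(w in D) (\sum_(i <- s) f i w) = \sum_(i <- s) \int[mu]_(w in D) (f i w) /\
  mu.-integrable D (EFin \o (fun w => \sum_(i <- s) f i w)).
Proof.
elim: s => [_|i s ih h].
  rewrite big_nil; split.
    by under eq_Rintegral do rewrite big_nil; rewrite Rintegral_cst// mul0r.
  by apply: eq_integrable (integrable0 _ _) => // w _ /=; rewrite big_nil.
have [ih1 ih2] := ih (fun j sj => h j (or_intror sj)).
have hi := h i (or_introl erefl).
rewrite big_cons -ih1; split.
  under eq_Rintegral do rewrite big_cons.
  by rewrite RintegralD.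
have := integrableD mD hi ih2.
by apply: eq_integrable => // w _ /=; rewrite big_cons EFinD.
Qed.

Section square_integrable.
Context d (T : measurableType d) (R : realType) (P : probability T R).
Implicit Types f g : T -> R.

Definition L2 f : Prop := measurable_fun [set: T] f /\ (msq P [set: T] f < +oo)%E.

Lemma L2D f g : L2 f -> L2 g -> L2 (fun w => f w + g w).
Proof.
move=> [mf f2] [mg g2]; split; first exact: measurable_funD.
apply: (le_lt_trans (msqD P measurableT mf mg)).
by rewrite lte_add_pinfty// lte_mul_pinfty// lee_fin.
Qed.

Lemma L2_sum (I : Type) (s : seq I) (f : I -> T -> R) :
  (forall i, List.In i s -> L2 (f i)) -> L2 (fun w => \sum_(i <- s) f i w).
Proof.
elim: s => [_|i s ih h].
  under eq_fun do rewrite big_nil.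
  split; first exact: measurable_cst.
  by rewrite /msq; under eq_integral do rewrite expr0n/=; rewrite integral0 ltry.
under eq_fun do rewrite big_cons.
by apply: L2D; [apply: h; left|apply: ih => j sj; apply: h; right].
Qed.

Lemma L2_mul_bounded (K : R) f g : measurable_fun [set: T] f -> L2 g ->
  (forall w, `|f w| <= K) -> L2 (fun w => f w * g w).
Proof.
move=> mf [mg g2] fK; split; first exact: measurable_funM.
apply: (@le_lt_trans _ _ (msq P [set: T] (fun w => K * g w))).
  apply: msq_le => w _; rewrite !normrM ler_wpM2r//.
  by rewrite (le_trans (fK w))// ler_norm.
by rewrite msqZ// lte_mul_pinfty// ?lee_fin ?sqr_ge0// ltry.
Qed.

Lemma L2_cst (k : R) : L2 (fun=> k).
Proof.
split; first exact: measurable_cst.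
by rewrite /msq integral_cst//= probability_setT mule1 ltry.
Qed.

Lemma L2_bounded (K : R) f : measurable_fun [set: T] f ->
  (forall w, `|f w| <= K) -> L2 f.
Proof.
move=> mf fK.
have := @L2_mul_bounded K f (fun=> 1) mf (L2_cst 1) fK.
by under eq_fun do rewrite mulr1.
Qed.

Lemma L2_mul_integrable f g : L2 f -> L2 g -> P.-integrable [set: T] (EFin \o (f \* g)).
Proof.
move=> [mf f2] [mg g2]; apply/integrableP; split.
  by apply/measurable_EFinP; exact: measurable_funM.
apply: (@le_lt_trans _ _ (msq P [set: T] f + msq P [set: T] g)%E); last first.
  exact: lte_add_pinfty.
rewrite /msq -ge0_integralD//; try by [move=> *; rewrite lee_fin sqr_ge0|exact: measurable_sqr].
apply: ge0_le_integralW => // w _; rewrite -EFinD lee_fin /= ler_norml.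
by have := sqr_ge0 (f w + g w); have := sqr_ge0 (f w - g w); nra.
Qed.

Lemma L2_integrable f : L2 f -> P.-integrable [set: T] (EFin \o f).
Proof.
move=> f2; have := L2_mul_integrable f2 (L2_cst 1).
by apply: eq_integrable => // w _ /=; rewrite mulr1.
Qed.

Lemma msq_Rintegral f : L2 f -> msq P [set: T] f = (\int[P]_w (f w * f w))%:E.
Proof.
move=> f2; rewrite /Rintegral fineK; last first.
  by apply: integrable_fin_num => //; exact: L2_mul_integrable.
by apply: eq_integral => w _; rewrite expr2.
Qed.

End square_integrable.

Section isometry.
Context d (Omega : measurableType d) (R : realType) (P : probability Omega R).
Variable B : R * R -> Omega -> R.
Hypotheses (P_complete : measure_is_complete P) (B_sheet : brownian_sheet P B).
Local Notation step := (@step _ Omega R).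
Implicit Types (l u z : R * R) (e f : step) (X : Omega -> R).

Definition history_measurable l X : Prop :=
  measurable_fun [set: g_sigma_algebraType (history P B l)] X.

Lemma history_sub_measurable l : history P B l `<=` @measurable _ Omega.
Proof.
apply: smallest_sub; first exact: sigma_algebra_measurable.
move=> A [[s [U [[s1 s2 _] mU ->]]]|]; last exact: negligible_measurable.
by rewrite -[X in measurable X]setTI; exact: (sheet_measurable B_sheet).
Qed.

Lemma sheet_filtration_sub_measurable z : sheet_filtration P B z `<=` @measurable _ Omega.
Proof.
by move=> A /(@sheet_filtration_history _ _ _ P B z z (or_introl (lexx _)))/history_sub_measurable.
Qed.

Lemma history_measurable_set l X : history_measurable l X ->
  forall U : set R, measurable U -> history P B l (X @^-1` U).
Proof.
move=> hX U mU; have := hX measurableT U mU; rewrite setTI.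
by rewrite /measurable/= sigma_algebra_id//; exact: smallest_sigma_algebra.
Qed.

Lemma history_measurable_fun l X : history_measurable l X -> measurable_fun [set: Omega] X.
Proof.
move=> hX _ U mU; rewrite setTI; apply: history_sub_measurable.
exact: (history_measurable_set hX).
Qed.

Lemma sheet_measurable_fun z X : sheet_measurable_at P B z X -> measurable_fun [set: Omega] X.
Proof.
by move=> hX _ U mU; rewrite setTI; apply: sheet_filtration_sub_measurable; exact: hX.
Qed.

Lemma sheet_measurable_history z l X : z.1 <= l.1 \/ z.2 <= l.2 ->
  sheet_measurable_at P B z X -> history_measurable l X.
Proof.
move=> zl hX _ U mU; rewrite setTI; apply: sub_sigma_algebra.
by apply: (sheet_filtration_history zl); exact: hX.
Qed.

Lemma sheet_measurable_mono z z' X : z.1 <= z'.1 -> z.2 <= z'.2 ->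
  sheet_measurable_at P B z X -> sheet_measurable_at P B z' X.
Proof.
move=> h1 h2 hX U /hX; apply: sub_sigma_algebra2 => A [|]; last by right.
move=> [s [V [/andP[s0 s1] /andP[s2 s3] mV ->]]]; left; exists s, V; split=> //.
  by rewrite s0 (le_trans s1).
by rewrite s2 (le_trans s3).
Qed.

Lemma sheet_history l s : past_region l s -> history_measurable l (B s).
Proof.
move=> ls _ U mU; rewrite setTI; apply: sub_sigma_algebra; apply: sub_sigma_algebra.
by left; exists s, U.
Qed.

Definition weak_rect l u : Prop := [/\ quadrant l, l.1 <= u.1 & l.2 <= u.2].

Lemma weak_rect_quadrant l u : weak_rect l u -> quadrant u.
Proof. by move=> [[l1 l2] h1 h2]; split; [exact: le_trans h1|exact: le_trans h2]. Qed.

Lemma incr_history l u l' : weak_rect l u -> u.1 <= l'.1 \/ u.2 <= l'.2 ->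
  history_measurable l' (incr B l u).
Proof.
move=> [[l1 l2] lu1 lu2] h.
have h' : l.1 <= l'.1 \/ l.2 <= l'.2.
  by case: h => h; [left; exact: le_trans lu1 h|right; exact: le_trans lu2 h].
have u1 := le_trans l1 lu1; have u2 := le_trans l2 lu2.
have mix1 : l.1 <= l'.1 \/ u.2 <= l'.2.
  by case: h => h; [left; exact: le_trans lu1 h|right].
have mix2 : u.1 <= l'.1 \/ l.2 <= l'.2.
  by case: h => h; [left|right; exact: le_trans lu2 h].
rewrite /incr; apply: measurable_funD; [apply: measurable_funB; [apply: measurable_funB|]|];
  exact: sheet_history.
Qed.

Lemma incr_degenerate l u w : u.1 = l.1 \/ u.2 = l.2 -> incr B l u w = 0.
Proof.
by case: l u => [a b] [c e] /= [] ->; rewrite /incr/=; ring.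
Qed.

Definition area l u : R := (u.1 - l.1) * (u.2 - l.2).

Lemma incr_msq l u : weak_rect l u -> msq P [set: Omega] (incr B l u) = (area l u)%:E.
Proof.
move=> lu; have [q l1 l2] := lu.
have [lu1|lu1] := eqVneq l.1 u.1.
  rewrite /area lu1 subrr mul0r; rewrite /msq; apply: integral0_eq => w _.
  by rewrite incr_degenerate ?expr0n; last by left.
have [lu2|lu2] := eqVneq l.2 u.2.
  rewrite /area lu2 subrr mulr0; rewrite /msq; apply: integral0_eq => w _.
  by rewrite incr_degenerate ?expr0n; last by right.
have a0 : 0 < area l u by rewrite /area mulr_gt0// subr_gt0 lt_neqAle ?lu1 ?lu2.
rewrite (@normal_var_msq _ _ _ _ (Num.sqrt (area l u))) ?sqrtr_gt0//.
- by rewrite sqr_sqrtr// ltW.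
- exact: (measurable_incr B_sheet q (weak_rect_quadrant lu)).
- move=> A mA; apply: (sheet_normal B_sheet) => //.
  by split => //; rewrite lt_neqAle ?lu1 ?lu2.
Qed.

Lemma L2_incr l u : weak_rect l u -> L2 P (incr B l u).
Proof.
move=> lu; split; last by rewrite incr_msq// ltry.
by have [q _ _] := lu; exact: (measurable_incr B_sheet q (weak_rect_quadrant lu)).
Qed.

(** The increment is independent of the history; both sides vanish when the
    rectangle is degenerate. *)
Lemma history_mul_measurable_incr l u X (g : R -> R) (g0 : g 0 = 0) :
  weak_rect l u -> history_measurable l X -> measurable_fun [set: R] g ->
  P.-integrable [set: Omega] (EFin \o X) ->
  P.-integrable [set: Omega] (EFin \o (g \o incr B l u)) ->
  P.-integrable [set: Omega] (EFin \o (X \* (g \o incr B l u))) /\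
  \int[P]_w (X w * g (incr B l u w)) = (\int[P]_w X w) * \int[P]_w g (incr B l u w).
Proof.
move=> lu hX mg iX iY; have [q l1 l2] := lu.
have degen : l.1 = u.1 \/ l.2 = u.2 -> P.-integrable [set: Omega] (EFin \o (X \* (g \o incr B l u))) /\
  \int[P]_w (X w * g (incr B l u w)) = (\int[P]_w X w) * \int[P]_w g (incr B l u w).
  move=> h.
  have z w : g (incr B l u w) = 0 by rewrite incr_degenerate//; case: h => ->; [left|right].
  split.
    by apply: eq_integrable (integrable0 _ _) => // w _ /=; rewrite z mulr0.
  have -> : \int[P]_w g (incr B l u w) = 0.
    by under eq_Rintegral do rewrite z; rewrite Rintegral_cst// mul0r.
  by under eq_Rintegral do rewrite z mulr0; rewrite Rintegral_cst// mul0r mulr0.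
have [lu1|lu1] := eqVneq l.1 u.1; first by apply: degen; left.
have [lu2|lu2] := eqVneq l.2 u.2; first by apply: degen; right.
have mX := history_measurable_fun hX.
have mI : measurable_fun [set: Omega] (incr B l u) by exact: (measurable_incr B_sheet q (weak_rect_quadrant lu)).
have mgI : measurable_fun [set: Omega] (g \o incr B l u) by exact: measurableT_comp.
pose X' : {mfun Omega >-> R} := HB.pack X (isMeasurableFun.Build _ _ _ _ X mX).
pose Y' : {mfun Omega >-> R} := HB.pack (g \o incr B l u) (isMeasurableFun.Build _ _ _ _ _ mgI).
have [|h1 h2] := @independent_mul _ _ _ P X' Y' _ iX iY.
  move=> A U mA mU /=.
  rewrite (_ : (g \o incr B l u) @^-1` U = incr B l u @^-1` (g @^-1` U))//.
  apply: history_indep => //.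
  - by split => //; rewrite lt_neqAle ?lu1 ?lu2.
  - exact: (history_measurable_set hX).
  - by rewrite -[X in measurable X]setTI; exact: mg.
split; first exact: h1.
rewrite /Rintegral -fineM; last 2 first.
- exact: integrable_fin_num iX.
- exact: integrable_fin_num iY.
by congr fine; exact: h2.
Qed.

Lemma history_incr_mean0 l u X : weak_rect l u -> history_measurable l X ->
  P.-integrable [set: Omega] (EFin \o X) -> \int[P]_w (X w * incr B l u w) = 0.
Proof.
move=> lu hX iX.
have [q l1 l2] := lu.
have [_ ->] := @history_mul_measurable_incr l u X id erefl lu hX (@measurable_id _ _ setT) iX
  (L2_integrable (L2_incr lu)).
have [lu1|lu1] := eqVneq l.1 u.1.
  have -> : \int[P]_w incr B l u w = 0; last by rewrite mulr0.
  have z w : incr B l u w = 0 by rewrite incr_degenerate//; left.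
  by under eq_Rintegral do rewrite z; rewrite Rintegral_cst// mul0r.
have [lu2|lu2] := eqVneq l.2 u.2.
  have -> : \int[P]_w incr B l u w = 0; last by rewrite mulr0.
  have z w : incr B l u w = 0 by rewrite incr_degenerate//; right.
  by under eq_Rintegral do rewrite z; rewrite Rintegral_cst// mul0r.
rewrite [X in _ * X]/Rintegral.
rewrite (@normal_var_integral0 _ _ _ _ (Num.sqrt (area l u))) ?mulr0//.
- by rewrite sqrtr_gt0 /area mulr_gt0// subr_gt0 lt_neqAle ?lu1 ?lu2.
- exact: (measurable_incr B_sheet q (weak_rect_quadrant lu)).
- move=> A mA; apply: (sheet_normal B_sheet) => //.
  by split => //; rewrite lt_neqAle ?lu1 ?lu2.
Qed.

Lemma history_incr_square l u X : weak_rect l u -> history_measurable l X ->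
  P.-integrable [set: Omega] (EFin \o X) ->
  \int[P]_w (X w * (incr B l u w * incr B l u w)) = (\int[P]_w X w) * area l u.
Proof.
move=> lu hX iX.
have [_ ->] := @history_mul_measurable_incr l u X (fun x => x * x) (mulr0 0) lu hX
  (measurable_funM (@measurable_id _ _ _) (@measurable_id _ _ _)) iX
  (L2_mul_integrable (L2_incr lu) (L2_incr lu)).
congr (_ * _); apply: EFin_inj.
by rewrite -(incr_msq lu) msq_Rintegral//; exact: L2_incr.
Qed.

End isometry.

Section step_pairs.
Context d (Omega : measurableType d) (R : realType) (P : probability Omega R).
Variable B : R * R -> Omega -> R.
Hypotheses (P_complete : measure_is_complete P) (B_sheet : brownian_sheet P B).
Local Notation step := (@step _ Omega R).
Implicit Types (l u z : R * R) (e f : step) (X : Omega -> R).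

(** Steps over possibly degenerate rectangles, as they arise by clipping; only a
    coefficient that multiplies a nonzero increment has to be adapted. *)
Definition weak_step e : Prop :=
  [/\ weak_rect (lo e) (up e), exists K : R, forall w, `|coef e w| <= K,
      measurable_fun [set: Omega] (coef e) &
      (lo e).1 < (up e).1 -> (lo e).2 < (up e).2 ->
        sheet_measurable_at P B (lo e) (coef e)].

Definition step_integral e (w : Omega) : R := coef e w * incr B (lo e) (up e) w.

Definition overlap1 (a b a' b' : R) : R := Num.max 0 (Num.min b b' - Num.max a a').

Definition overlap e f : R :=
  overlap1 (lo e).1 (up e).1 (lo f).1 (up f).1 *
  overlap1 (lo e).2 (up e).2 (lo f).2 (up f).2.

(** The polarized isometry for two steps; overlap e f is the area common to
    their rectangles. *)
Definition isometric_pair e f : Prop :=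
  \int[P]_w (step_integral e w * step_integral f w) =
  (\int[P]_w (coef e w * coef f w)) * overlap e f.

Lemma overlap1_sep a b a' b' : b <= a' -> overlap1 a b a' b' = 0.
Proof.
move=> h; rewrite /overlap1; apply/max_idPl.
by case: (leP b b') => ?; case: (leP a a') => ?; lra.
Qed.

Lemma overlap1C a b a' b' : overlap1 a b a' b' = overlap1 a' b' a b.
Proof. by rewrite /overlap1 minC [Num.max a a']maxC. Qed.

Lemma overlap1_same a b : a <= b -> overlap1 a b a b = b - a.
Proof. by move=> h; rewrite /overlap1 minxx maxxx; apply/max_idPr; rewrite subr_ge0. Qed.

Lemma overlap1_split v a b a' b' : a <= v <= b -> a' <= b' ->
  overlap1 a b a' b' = overlap1 a v a' b' + overlap1 v b a' b'.
Proof.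
move=> /andP[av vb] ab'; rewrite /overlap1; case: (leP b b') => ?; case: (leP v b') => ?;
  case: (leP a a') => ?; case: (leP v a') => ?;
  rewrite !maxElt; do 3?[case: ltP => ?]; lra.
Qed.

Lemma overlapC e f : overlap e f = overlap f e.
Proof. by rewrite /overlap overlap1C [X in _ * X]overlap1C. Qed.

Lemma L2_step_integral e : weak_step e -> L2 P (step_integral e).
Proof.
move=> [lu [K eK] me _]; apply: L2_mul_bounded eK => //.
exact: (L2_incr B_sheet).
Qed.

Lemma L2_coef e : weak_step e -> L2 P (coef e).
Proof. by move=> [_ [K eK] me _]; apply: L2_bounded eK. Qed.

Lemma isometric_pairC e f : isometric_pair e f -> isometric_pair f e.
Proof.
rewrite /isometric_pair overlapC => h.
under eq_Rintegral do rewrite mulrC; rewrite h.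
by under eq_Rintegral do rewrite mulrC.
Qed.

(** A coordinate is selected by a boolean, so that one argument covers the cuts in
    both directions. *)
Definition coord (i : bool) z : R := if i then z.1 else z.2.
Definition set_coord (i : bool) (v : R) z : R * R := if i then (v, z.2) else (z.1, v).

Lemma overlap_sep i e f : coord i (up e) <= coord i (lo f) -> overlap e f = 0.
Proof.
case: i => /= h; rewrite /overlap; first by rewrite overlap1_sep// mul0r.
by rewrite [X in _ * X]overlap1_sep// mulr0.
Qed.

Lemma isometric_pair_degenerate i e f : weak_step e -> weak_step f ->
  coord i (up e) = coord i (lo e) -> isometric_pair e f.
Proof.
move=> we [[_ f1 f2] _ _ _] he.
have z w : incr B (lo e) (up e) w = 0.
  by apply: incr_degenerate; case: i he => /= h; [left|right].
rewrite /isometric_pair /step_integral; under eq_Rintegral do rewrite z mulr0 mul0r.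
rewrite Rintegral_cst// mul0r /overlap.
have deg a a' b' : overlap1 a a a' b' = 0.
  rewrite /overlap1; apply/max_idPl.
  by case: (leP a b') => ?; case: (leP a a') => ?; lra.
by case: i he => /= ->; rewrite deg ?mul0r !mulr0.
Qed.

(** When e ends before f begins in one of the coordinates, everything but the
    increment of f belongs to the history at the lower left corner of f, and
    that increment has mean 0 given this history. *)
Lemma isometric_pair_sep i e f : weak_step e -> weak_step f ->
  coord i (up e) <= coord i (lo f) -> isometric_pair e f.
Proof.
move=> we wf h; have [[qe e1 e2] [Ke eK] me ae] := we.
have [[qf f1 f2] [Kf fK] mf af] := wf.
have [d1|d1] := eqVneq (up e).1 (lo e).1; first exact: (@isometric_pair_degenerate true).
have [d2|d2] := eqVneq (up e).2 (lo e).2; first exact: (@isometric_pair_degenerate false).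
have [d3|d3] := eqVneq (up f).1 (lo f).1.
  by apply: isometric_pairC; exact: (@isometric_pair_degenerate true).
have [d4|d4] := eqVneq (up f).2 (lo f).2.
  by apply: isometric_pairC; exact: (@isometric_pair_degenerate false).
have {}ae : sheet_measurable_at P B (lo e) (coef e).
  by apply: ae; rewrite lt_neqAle 1?eq_sym ?d1 ?d2.
have {}af : sheet_measurable_at P B (lo f) (coef f).
  by apply: af; rewrite lt_neqAle 1?eq_sym ?d3 ?d4.
rewrite /isometric_pair (overlap_sep h) mulr0.
pose X w := coef e w * (coef f w * incr B (lo e) (up e) w).
rewrite (@eq_Rintegral _ _ _ _ _ (fun w => X w * incr B (lo f) (up f) w)); last first.
  by move=> w _; rewrite /step_integral /X; ring.
apply: (history_incr_mean0 P_complete B_sheet); first by split.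
- have h' : (up e).1 <= (lo f).1 \/ (up e).2 <= (lo f).2.
    by case: i h => /= h; [left|right].
  apply: measurable_funM.
    apply: sheet_measurable_history ae.
    by case: h' => h'; [left; exact: le_trans e1 h'|right; exact: le_trans e2 h'].
  apply: measurable_funM; first by apply: sheet_measurable_history af; left.
  exact: incr_history.
- apply: L2_integrable; apply: L2_mul_bounded eK => //.
  by apply: L2_mul_bounded fK => //; exact: (L2_incr B_sheet).
Qed.

(** Over a common rectangle the identity is E (X W^2) = E X * area, with X the
    product of the coefficients and W the increment. *)
Lemma isometric_pair_same e f : weak_step e -> weak_step f ->
  lo e = lo f -> up e = up f -> isometric_pair e f.
Proof.
move=> we wf hl hu; have [lue [Ke eK] me ae] := we.
have [luf [Kf fK] mf af] := wf.
have [d1|d1] := eqVneq (up e).1 (lo e).1; first exact: (@isometric_pair_degenerate true).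
have [d2|d2] := eqVneq (up e).2 (lo e).2; first exact: (@isometric_pair_degenerate false).
have [_ e1 e2] := lue.
have e1' : (lo e).1 < (up e).1 by rewrite lt_neqAle eq_sym d1.
have e2' : (lo e).2 < (up e).2 by rewrite lt_neqAle eq_sym d2.
have {}ae := ae e1' e2'; have {}af : sheet_measurable_at P B (lo f) (coef f).
  by apply: af; rewrite -hl -hu.
rewrite /isometric_pair /overlap -hl -hu !overlap1_same//.
rewrite (@eq_Rintegral _ _ _ _ _ (fun w => (coef e w * coef f w) *
  (incr B (lo e) (up e) w * incr B (lo e) (up e) w))); last first.
  by move=> w _; rewrite /step_integral -hl -hu; ring.
rewrite (history_incr_square P_complete B_sheet)//.
- apply: measurable_funM.
    by apply: sheet_measurable_history ae; left.
  by rewrite hl; apply: sheet_measurable_history af; left.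
- by apply: L2_mul_integrable; exact: L2_coef.
Qed.

Definition step_below i v e : step := Step (lo e) (set_coord i v (up e)) (coef e).
Definition step_above i v e : step := Step (set_coord i v (lo e)) (up e) (coef e).

Lemma weak_step_split i v e : weak_step e -> coord i (lo e) <= v <= coord i (up e) ->
  weak_step (step_below i v e) /\ weak_step (step_above i v e).
Proof.
move=> [[[q1 q2] e1 e2] [K eK] me ae] /andP[v1 v2].
case: i v1 v2 => /= v1 v2; split; split => //=; try by exists K.
- move=> lt1 lt2; apply: ae => //; exact: lt_le_trans v2.
- by split=> //=; split => //=; exact: le_trans v1.
- move=> lt1 lt2; apply: (@sheet_measurable_mono _ _ _ _ _ (lo e)) => //.
  by apply: ae => //; exact: le_lt_trans lt1.
- move=> lt1 lt2; apply: ae => //; exact: lt_le_trans v2.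
- by split=> //=; split => //=; exact: le_trans v1.
- move=> lt1 lt2; apply: (@sheet_measurable_mono _ _ _ _ _ (lo e)) => //.
  by apply: ae => //; exact: le_lt_trans lt2.
Qed.

(** Increments and overlaps are additive when e is cut. *)
Lemma isometric_pair_split i v e f : weak_step e -> weak_step f ->
  coord i (lo e) <= v <= coord i (up e) ->
  isometric_pair (step_below i v e) f -> isometric_pair (step_above i v e) f ->
  isometric_pair e f.
Proof.
move=> we wf hv; have [w1 w2] := weak_step_split we hv.
rewrite /isometric_pair => h1 h2.
rewrite (@eq_Rintegral _ _ _ _ _ (fun w =>
  step_integral (step_below i v e) w * step_integral f w +
  step_integral (step_above i v e) w * step_integral f w)); last first.
  move=> w _; rewrite /step_integral; case: (e) (f) => [[a b] [a' b'] k] [lf uf kf].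
  by case: (i); rewrite /incr/=; ring.
rewrite RintegralD//; last 2 first.
- by apply: L2_mul_integrable; exact: L2_step_integral.
- by apply: L2_mul_integrable; exact: L2_step_integral.
rewrite h1 h2 -mulrDr; congr (_ * _).
have [[_ f1 f2] _ _ _] := wf.
move: hv; rewrite /overlap; case: (i) => /= hv.
  by rewrite [in RHS](overlap1_split hv f1) mulrDl.
by rewrite [in RHS](overlap1_split hv f2) mulrDr.
Qed.

(** Cutting both rectangles along one coordinate until their sides in that
    coordinate coincide: all other pieces are separated or degenerate. *)
Lemma isometric_pair_align i e f : weak_step e -> weak_step f ->
  (forall e' f', weak_step e' -> weak_step f' ->
     coord i (lo e') = coord i (lo f') -> coord i (up e') = coord i (up f') ->
     coord (~~ i) (lo e') = coord (~~ i) (lo e) -> coord (~~ i) (up e') = coord (~~ i) (up e) ->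
     coord (~~ i) (lo f') = coord (~~ i) (lo f) -> coord (~~ i) (up f') = coord (~~ i) (up f) ->
     isometric_pair e' f') -> isometric_pair e f.
Proof.
move=> we wf H.
have [s1|s1] := leP (coord i (up e)) (coord i (lo f)); first exact: (isometric_pair_sep we wf s1).
have [s2|s2] := leP (coord i (up f)) (coord i (lo e)).
  by apply: isometric_pairC; exact: (isometric_pair_sep wf we s2).
have coordK v z : coord i (set_coord i v z) = v by case: (i).
have coordN v z : coord (~~ i) (set_coord i v z) = coord (~~ i) z by case: (i).
have wle g : weak_step g -> coord i (lo g) <= coord i (up g).
  by move=> [[_ ? ?] _ _ _]; case: (i).
have le_e := wle e we; have le_f := wle f wf.
pose m := Num.max (coord i (lo e)) (coord i (lo f)).
pose n := Num.min (coord i (up e)) (coord i (up f)).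
have mn : m <= n.
  by rewrite /m /n ge_max !le_min le_e (ltW s2) (ltW s1) le_f.
(* it suffices to treat the part of the first rectangle between m and n *)
have trim e1 f1 : weak_step e1 -> weak_step f1 ->
    coord i (lo e1) <= m -> n <= coord i (up e1) ->
    m = coord i (lo e1) \/ m = coord i (lo f1) ->
    n = coord i (up e1) \/ n = coord i (up f1) ->
    isometric_pair (step_below i n (step_above i m e1)) f1 -> isometric_pair e1 f1.
  move=> w1 wf1 m1 n1 hm hn hmid.
  have cm : coord i (lo e1) <= m <= coord i (up e1) by rewrite m1 (le_trans mn).
  have [wb wa] := weak_step_split w1 cm.
  apply: (isometric_pair_split w1 wf1 cm).
    case: hm => hm.
      by apply: (isometric_pair_degenerate (i := i) wb wf1); rewrite /= coordK.
    by apply: (isometric_pair_sep (i := i) wb wf1); rewrite /= coordK hm.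
  have cn : coord i (lo (step_above i m e1)) <= n <= coord i (up (step_above i m e1)).
    by rewrite /= coordK mn n1.
  have [wb' wa'] := weak_step_split wa cn.
  apply: (isometric_pair_split wa wf1 cn) => //.
  case: hn => hn.
    by apply: (isometric_pair_degenerate (i := i) wa' wf1); rewrite /= coordK.
  by apply: isometric_pairC; apply: (isometric_pair_sep (i := i) wf1 wa'); rewrite /= coordK hn.
have mE : m = coord i (lo e) \/ m = coord i (lo f).
  by rewrite /m maxEle; case: ifP; [right|left].
have nE : n = coord i (up e) \/ n = coord i (up f).
  by rewrite /n minEle; case: ifP; [left|right].
have me : coord i (lo e) <= m by rewrite le_max lexx.
have mf : coord i (lo f) <= m by rewrite le_max lexx orbT.
have ne : n <= coord i (up e) by rewrite ge_min lexx.
have nf : n <= coord i (up f) by rewrite ge_min lexx orbT.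
have mid g : weak_step g -> coord i (lo g) <= m -> n <= coord i (up g) ->
    weak_step (step_below i n (step_above i m g)).
  move=> wg gm gn.
  have [|_ wa] := @weak_step_split i m g wg; first by rewrite gm (le_trans mn).
  have [|//] := @weak_step_split i n _ wa.
  by rewrite /= coordK mn gn.
apply: (trim e f) => //; apply: isometric_pairC; apply: (trim f _) => //.
- exact: mid.
- by case: mE => ->; [right; rewrite /= coordK|left].
- by case: nE => ->; [right; rewrite /= coordK|left].
apply: isometric_pairC; apply: H; rewrite /= ?coordK ?coordN//; exact: mid.
Qed.

(** Alignment in each coordinate leaves two steps over the same rectangle. *)
Lemma isometric_pairP e f : weak_step e -> weak_step f -> isometric_pair e f.
Proof.
move=> we wf; apply: (isometric_pair_align (i := true) we wf) => /= e1 f1 we1 wf1 l1 u1 _ _ _ _.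
apply: (isometric_pair_align (i := false) we1 wf1) => /= e2 f2 we2 wf2 l2 u2 le2 ue2 lf2 uf2.
apply: isometric_pair_same => //.
  by move: l2 le2 lf2; rewrite (surjective_pairing (lo e2)) (surjective_pairing (lo f2)) => /= -> -> ->; rewrite l1.
by move: u2 ue2 uf2; rewrite (surjective_pairing (up e2)) (surjective_pairing (up f2)) => /= -> -> ->; rewrite u1.
Qed.

End step_pairs.

Section simple_isometry.
Context d (Omega : measurableType d) (R : realType) (P : probability Omega R).
Variable B : R * R -> Omega -> R.
Hypotheses (P_complete : measure_is_complete P) (B_sheet : brownian_sheet P B).
Local Notation step := (@step _ Omega R).
Implicit Types (l u z x : R * R) (e f : step) (s : seq step) (X : Omega -> R).

Lemma measurable_rect l u : measurable (rect l u).
Proof.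
rewrite (_ : rect l u = `]l.1, u.1] `*` `]l.2, u.2]); first exact: measurableX.
by apply/seteqP; split => -[a b] /=; rewrite !in_itv/=.
Qed.

Lemma leb1_itv_oc (a b : R) : leb1 `]a, b] = (Num.max 0 (b - a))%:E.
Proof.
rewrite [LHS]lebesgue_measure_itv/= lte_fin; case: ifPn => h.
  by rewrite -EFinD; congr EFin; apply/esym/max_idPr; rewrite subr_ge0 ltW.
by congr EFin; apply/esym/max_idPl; rewrite subr_le0 leNgt.
Qed.

Lemma leb2X (A C : set R) : measurable A -> measurable C ->
  leb2 (A `*` C) = (leb1 A * leb1 C)%E.
Proof. by move=> mA mC; exact: product_measure1E. Qed.

Lemma leb2_rect_overlap e f :
  leb2 (rect (lo e) (up e) `&` rect (lo f) (up f)) = (overlap e f)%:E.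
Proof.
rewrite (_ : _ `&` _ =
  `]Num.max (lo e).1 (lo f).1, Num.min (up e).1 (up f).1] `*`
  `]Num.max (lo e).2 (lo f).2, Num.min (up e).2 (up f).2]); last first.
  apply/seteqP; split => -[a b]; rewrite /rect/= !in_itv/= !gt_max !le_min.
    by move=> [[/andP[-> ->] /andP[-> ->]] [/andP[-> ->] /andP[-> ->]]].
  by move=> [/andP[/andP[-> ->] /andP[-> ->]] /andP[/andP[-> ->] /andP[-> ->]]].
by rewrite leb2X// !leb1_itv_oc -EFinM.
Qed.

Lemma simple_process_square s (w : Omega) :
  (\int[leb2]_x ((simple_process s x w) ^+ 2)%:E =
   (\sum_(e <- s) \sum_(f <- s) coef e w * coef f w * overlap e f)%:E)%E.
Proof.
pose g e f (x : R * R) : R := coef e w * coef f w * \1_(rect (lo e) (up e) `&` rect (lo f) (up f)) x.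
have mI e f : measurable (rect (lo e) (up e) `&` rect (lo f) (up f)).
  by apply: measurableI; exact: measurable_rect.
have iI e f : leb2.-integrable [set: R * R] (EFin \o (\1_(rect (lo e) (up e) `&` rect (lo f) (up f)) : R * R -> R)).
  apply/integrableP; split; first by apply/measurable_EFinP; exact: measurable_indic.
  under eq_integral do rewrite /= ger0_norm//.
  by rewrite integral_indic// setIT [X in (X < _)%E](leb2_rect_overlap e f) ltry.
have ig e f : leb2.-integrable [set: R * R] (EFin \o g e f).
  have := integrableZl measurableT (coef e w * coef f w) (iI e f).
  by apply: eq_integrable.
have gE e f : \int[leb2]_x g e f x = coef e w * coef f w * overlap e f.
  rewrite RintegralZl//; congr (_ * _).
  by rewrite /Rintegral integral_indic// setIT [X in fine X](leb2_rect_overlap e f).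
have i1 e := Rintegral_sum (mu := leb2) measurableT (s := s) (fun f _ => ig e f).
have [i2 i3] := Rintegral_sum (mu := leb2) measurableT (s := s) (fun e _ => (i1 e).2).
transitivity ((\int[leb2]_x \sum_(e <- s) \sum_(f <- s) g e f x)%:E).
  rewrite /Rintegral fineK; last exact: integrable_fin_num.
  apply: eq_integral => x _; congr EFin.
  rewrite /simple_process expr2 mulr_suml; apply: eq_bigr => e _.
  rewrite mulr_sumr; apply: eq_bigr => f _.
  by rewrite /g indicI/=; ring.
congr EFin; rewrite i2; apply: eq_bigr => e _.
by rewrite (i1 e).1; apply: eq_bigr => f _.
Qed.

(** Expansion of both squares into pairs of steps. *)
Lemma step_isometry s : (forall e, List.In e s -> weak_step P B e) ->
  msq P [set: Omega] (fun w => \sum_(e <- s) step_integral B e w) =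
  (\int[P]_w \int[leb2]_x ((simple_process s x w) ^+ 2)%:E)%E.
Proof.
move=> ws.
have L2s e : List.In e s -> L2 P (step_integral B e).
  by move=> /ws we; exact: (L2_step_integral B_sheet we).
rewrite msq_Rintegral; last exact: L2_sum.
have iI e f : List.In e s -> List.In f s ->
    P.-integrable [set: Omega] (EFin \o (fun w => step_integral B e w * step_integral B f w)).
  by move=> es fs; apply: L2_mul_integrable; exact: L2s.
have ic e f : List.In e s -> List.In f s ->
    P.-integrable [set: Omega] (EFin \o (fun w => coef e w * coef f w * overlap e f)).
  move=> es fs.
  have := integrableZr measurableT (overlap e f) (L2_mul_integrable (L2_coef (ws e es)) (L2_coef (ws f fs))).
  by apply: eq_integrable.
have I1 e es := Rintegral_sum (mu := P) measurableT (s := s) (fun f fs => iI e f es fs).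
have C1 e es := Rintegral_sum (mu := P) measurableT (s := s) (fun f fs => ic e f es fs).
have [I2 I3] := Rintegral_sum (mu := P) measurableT (s := s) (fun e es => (I1 e es).2).
have [C2 C3] := Rintegral_sum (mu := P) measurableT (s := s) (fun e es => (C1 e es).2).
transitivity ((\int[P]_w \sum_(e <- s) \sum_(f <- s) coef e w * coef f w * overlap e f)%:E); last first.
  rewrite /Rintegral fineK; last exact: integrable_fin_num.
  by apply: eq_integral => w _; rewrite simple_process_square.
congr EFin.
rewrite (@eq_Rintegral _ _ _ _ _ (fun w => \sum_(e <- s) \sum_(f <- s) step_integral B e w * step_integral B f w)); last first.
  by move=> w _; rewrite mulr_suml; apply: eq_bigr => e _; rewrite mulr_sumr.
rewrite I2 C2.
have eq_big_In (F G : step -> R) r : (forall e, List.In e r -> F e = G e) ->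
    \sum_(e <- r) F e = \sum_(e <- r) G e.
  elim: r => [|e r ih] h; first by rewrite !big_nil.
  by rewrite !big_cons h ?ih//; [move=> f fr; apply: h; right|left].
apply: (eq_big_In) => e es; rewrite (I1 e es).1 (C1 e es).1.
apply: (eq_big_In) => f fs.
have := isometric_pairP P_complete B_sheet (ws e es) (ws f fs).
rewrite /isometric_pair => ->.
by rewrite RintegralZr//; apply: L2_mul_integrable; exact: (L2_coef (ws _ _)).
Qed.

Definition clip z e : step := Step (pmin (lo e) z) (pmin (up e) z) (coef e).

Lemma simple_integral_clip s z w :
  simple_integral B s z w = \sum_(e <- map (clip z) s) step_integral B e w.
Proof. by rewrite big_map. Qed.

(** Adaptedness as plain measurability, so that the closure properties of
    measurable functions apply to adapted variables. *)
Definition adapted_at z X : Prop :=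
  measurable_fun [set: g_sigma_algebraType (sheet_filtration P B z)] X.

Lemma adapted_atP z X : sheet_measurable_at P B z X <-> adapted_at z X.
Proof.
split => [h _ U mU|h U mU].
  by rewrite setTI; apply: sub_sigma_algebra; exact: h.
have := h measurableT U mU; rewrite setTI.
by rewrite /measurable/= sigma_algebra_id//; exact: smallest_sigma_algebra.
Qed.

Definition negate_step e : step := Step (lo e) (up e) (fun w => - coef e w).

Lemma weak_negate e : weak_step P B e -> weak_step P B (negate_step e).
Proof.
move=> [lu [K eK] me ae]; split=> //.
- by exists K => w /=; rewrite normrN.
- exact: measurable_funN.
- by move=> h1 h2; apply/adapted_atP; apply: measurable_funN; apply/adapted_atP; exact: ae.
Qed.

Lemma weak_clip z e : quadrant z -> admissible_step P B e -> weak_step P B (clip z e).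
Proof.
move=> [z1 z2] [[[l1 l2] lu1 lu2] [K eK] ae]; split => /=.
- split => //=; first by split; rewrite /= le_min ?l1 ?l2.
    by rewrite le_min ge_min (ltW lu1)/= ge_min lexx orbT.
  by rewrite le_min ge_min (ltW lu2)/= ge_min lexx orbT.
- by exists K.
- exact: (sheet_measurable_fun P_complete B_sheet ae).
- rewrite !lt_min !gt_min !ltxx !orbF => /andP[_ h1] /andP[_ h2].
  suff -> : pmin (lo e) z = lo e by [].
  rewrite /pmin (min_idPl (ltW h1)) (min_idPl (ltW h2)).
  by case: (lo e).
Qed.

Lemma rect_clip z e x : admissible_step P B e -> quadrant z ->
  \1_(rect (lo (clip z e)) (up (clip z e))) x =
  \1_(rect (lo e) (up e)) x * \1_(Rz z) x :> R.
Proof.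
move=> [[[l1 l2] _ _] _ _] [z1 z2]; rewrite !indicE -natrM mulnb; congr (nat_of_bool _)%:R.
apply/idP/andP => [/set_mem|[/set_mem + /set_mem]]; rewrite /rect /Rz /pmin/= ?in_itv/=.
  rewrite !gt_min !le_min => -[/andP[a1 /andP[a2 a3]] /andP[a4 /andP[a5 a6]]].
  have b1 : (lo e).1 < x.1 by case/orP: a1 => //; lra.
  have b2 : (lo e).2 < x.2 by case/orP: a4 => //; lra.
  split; rewrite inE/= ?in_itv/=; split; apply/andP; split=> //.
    by move: b1 l1; lra.
  by move: b2 l2; lra.
move=> [/andP[a1 a2] /andP[a3 a4]] [/andP[a5 a6] /andP[a7 a8]].
by rewrite inE/= !gt_min !le_min a1 a2 a3 a4 a6 a8.
Qed.

Lemma simple_process_clip z s x w : (forall e, List.In e s -> admissible_step P B e) ->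
  quadrant z -> simple_process (map (clip z) s) x w = simple_process s x w * \1_(Rz z) x.
Proof.
move=> hs qz; rewrite /simple_process big_map; elim: s hs => [|e s ih] hs.
  by rewrite !big_nil mul0r.
rewrite !big_cons ih; last by move=> f fs; apply: hs; right.
rewrite mulrDl; congr (_ + _); rewrite -mulrA; congr (_ * _).
by apply: rect_clip => //; apply: hs; left.
Qed.

Lemma simple_process_negate s x w :
  simple_process (map negate_step s) x w = - simple_process s x w.
Proof.
by rewrite /simple_process big_map -sumrN; apply: eq_bigr => e _; rewrite mulNr.
Qed.

Lemma simple_process_cat s s' x w :
  simple_process (s ++ s') x w = simple_process s x w + simple_process s' x w.
Proof. by rewrite /simple_process big_cat. Qed.

(** Two simple processes integrated over two rectangles: the difference of the
    integrals is the integral of one list of clipped steps. *)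
Lemma simple_integral_isometry s s' z z' : quadrant z -> quadrant z' ->
  (forall e, List.In e s -> admissible_step P B e) ->
  (forall e, List.In e s' -> admissible_step P B e) ->
  msq P [set: Omega] (fun w => simple_integral B s z w - simple_integral B s' z' w) =
  (\int[P]_w \int[leb2]_x
     ((simple_process s x w * \1_(Rz z) x - simple_process s' x w * \1_(Rz z') x) ^+ 2)%:E)%E.
Proof.
move=> qz qz' hs hs'.
pose r := map (clip z) s ++ map negate_step (map (clip z') s').
rewrite (@eq_msq _ _ _ _ _ _ (fun w => \sum_(e <- r) step_integral B e w)); last first.
  move=> w _; rewrite /r big_cat/= -simple_integral_clip; congr (_ + _).
  rewrite simple_integral_clip big_map -sumrN; apply: eq_bigr => e _.
  by rewrite /step_integral/= mulNr.
rewrite step_isometry.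
  apply: eq_integral => w _; apply: eq_integral => x _.
  by rewrite /r simple_process_cat simple_process_negate !simple_process_clip.
move=> e; rewrite /r => /(List.in_app_or _ _ _)[].
  by move=> /List.in_map_iff[f [<- fs]]; apply: weak_clip => //; exact: hs.
move=> /List.in_map_iff[f [<- /List.in_map_iff[g [<- gs]]]].
by apply: weak_negate; apply: weak_clip => //; exact: hs'.
Qed.

End simple_isometry.

(** * Approximable integrands *)

Section joint_integrals.
Context d (Omega : measurableType d) (R : realType) (P : probability Omega R).
Implicit Types (D : set (R * R)) (z : R * R) (phi psi : R * R -> Omega -> R).

Lemma measurable_Rz z : measurable (Rz z).
Proof. exact: measurableX. Qed.

Lemma Rz_subset z z' : z.1 <= z'.1 -> z.2 <= z'.2 -> Rz z `<=` Rz z'.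
Proof.
move=> h1 h2 [a b] [] /=; rewrite !in_itv/= => /andP[a1 a2] /andP[b1 b2].
by split; rewrite /= in_itv/=; apply/andP; split => //; [exact: le_trans h1|exact: le_trans h2].
Qed.

Definition jointly_measurable D phi : Prop :=
  measurable_fun (D `*` [set: Omega]) (fun p => phi p.1 p.2).

Lemma measurableXT D : measurable D -> measurable (D `*` [set: Omega]).
Proof. by move=> mD; exact: measurableX. Qed.

Section tonelli.
Variables (D : set (R * R)) (f : R * R -> Omega -> \bar R).
Hypothesis mD : measurable D.
Hypothesis f0 : forall x w, D x -> (0 <= f x w)%E.
Hypothesis mf : measurable_fun (D `*` [set: Omega]) (fun p => f p.1 p.2).

Let F : (R * R) * Omega -> \bar R := (fun p => f p.1 p.2) \_ (D `*` [set: Omega]).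

Let F0 p : (0 <= F p)%E.
Proof. by rewrite /F patchE; case: ifPn => // /set_mem[/= ? _]; exact: f0. Qed.

Let mF : measurable_fun [set: (R * R) * Omega] F.
Proof. by apply/(measurable_restrictT _ (measurableXT mD)). Qed.

Let FE x w : F (x, w) = ((f ^~ w) \_ D) x.
Proof.
rewrite /F !patchE; case: ifPn => [/set_mem[/= Dx _]|]; first by rewrite mem_set.
by move=> h; rewrite memNset// => Dx; move/negP: h; apply; rewrite inE.
Qed.

Lemma joint_tonelli1 : (\int[leb2 \x P]_(p in D `*` [set: Omega]) f p.1 p.2 =
  \int[P]_w \int[leb2]_(x in D) f x w)%E.
Proof.
rewrite integral_mkcond (fubini_tonelli2 F)//.
apply: eq_integral => w _; rewrite [RHS]integral_mkcond.
by apply: eq_integral => x _; rewrite FE.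
Qed.

Lemma joint_tonelli2 : (\int[leb2 \x P]_(p in D `*` [set: Omega]) f p.1 p.2 =
  \int[leb2]_(x in D) \int[P]_w f x w)%E.
Proof.
rewrite integral_mkcond (fubini_tonelli1 F)// [RHS]integral_mkcond.
apply: eq_integral => x _; rewrite patchE; case: ifPn => xD.
  by apply: eq_integral => w _; rewrite FE patchE xD.
by apply: integral0_eq => w _; rewrite FE patchE (negbTE xD).
Qed.

Lemma measurable_inner1 : measurable_fun [set: Omega] (fun w => \int[leb2]_(x in D) f x w)%E.
Proof.
have := measurable_fun_fubini_tonelli_G (m1 := leb2) F mF F0.
apply: eq_measurable_fun => w _; rewrite /fubini_G [RHS]integral_mkcond.
by apply: eq_integral => x _; rewrite FE.
Qed.

Lemma measurable_inner2 : measurable_fun D (fun x => \int[P]_w f x w)%E.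
Proof.
have := measurable_fun_fubini_tonelli_F (m2 := P) F mF F0.
move=> /measurable_funTS h; apply: eq_measurable_fun (h D) => x xD.
by apply: eq_integral => w _; rewrite FE patchE xD.
Qed.

End tonelli.

Lemma jm_section D phi w : measurable D -> jointly_measurable D phi ->
  measurable_fun D (phi ^~ w).
Proof.
move=> mD mphi.
pose F := (fun p : (R * R) * Omega => phi p.1 p.2) \_ (D `*` [set: Omega]).
have mF : measurable_fun [set: (R * R) * Omega] F.
  by apply/(measurable_restrictT _ (measurableXT mD)).
apply: (eq_measurable_fun (fun x => F (x, w))).
  by move=> x /set_mem xD; rewrite /F patchE mem_set.
by apply: measurable_funTS; exact: (measurable_fun_pair1 (f := F)).
Qed.

Lemma jmS D D' phi : measurable D -> D' `<=` D -> jointly_measurable D phi -> jointly_measurable D' phi.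
Proof.
move=> mD DD'; apply: measurable_funS; first exact: measurableXT.
by move=> [x w] [/= ? _]; split => //; exact: DD'.
Qed.

Lemma normsq_msq z phi : jointly_measurable (Rz z) phi ->
  normsq_Rz P z phi = msq (leb2 \x P)%E (Rz z `*` [set: Omega]) (fun p => phi p.1 p.2).
Proof.
move=> mphi; rewrite /normsq_Rz -(joint_tonelli1 (f := fun x w => ((phi x w) ^+ 2)%:E))//.
- exact: measurable_Rz.
- by move=> x w _; rewrite lee_fin sqr_ge0.
- exact: measurable_sqr.
Qed.

Lemma normsq_swap z phi : jointly_measurable (Rz z) phi ->
  normsq_Rz P z phi = (\int[leb2]_(x in Rz z) msq P [set: Omega] (phi x))%E.
Proof.
move=> mphi; rewrite normsq_msq//.
rewrite -(joint_tonelli2 (f := fun x w => ((phi x w) ^+ 2)%:E))//.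
- exact: measurable_Rz.
- by move=> x w _; rewrite lee_fin sqr_ge0.
- exact: measurable_sqr.
Qed.

Lemma normsq_ge0 z phi : (0 <= normsq_Rz P z phi)%E.
Proof. by apply: integral_ge0 => w _; exact: msq_ge0. Qed.

Lemma normsq_triangle z phi psi chi (a b : R) :
  jointly_measurable (Rz z) phi -> jointly_measurable (Rz z) psi -> jointly_measurable (Rz z) chi ->
  (normsq_Rz P z (fun x w => (phi x w - psi x w)%R) <= a%:E)%E ->
  (normsq_Rz P z (fun x w => (psi x w - chi x w)%R) <= b%:E)%E ->
  (normsq_Rz P z (fun x w => (phi x w - chi x w)%R) <= (2 * a + 2 * b)%:E)%E.
Proof.
move=> m1 m2 m3; rewrite !normsq_msq; try exact: measurable_funB.
exact: (msq_triangle (measurableXT (measurable_Rz z)) m1 m2 m3).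
Qed.

Lemma normsqZ z (k : R) phi : jointly_measurable (Rz z) phi ->
  normsq_Rz P z (fun x w => k * phi x w) = ((k ^+ 2)%:E * normsq_Rz P z phi)%E.
Proof.
move=> mphi; rewrite !normsq_msq//; last exact: measurable_funM.
by rewrite -msqZ//; exact: measurableXT (measurable_Rz z).
Qed.

Lemma normsq_mono z z' phi : jointly_measurable (Rz z') phi -> z.1 <= z'.1 -> z.2 <= z'.2 ->
  (normsq_Rz P z phi <= normsq_Rz P z' phi)%E.
Proof.
move=> mphi h1 h2; have zz' := Rz_subset h1 h2.
apply: ge0_le_integralW => w _; first exact: msq_ge0.
apply: msq_subset => //; [exact: measurable_Rz..|].
by apply: (jm_section _ _ mphi); exact: measurable_Rz.
Qed.

Lemma normsq_le z phi psi :
  (forall x w, Rz z x -> `|phi x w| <= `|psi x w|) ->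
  (normsq_Rz P z phi <= normsq_Rz P z psi)%E.
Proof.
move=> h; apply: ge0_le_integralW => w _; first exact: msq_ge0.
by apply: msq_le => x zx; exact: h.
Qed.

Lemma eq_normsq z phi psi : (forall x w, Rz z x -> phi x w = psi x w) ->
  normsq_Rz P z phi = normsq_Rz P z psi.
Proof.
by move=> h; apply: eq_integral => w _; apply: eq_msq => x zx; exact: h.
Qed.

Lemma leb2_Rz z : quadrant z -> leb2 (Rz z) = (z.1 * z.2)%:E.
Proof.
move=> [z1 z2]; rewrite leb2X// [leb1 _]lebesgue_measure_itv [leb1 _]lebesgue_measure_itv/=.
rewrite !lte_fin; case: ifPn => h1; case: ifPn => h2; rewrite ?oppr0 ?adde0 ?mul0e ?mule0 -?EFinM//.
- have -> : z.2 = 0 by apply/eqP; rewrite eq_le z2 leNgt h2.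
  by rewrite mulr0.
- have -> : z.1 = 0 by apply/eqP; rewrite eq_le z1 leNgt h1.
  by rewrite mul0r.
- have -> : z.1 = 0 by apply/eqP; rewrite eq_le z1 leNgt h1.
  by rewrite mul0r.
Qed.

(** The two axes are Lebesgue null. *)
Lemma integral_Rz_rect z (f : R * R -> \bar R) : quadrant z ->
  (forall x, Rz z x -> 0 <= f x)%E -> measurable_fun (Rz z) f ->
  (\int[leb2]_(x in Rz z) f x = \int[leb2]_(x in rect (0, 0)%R z) f x)%E.
Proof.
move=> qz f0 mf.
have mN : measurable (Rz z `\` rect (0, 0) z).
  by apply: measurableD; [exact: measurable_Rz|exact: measurable_rect].
have sub : rect (0, 0) z `<=` Rz z.
  move=> [a b] [/= /andP[a1 a2] /andP[b1 b2]]; split; rewrite /= in_itv/=.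
    by rewrite a2 ltW.
  by rewrite b2 ltW.
rewrite (@ge0_negligible_integral _ _ _ leb2 _ (Rz z `\` rect (0, 0) z))//; last 2 first.
- exact: measurable_Rz.
- rewrite measureD; [|exact: measurable_Rz|exact: measurable_rect|]; last first.
    by rewrite [X in (X < _)%E](leb2_Rz qz) ltry.
  rewrite setIidr// [X in (X - _)%E](leb2_Rz qz).
  rewrite (_ : rect (0, 0) z = `]0, z.1] `*` `]0, z.2]); last first.
    by apply/seteqP; split => -[a b] /=; rewrite !in_itv/=.
  rewrite [X in (_ - X)%E](_ : _ = (z.1 * z.2)%:E) ?subee//.
  transitivity (leb1 `]0%R, z.1] * leb1 `]0%R, z.2])%E; first exact: leb2X.
  have [z1 z2] := qz.
  by rewrite !leb1_itv_oc !subr0 -EFinM; congr ((_ * _)%:E); apply/max_idPr.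
by rewrite setDD setIidr.
Qed.

End joint_integrals.

Lemma msq_cvg_dominated d (T : measurableType d) (R : realType)
    (mu : {measure set T -> \bar R}) (D : set T) (f_ : nat -> T -> R) (f g : T -> R) :
  measurable D -> (forall n, measurable_fun D (f_ n)) -> measurable_fun D f ->
  measurable_fun D g -> (msq mu D g < +oo)%E ->
  (forall x, D x -> f_ ^~ x @ \oo --> f x) ->
  (forall n x, D x -> `|f_ n x| <= `|g x|) ->
  forall eps : R, 0 < eps ->
  exists n, (msq mu D (fun x => f x - f_ n x)%R <= eps%:E)%E.
Proof.
move=> mD mf_ mf mg g2 cf fg eps eps0.
pose h n x := ((f x - f_ n x) ^+ 2)%:E.
have mh n : measurable_fun D (h n) by apply: measurable_sqr; exact: measurable_funB.
have fg' x : D x -> `|f x| <= `|g x|.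
  move=> Dx; have cn : `|f_ n x| @[n --> \oo] --> `|f x| by apply: cvg_norm; exact: cf.
  rewrite -(cvg_lim _ cn)//; apply: limr_le; first exact: cvgP cn.
  by apply: nearW => n; exact: fg.
have [] := @dominated_convergence _ _ _ mu D mD h (cst 0%E) (fun x => (4 * (g x) ^+ 2)%:E) mh.
- exact: measurable_cst.
- apply: aeW => x Dx; apply: cvg_EFin; first exact: nearW.
  rewrite (_ : _ \o _ = (fun n => (f x - f_ n x) * (f x - f_ n x))); last first.
    by apply/funext => n; rewrite /h/= expr2.
  rewrite [X in _ --> X](_ : _ = (f x - f x) * (f x - f x)); last by rewrite /= subrr mulr0.
  by apply: cvgM; apply: cvgB; [exact: cvg_cst|exact: cf|exact: cvg_cst|exact: cf].
- apply/integrableP; split.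
    by apply/measurable_EFinP/measurable_funM => //; exact: measurable_funX.
  rewrite (eq_integral (fun x => 4%:E * ((g x) ^+ 2)%:E))%E; last first.
    by move=> x _; rewrite -EFinM /= ger0_norm// mulr_ge0// sqr_ge0.
  rewrite ge0_integralZl_EFin//; last 2 first.
    by move=> x _; rewrite lee_fin sqr_ge0.
    exact: measurable_sqr.
  by rewrite lte_mul_pinfty// ?lee_fin.
- apply: aeW => x n Dx; rewrite gee0_abs ?lee_fin ?sqr_ge0//.
  have h1 := fg' x Dx; have h2 := fg n x Dx.
  have h3 : `|f x - f_ n x| <= 2 * `|g x|.
    by rewrite (le_trans (ler_normB _ _))//; lra.
  rewrite -[leLHS]real_normK ?num_real// -[in leRHS]real_normK ?num_real//.
  by have := normr_ge0 (f x - f_ n x); nra.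
move=> _ _; rewrite integral0.
move=> /fine_cvgP[fin_h /cvgr_lt/(_ _ eps0) near_h].
near \oo => n; exists n.
have : fine (\int[mu]_(x in D) h n x)%E < eps by near: n.
have : (\int[mu]_(x in D) h n x)%E \is a fin_num by near: n.
by rewrite /msq -/(h n) => /fineK {2}<- /ltW; rewrite lee_fin.
Unshelve. all: by end_near. Qed.

(** As the generators contain the whole spaces, the products of generators
    generate the two families of cylinders. *)
Lemma g_sigma_prod (T1 T2 : Type) (C1 : set (set T1)) (C2 : set (set T2)) :
  C1 setT -> C2 setT ->
  <<s [set A `*` B | A in <<s C1 >> & B in <<s C2 >>] >> `<=` <<s [set A `*` B | A in C1 & B in C2] >>.
Proof.
move=> h1 h2; set S := <<s [set A `*` B | A in C1 & B in C2] >>.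
have sS : sigma_algebra setT S by exact: smallest_sigma_algebra.
have S1 A : <<s C1 >> A -> S (fst @^-1` A).
  move=> sA; suff : image_set_system setT fst S A by rewrite /image_set_system/= setTI.
  move: A sA; apply: smallest_sub; first exact: sigma_algebra_image.
  move=> A CA; rewrite /image_set_system/= setTI; apply: sub_sigma_algebra.
  by exists A => //; exists setT => //; apply/seteqP; split => -[x y] // [].
have S2 B : <<s C2 >> B -> S (snd @^-1` B).
  move=> sB; suff : image_set_system setT snd S B by rewrite /image_set_system/= setTI.
  move: B sB; apply: smallest_sub; first exact: sigma_algebra_image.
  move=> B CB; rewrite /image_set_system/= setTI; apply: sub_sigma_algebra.
  by exists setT => //; exists B => //; apply/seteqP; split => -[x y] // [].
apply: smallest_sub => // _ [A sA] [B sB] <-.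
rewrite (_ : A `*` B = fst @^-1` A `&` snd @^-1` B)//.
have [_ SD SI] := sS.
rewrite -[X in S X]setCK setCI -setTD; apply: (SD _).
rewrite -bigcup2E; apply: SI => -[|[|n]] /=.
- by rewrite -setTD; apply: (SD _); exact: S1.
- by rewrite -setTD; apply: (SD _); exact: S2.
- by case: sS.
Qed.

Section approximation.
Context d (Omega : measurableType d) (R : realType) (P : probability Omega R).
Variable B : R * R -> Omega -> R.
Hypotheses (P_complete : measure_is_complete P) (B_sheet : brownian_sheet P B).
Local Notation step := (@step _ Omega R).
Implicit Types (l u x : R * R) (e f : step) (s : seq step) (xi : Omega -> R).
Implicit Types (phi psi : R * R -> Omega -> R).

Definition admissible s : Prop := forall e, List.In e s -> admissible_step P B e.

Lemma jm_cst_mul (X : Omega -> R) (A : set (R * R)) : measurable_fun [set: Omega] X ->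
  measurable A -> jointly_measurable setT (fun x w => X w * \1_A x).
Proof.
move=> mX mA; rewrite /jointly_measurable setXTT.
apply: measurable_funM; first exact: measurableT_comp.
by apply: (@measurableT_comp _ _ _ _ _ _ (\1_A : R * R -> R)).
Qed.

Lemma jm_simple s : admissible s -> jointly_measurable setT (simple_process s).
Proof.
rewrite /jointly_measurable setXTT /simple_process.
elim: s => [_|e s ih hs]; first by under eq_fun do rewrite big_nil; exact: measurable_cst.
under eq_fun do rewrite big_cons.
apply: measurable_funD; last by apply: ih => f fs; apply: hs; right.
have [_ _ ae] := hs e (or_introl erefl).
have := jm_cst_mul (sheet_measurable_fun P_complete B_sheet ae) (measurable_rect (lo e) (up e)).
by rewrite /jointly_measurable setXTT.
Qed.

Section at_z.
Variable z : R * R.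
Local Notation jm := (@jointly_measurable _ Omega R (Rz z)).

Lemma jm_simple_Rz s : admissible s -> jm (simple_process s).
Proof. by move=> hs; apply: (jmS (D := setT)) => //; exact: jm_simple. Qed.

Lemma jmD phi psi : jm phi -> jm psi -> jm (fun x w => phi x w + psi x w).
Proof. exact: measurable_funD. Qed.

Lemma jmB phi psi : jm phi -> jm psi -> jm (fun x w => phi x w - psi x w).
Proof. exact: measurable_funB. Qed.

Lemma jmZ k phi : jm phi -> jm (fun x w => k * phi x w).
Proof. by move=> h; apply: measurable_funM. Qed.

(** The closure of the simple processes in the norm over R_z: the integrands
    that have an Ito integral. *)
Definition approximable phi : Prop := forall eps : R, 0 < eps ->
  exists s, admissible s /\
    (normsq_Rz P z (fun x w => (phi x w - simple_process s x w)%R) <= eps%:E)%E.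

Lemma admissible_cat s s' : admissible s -> admissible s' -> admissible (s ++ s').
Proof. by move=> h h' e /(List.in_app_or _ _ _)[/h|/h']. Qed.

Lemma approximableD phi psi : jm phi -> jm psi ->
  approximable phi -> approximable psi -> approximable (fun x w => phi x w + psi x w).
Proof.
move=> mphi mpsi aphi apsi eps eps0.
have e4 : 0 < eps / 4 by lra.
have [s [hs ns]] := aphi _ e4; have [s' [hs' ns']] := apsi _ e4.
exists (s ++ s'); split; first exact: admissible_cat.
have ms := jm_simple_Rz hs; have ms' := jm_simple_Rz hs'.
have mss := jm_simple_Rz (admissible_cat hs hs').
rewrite normsq_msq; last by apply: jmB => //; exact: jmD.
move: ns ns'; rewrite !normsq_msq; try exact: jmB.
move=> ns ns'.
rewrite (@eq_msq _ _ _ _ _ _ (fun p : (R * R) * Omega =>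
  (phi p.1 p.2 - simple_process s p.1 p.2) + (psi p.1 p.2 - simple_process s' p.1 p.2))); last first.
  by move=> p _; rewrite simple_process_cat; ring.
apply: (le_trans (msqD _ (measurableXT (measurable_Rz z)) _ _)); [exact: jmB..|].
rewrite (_ : eps%:E = 2%:E * (eps / 4)%:E + 2%:E * (eps / 4)%:E)%E; last first.
  by rewrite -!EFinM -EFinD; congr EFin; lra.
by apply: leeD; rewrite lee_pmul2l ?lte_fin.
Qed.

Lemma approximableZ k phi : jm phi -> approximable phi ->
  approximable (fun x w => k * phi x w).
Proof.
move=> mphi aphi eps eps0.
have k0 : 0 < k ^+ 2 + 1 by have := sqr_ge0 k; lra.
have [s [hs ns]] := aphi _ (divr_gt0 eps0 k0).
exists (map (fun e => Step (lo e) (up e) (fun w => k * coef e w)) s); split.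
  move=> _ /List.in_map_iff[f [<- /hs[lu [K fK] af]]]; split => //.
    exists (`|k| * K) => w /=; rewrite normrM; apply: ler_wpM2l => //.
  apply/adapted_atP; apply: measurable_funM => //.
  exact/adapted_atP.
rewrite (@eq_normsq _ _ _ _ _ _ (fun x w => k * (phi x w - simple_process s x w))); last first.
  move=> x w _; rewrite mulrBr; congr (_ - _).
  by rewrite /simple_process big_map mulr_sumr; apply: eq_bigr => e _; rewrite mulrA.
have mps : jm (fun x w => phi x w - simple_process s x w).
  by apply: jmB => //; exact: jm_simple_Rz.
rewrite normsqZ//.
apply: (@le_trans _ _ ((k ^+ 2)%:E * (eps / (k ^+ 2 + 1))%:E)%E).
  by apply: lee_wpmul2l => //; rewrite lee_fin sqr_ge0.
rewrite -EFinM lee_fin mulrA ler_pdivrMr// mulrC ler_pM2l//; lra.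
Qed.

Lemma approximable_limit phi : jm phi ->
  (forall eps : R, 0 < eps -> exists psi, [/\ jm psi, approximable psi &
     (normsq_Rz P z (fun x w => (phi x w - psi x w)%R) <= eps%:E)%E]) ->
  approximable phi.
Proof.
move=> mphi h eps eps0; have e4 : 0 < eps / 4 by lra.
have [psi [mpsi apsi npsi]] := h _ e4; have [s [hs ns]] := apsi _ e4.
exists s; split => //.
have := normsq_triangle mphi mpsi (jm_simple_Rz hs) npsi ns.
by move/le_trans; apply; rewrite lee_fin; lra.
Qed.

Lemma eq_approximable phi psi : (forall x w, Rz z x -> phi x w = psi x w) ->
  approximable phi -> approximable psi.
Proof.
move=> h aphi eps /aphi[s [hs ns]]; exists s; split; first exact: hs.
rewrite (@eq_normsq _ _ _ _ _ _ (fun x w => phi x w - simple_process s x w))//.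
by move=> x w zx; rewrite h.
Qed.

Lemma approximable_step e : admissible_step P B e ->
  approximable (fun x w => coef e w * \1_(rect (lo e) (up e)) x).
Proof.
move=> he eps eps0; exists [:: e]; split; first by move=> f [<-|[]].
rewrite (@eq_normsq _ _ _ _ _ _ (fun x w => 0)).
  rewrite /normsq_Rz; under eq_integral do under eq_integral do rewrite expr0n/=.
  under eq_integral do rewrite integral0.
  by rewrite integral0 lee_fin ltW.
by move=> x w _; rewrite /simple_process big_cons big_nil addr0 subrr.
Qed.

Lemma approximable0 : approximable (fun x w => 0).
Proof.
move=> eps eps0; exists [::]; split => //.
rewrite (@eq_normsq _ _ _ _ _ _ (fun x w => 0)).
  rewrite /normsq_Rz; under eq_integral do under eq_integral do rewrite expr0n/=.
  under eq_integral do rewrite integral0.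
  by rewrite integral0 lee_fin ltW.
by move=> x w _; rewrite /simple_process big_nil subrr.
Qed.

Lemma approximable_sum (I : Type) (r : seq I) (F : I -> R * R -> Omega -> R) :
  (forall i, jm (F i)) -> (forall i, approximable (F i)) ->
  jm (fun x w => \sum_(i <- r) F i x w) /\ approximable (fun x w => \sum_(i <- r) F i x w).
Proof.
move=> mF aF; elim: r => [|i r [mr ar]].
  split.
    by rewrite /jointly_measurable; under eq_fun do rewrite big_nil; exact: measurable_cst.
  by apply: eq_approximable approximable0 => x w _; rewrite big_nil.
split.
  rewrite /jointly_measurable; under eq_fun do rewrite big_cons.
  exact: (jmD (mF i) mr).
apply: (eq_approximable (phi := fun x w => F i x w + \sum_(j <- r) F j x w)).
  by move=> x w _; rewrite big_cons.
exact: (approximableD (mF i) mr (aF i) ar).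
Qed.

End at_z.
End approximation.

Section cell_approximation.
Context d (Omega : measurableType d) (R : realType) (P : probability Omega R).
Variable B : R * R -> Omega -> R.
Hypotheses (P_complete : measure_is_complete P) (B_sheet : brownian_sheet P B).
Variables (z l u : R * R) (xi : Omega -> R).
Hypotheses (qz : quadrant z) (lu : proper_rect l u) (mxi : sheet_measurable_at P B l xi).
Local Notation jm := (@jointly_measurable _ Omega R (Rz z)).
Local Notation approximable := (approximable P B z).
Implicit Types (E : set ((R * R) * R)) (g : (R * R) * R -> R).

(** A coefficient on one cell, with the state argument frozen at the value of
    the process at the lower left corner l of the cell and the space-time
    argument left free. *)
Definition frozen g (x : R * R) (w : Omega) : R := g (x, xi w) * \1_(rect l u) x.

Let mxi' : measurable_fun [set: Omega] xi := sheet_measurable_fun P_complete B_sheet mxi.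

Lemma jm_frozen g : measurable_fun [set: (R * R) * R] g -> jm (frozen g).
Proof.
move=> mg; apply: (jmS (D := setT)) => //; rewrite /jointly_measurable setXTT.
apply: measurable_funM.
  apply: (measurableT_comp mg); apply: measurable_fun_pair => //.
  exact: measurableT_comp.
apply: (@measurableT_comp _ _ _ _ _ _ (\1_(rect l u) : R * R -> R)) => //.
by apply: measurable_indic; exact: measurable_rect.
Qed.

Let msq1 : (msq (leb2 \x P)%E (Rz z `*` [set: Omega]) (fun=> 1%R) < +oo)%E.
Proof.
rewrite /msq expr1n integral_cst//; last exact: measurableXT (measurable_Rz z).
rewrite mul1e [X in (X < _)%E](_ : _ = leb2 (Rz z) * P [set: Omega])%E; last first.
  by apply: product_measure1E => //; exact: measurable_Rz.
by rewrite probability_setT mule1 [X in (X < _)%E](leb2_Rz qz) ltry.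
Qed.

(** A pi-system that generates the Borel sets of the space of pairs (point of the
    plane, frozen value) and whose frozen indicators are steps. *)
Let half_open : set (set R) := [set A | A = setT \/ ocitv A].

Let half_open_generates (A : set R) : measurable A -> <<s half_open >> A.
Proof.
move=> mA; have sub : @ocitv R `<=` half_open by move=> C oC; right.
have : <<s @ocitv R >> A by exact: mA.
exact: sub_sigma_algebra2.
Qed.

Let boxes : set (set ((R * R) * R)) :=
  [set A `*` C | A in [set A1 `*` A2 | A1 in half_open & A2 in half_open] & C in @measurable _ R].

Let boxes_generate E : measurable E -> <<s boxes >> E.
Proof.
rewrite [X in X E -> _]measurable_prod_measurableType => mE.
have T1 : half_open setT by left.
apply: g_sigma_prod => //.
  by exists setT => //; exists setT => //; rewrite setXTT.
apply: sub_sigma_algebra2 mE => _ [A mA] [C mC] <-.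
exists A; last by exists C => //; exact: sub_sigma_algebra.
apply: g_sigma_prod => //.
have := mA; rewrite [X in X A -> _]measurable_prod_measurableType.
apply: sub_sigma_algebra2 => _ [A1 mA1] [A2 mA2] <-.
by exists A1; [exact: half_open_generates|exists A2 => //; exact: half_open_generates].
Qed.

Let half_openI : setI_closed half_open.
Proof.
move=> A1 A2 [->|o1] [->|o2]; rewrite ?setTI ?setIT; [left|right|right|right] => //.
exact: ocitvI.
Qed.

Let boxesI : setI_closed boxes.
Proof.
move=> _ _ [_ [A1 h1 [A2 h2 <-]] [C mC <-]] [_ [A1' h1' [A2' h2' <-]] [C' mC' <-]].
exists ((A1 `&` A1') `*` (A2 `&` A2')).
  by exists (A1 `&` A1'); [exact: half_openI|exists (A2 `&` A2') => //; exact: half_openI].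
exists (C `&` C'); first exact: measurableI.
by rewrite !setXI.
Qed.

Let half_open_itv (A : set R) (a b : R) : a < b -> half_open A ->
  exists a' b', [/\ a <= a', a' <= b' & A `&` `]a, b] = `]a', b']%classic].
Proof.
move=> ab [->|[[a1 b1] _ <-]].
  by exists a, b; split; [|exact: ltW|rewrite setTI].
pose a' := Num.max a a1.
exists a', (Num.max a' (Num.min b b1)); split.
- by rewrite le_max lexx.
- by rewrite le_max lexx.
apply/seteqP; split => t /=; rewrite !in_itv/= gt_max le_max le_min.
  by move=> [/andP[-> ->] /andP[-> ->]]; rewrite orbT.
move=> /andP[/andP[h1 h2] /orP[|/andP[h3 h4]]]; last by rewrite h1 h2 h3 h4.
by rewrite /a' le_max => /orP[|] h; move: h1 h2 h; lra.
Qed.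

(** For a box, the frozen indicator is a step whose coefficient is an indicator
    of the frozen value. *)
Let frozen_box E : boxes E -> approximable (frozen \1_E).
Proof.
move=> [_ [A1 h1 [A2 h2 <-]] [C mC <-]].
have [ql lu1 lu2] := lu.
have [a1 [b1 [la1 ab1 E1]]] := half_open_itv lu1 h1.
have [a2 [b2 [la2 ab2 E2]]] := half_open_itv lu2 h2.
have phiE x w : frozen \1_((A1 `*` A2) `*` C) x w =
    \1_C (xi w) * \1_(rect (a1, a2) (b1, b2)) x.
  have := congr1 (fun S => S x.1) E1; have := congr1 (fun S => S x.2) E2.
  rewrite /= !in_itv/= => e2 e1.
  rewrite /frozen !indicE -!natrM !mulnb; congr (nat_of_bool _)%:R.
  rewrite [in RHS]andbC; apply/andP/andP => -[].
    move=> /set_mem[[/= x1 x2] xC] /set_mem[/= y1 y2]; rewrite !inE; split => //.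
    by split => /=; [rewrite -e1|rewrite -e2].
  move=> /set_mem[/= y1 y2] /set_mem xC; rewrite !inE.
  move: y1 y2; rewrite -e1 -e2 => -[? ?] [? ?].
  by split=> //; split.
have [d1|d1] := eqVneq a1 b1.
  apply: eq_approximable (approximable0 P B z) => x w _.
  rewrite phiE [X in _ * X](_ : _ = 0) ?mulr0// indicE memNset// => -[/= + _].
  by rewrite d1 => /andP[h h']; move: (lt_le_trans h h'); rewrite ltxx.
have [d2|d2] := eqVneq a2 b2.
  apply: eq_approximable (approximable0 P B z) => x w _.
  rewrite phiE [X in _ * X](_ : _ = 0) ?mulr0// indicE memNset// => -[/= _ +].
  by rewrite d2 => /andP[h h']; move: (lt_le_trans h h'); rewrite ltxx.
pose e := Step (a1, a2) (b1, b2) (fun w => \1_C (xi w) : R).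
apply: (@eq_approximable _ _ _ _ _ _ (fun x w => coef e w * \1_(rect (lo e) (up e)) x)).
  by move=> x w _; rewrite phiE.
apply: approximable_step; split.
- split; rewrite /= ?lt_neqAle ?d1 ?d2//.
  by case: ql => q1 q2; split; [exact: le_trans la1|exact: le_trans la2].
- by exists 1 => w /=; rewrite indicE ger0_norm ?lern1//; case: (_ \in _).
- apply/adapted_atP.
  have : adapted_at P B (a1, a2) xi.
    by apply/adapted_atP; apply: sheet_measurable_mono mxi.
  by move=> h; apply: (@measurableT_comp _ _ _ _ _ _ (\1_C : R -> R)).
Qed.

(** Monotone class argument: the Borel sets with an approximable frozen
    indicator form a lambda-system that contains the boxes. *)
Lemma approximable_frozen_indic E : measurable E -> approximable (frozen \1_E).
Proof.
move=> /boxes_generate; pose K := [set E | measurable E /\ approximable (frozen \1_E)].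
suff : <<s boxes >> `<=` K by move=> h /h[].
have mi A : measurable A -> measurable_fun [set: (R * R) * R] (\1_A : _ -> R).
  exact: measurable_indic.
apply: (lambda_system_subset boxesI); last by move=> ? _ ?.
- split; first by move=> ? _ ?.
  + split; first exact: measurableT.
    have h : boxes setT.
      exists setT; last by exists setT => //; rewrite setXTT.
      by exists setT; [left|exists setT; [left|rewrite setXTT]].
    exact: frozen_box.
  + move=> A C CA [mA aA] [mC aC]; split; first exact: measurableD.
    have fC := approximableZ P_complete B_sheet (-1) (jm_frozen (mi C mC)) aC.
    have mfC : jm (fun x w => -1 * frozen \1_C x w) by apply: jmZ; exact: jm_frozen (mi C mC).
    apply: eq_approximable (approximableD P_complete B_sheet (jm_frozen (mi A mA)) mfC aA fC).
    move=> x w _; rewrite /frozen mulN1r -mulrBl; congr (_ * _).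
    rewrite !indicE in_setD; have := CA (x, xi w).
    by case: (boolP (_ \in C)) => [/set_mem hC|]; case: (boolP (_ \in A)) => [hA|] //=;
      rewrite ?subrr ?subr0// => /negP nA /(_ hC) hA; case: nA; rewrite inE.
  + move=> F ndF KF.
    have mF n : measurable (F n) by have [] := KF n.
    have mU : measurable (\bigcup_n F n) by exact: bigcup_measurable.
    split => //; apply: (approximable_limit P_complete B_sheet); first exact: jm_frozen (mi _ mU).
    move=> eps eps0.
    have cvgF x w : (frozen \1_(F n) x w) @[n --> \oo] --> frozen \1_(\bigcup_n F n) x w.
      apply: cvg_near_cst.
      have [[n _ Fn]|nF] := pselect ((\bigcup_n F n) (x, xi w)).
        exists n => // m /= nm.
        have h1 : F m (x, xi w) by move/subsetPset: (ndF _ _ nm); apply.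
        have h2 : (\bigcup_n F n) (x, xi w) by exists n.
        by rewrite /frozen !indicE (mem_set h1) (mem_set h2).
      apply: nearW => m; have nFm : ~ F m (x, xi w) by move=> Fm; apply: nF; exists m.
      by rewrite /frozen !indicE (memNset nFm) (memNset nF).
    have frozen1 A x w : `|frozen \1_A x w| <= `|1%R|.
      by rewrite /frozen !indicE; case: (_ \in _); case: (_ \in _);
        rewrite ?mulr1 ?mulr0 ?normr1 ?normr0.
    have [n hn] := msq_cvg_dominated (measurableXT (measurable_Rz z))
      (fun n => jm_frozen (mi _ (mF n))) (jm_frozen (mi _ mU)) (measurable_cst (1 : R)) msq1
      (fun p _ => cvgF p.1 p.2) (fun n p _ => frozen1 (F n) p.1 p.2) eps0.
    exists (frozen \1_(F n)); split; [exact: jm_frozen (mi _ (mF n))|by have [] := KF n|].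
    by rewrite normsq_msq//; apply: jmB; exact: jm_frozen (mi _ _).
- move=> E1 bE; split; last exact: frozen_box.
  move: bE => [_ [A1 h1 [A2 h2 <-]] [C mC <-]].
  have mh (A : set R) : half_open A -> measurable A.
    by move=> [->|[ab _ <-]]; [exact: measurableT|exact: measurable_itv].
  by apply: measurableX => //; apply: measurableX; exact: mh.
Qed.

Import HBNNSimple.

Let frozen_nnsfun (h : {nnsfun ((R * R) * R)%type >-> R}) : approximable (frozen h).
Proof.
have mh y : measurable (h @^-1` [set y]).
  by rewrite -[X in measurable X]setTI; apply: (measurable_funP h).
pose F (y : R) x w := y * frozen \1_(h @^-1` [set y]) x w.
have mF y : jm (F y) by apply: jmZ; apply: jm_frozen; exact: measurable_indic.
have aF y : approximable (F y).
  apply: (approximableZ P_complete B_sheet y); last exact: approximable_frozen_indic.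
  by apply: jm_frozen; exact: measurable_indic.
have [_] := approximable_sum P_complete B_sheet (finmap.enum_fset (fset_set (range h))) mF aF.
apply: eq_approximable => x w _.
rewrite /frozen [in RHS](fimfunE h) fsbig_finite//= mulr_suml.
by apply: eq_bigr => y _; rewrite /F /frozen mulrA.
Qed.

Let frozen_ge0 g : measurable_fun [set: (R * R) * R] g -> (forall p, 0 <= g p) ->
  (normsq_Rz P z (frozen g) < +oo)%E -> approximable (frozen g).
Proof.
move=> mg g0 ng; have mfg := jm_frozen mg.
have mEg : measurable_fun [set: (R * R) * R] (EFin \o g) by exact/measurable_EFinP.
pose h := nnsfun_approx measurableT mEg.
have cvgh p : h n p @[n --> \oo] --> g p.
  have := @cvg_nnsfun_approx _ _ _ _ measurableT _ mEg (fun p _ => g0 p) p I.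
  by move/fine_cvgP => [_]; exact.
have leh n p : h n p <= g p.
  rewrite -(cvg_lim _ (cvgh p))//; apply: limr_ge; first exact: cvgP (cvgh p).
  by exists n => // m nm; exact/lefP/nd_nnsfun_approx.
have mh n : measurable_fun [set: (R * R) * R] (h n) by [].
apply: (approximable_limit P_complete B_sheet mfg) => eps eps0.
have [n hn] : exists n, (msq (leb2 \x P)%E (Rz z `*` [set: Omega])
    (fun p => frozen g p.1 p.2 - frozen (h n) p.1 p.2)%R <= eps%:E)%E.
  apply: (msq_cvg_dominated (measurableXT (measurable_Rz z)) (fun n => jm_frozen (mh n)) mfg mfg) => //.
  - by rewrite -normsq_msq.
  - by move=> p _; apply: cvgM; [exact: cvgh|exact: cvg_cst].
  - move=> n p _; rewrite /frozen !normrM ler_wpM2r// !ger0_norm//.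
exists (frozen (h n)); split; [exact: jm_frozen|exact: frozen_nnsfun|].
by rewrite normsq_msq//; apply: jmB => //; exact: jm_frozen.
Qed.

(** Reduction to simple functions of (x, xi), separately for the positive and
    negative parts of g. *)
Lemma approximable_frozen g : measurable_fun [set: (R * R) * R] g ->
  (normsq_Rz P z (frozen g) < +oo)%E -> approximable (frozen g).
Proof.
move=> mg ng.
pose gp p := Num.max (g p) 0; pose gn p := Num.max (- g p) 0.
have mgp : measurable_fun [set: (R * R) * R] gp by exact: measurable_maxr.
have mgn : measurable_fun [set: (R * R) * R] gn by apply: measurable_maxr => //; exact: measurable_funN.
have ap : approximable (frozen gp).
  apply: (frozen_ge0 mgp); first by move=> p; rewrite le_max lexx orbT.
  apply: le_lt_trans ng; apply: normsq_le => x w _; rewrite /frozen !normrM ler_wpM2r//.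
  by rewrite /gp; case: (leP 0 (g (x, xi w))) => h; rewrite ?normr0.
have an : approximable (frozen gn).
  apply: (frozen_ge0 mgn); first by move=> p; rewrite le_max lexx orbT.
  apply: le_lt_trans ng; apply: normsq_le => x w _; rewrite /frozen !normrM ler_wpM2r//.
  by rewrite /gn; case: (leP (- g (x, xi w)) 0) => h; rewrite ?normr0 ?normrN.
have an' := approximableZ P_complete B_sheet (-1) (jm_frozen mgn) an.
have mn' : jm (fun x w => -1 * frozen gn x w) by apply: jmZ; exact: jm_frozen.
apply: eq_approximable (approximableD P_complete B_sheet (jm_frozen mgp) mn' ap an').
move=> x w _; rewrite /frozen mulN1r -mulrBl; congr (_ * _).
by rewrite /gp /gn !maxEle; case: ifP => h1; case: ifP => h2; lra.
Qed.

End cell_approximation.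

(** * Laws as elements of the completed space of random measures *)

(** The Cauchy-Schwarz inequality against the constant 1, by optimizing
    2 |f| <= t + f^2 / t over t > 0. *)
Lemma square_integral_le d (T : measurableType d) (R : realType)
    (mu : {measure set T -> \bar R}) (D : set T) (f : T -> R) (m q : R) :
  measurable D -> measurable_fun D f -> 0 < m -> (mu D <= m%:E)%E -> (msq mu D f <= q%:E)%E ->
  mu.-integrable D (EFin \o f) /\ exists A : R, [/\ 0 <= A,
    (\int[mu]_(x in D) `|f x|%:E)%E = A%:E & A ^+ 2 <= m * q].
Proof.
move=> mD mf m0 muD fq.
have q0 : 0 <= q by rewrite -lee_fin; exact: le_trans (msq_ge0 _ _ _) fq.
(* the last step takes t = A / m, where A is the integral of |f| *)
have bound (t : R) : 0 < t ->
    (\int[mu]_(x in D) `|f x|%:E <= ((t * m + q / t) / 2)%:E)%E.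
  move=> t0.
  apply: (@le_trans _ _ (\int[mu]_(x in D) ((t / 2)%:E + ((2 * t)^-1 * (f x) ^+ 2)%:E))%E).
    apply: ge0_le_integralW => x _; rewrite lee_fin// -subr_ge0.
    rewrite (_ : _ - _ = (2 * t)^-1 * (t - `|f x|) ^+ 2).
      by rewrite mulr_ge0 ?sqr_ge0// invr_ge0 mulr_ge0// ltW.
    rewrite sqrrB [(`|f x|) ^+ 2]real_normK ?num_real//.
    by field; rewrite gt_eqF.
  have t20 : 0 <= (2 * t)^-1 by rewrite invr_ge0 mulr_ge0// ltW.
  rewrite ge0_integralD//; last 3 first.
  - by move=> x _; rewrite lee_fin divr_ge0// ltW.
  - by move=> x _; rewrite lee_fin mulr_ge0 ?sqr_ge0.
  - by apply/measurable_EFinP/measurable_funM => //; exact: measurable_funX.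
  rewrite integral_cst//.
  under [X in (_ + X <= _)%E]eq_integral do rewrite EFinM.
  rewrite ge0_integralZl_EFin//; last 2 first.
  - by move=> x _; rewrite lee_fin sqr_ge0.
  - exact: measurable_sqr.
  apply: (@le_trans _ _ ((t / 2)%:E * m%:E + (2 * t)^-1%:E * q%:E)%E).
    apply: leeD; apply: lee_wpmul2l => //; rewrite lee_fin//.
    by rewrite divr_ge0// ltW.
  rewrite -!EFinM -EFinD lee_fin le_eqVlt; apply/orP; left; apply/eqP.
  by field; rewrite gt_eqF.
have fint : mu.-integrable D (EFin \o f).
  apply/integrableP; split; first exact/measurable_EFinP.
  by apply: le_lt_trans (bound 1 ltr01) _; rewrite ltry.
split=> //.
have intfin : (\int[mu]_(x in D) `|f x|%:E)%E \is a fin_num.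
  rewrite ge0_fin_numE; first by apply: le_lt_trans (bound 1 ltr01) _; rewrite ltry.
  by apply: integral_ge0 => x _; rewrite lee_fin.
exists (fine (\int[mu]_(x in D) `|f x|%:E)%E); set A := fine _.
have A0 : 0 <= A by apply: fine_ge0; apply: integral_ge0 => x _; rewrite lee_fin.
split => //; first by rewrite fineK.
have [->|An0] := eqVneq A 0; first by rewrite expr0n/= mulr_ge0// ltW.
have Apos : 0 < A by rewrite lt_neqAle eq_sym An0.
have := bound (A / m) (divr_gt0 Apos m0).
rewrite -(fineK intfin) -/A lee_fin.
have -> : (A / m * m + q / (A / m)) / 2 = (A + q * m / A) / 2.
  by field; rewrite An0 gt_eqF.
move=> h; have : A <= q * m / A by lra.
by rewrite ler_pdivlMr// expr2 [m * q]mulrC.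
Qed.

Lemma square_Rintegral_le d (T : measurableType d) (R : realType) (P : probability T R)
    (f : T -> R) (q : R) : measurable_fun [set: T] f -> (msq P [set: T] f <= q%:E)%E ->
  (\int[P]_w f w) ^+ 2 <= q.
Proof.
move=> mf fq.
have P1 : (P setT <= 1%:E)%E by rewrite probability_setT.
have [fi [A [A0 fA Aq]]] := square_integral_le measurableT mf ltr01 P1 fq.
have : `|\int[P]_w f w| <= A.
  apply: (le_trans (le_normr_Rintegral measurableT fi)).
  by rewrite /Rintegral fA.
move=> h; rewrite mul1r in Aq; apply: le_trans Aq.
by rewrite -[leLHS]real_normK ?num_real// ler_sqr ?nnegrE.
Qed.

Lemma cos_lipschitz (R : realType) (a b : R) : `|cos a - cos b| <= `|a - b|.
Proof.
wlog ab : a b / a <= b.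
  by move=> h; have [/h//|/ltW/h] := leP a b; rewrite distrC [`|b - a|]distrC.
have [|c _ h] := @MVT_segment R cos (fun x => - sin x) a b ab (fun x _ => is_derive_cos x).
  by apply/continuous_subspaceT => x; exact: continuous_cos.
by rewrite distrC h normrM normrN [`|a - b|]distrC ler_piMl// sin_max.
Qed.

Lemma sin_lipschitz (R : realType) (a b : R) : `|sin a - sin b| <= `|a - b|.
Proof.
wlog ab : a b / a <= b.
  by move=> h; have [/h//|/ltW/h] := leP a b; rewrite distrC [`|b - a|]distrC.
have [|c _ h] := @MVT_segment R sin cos a b ab (fun x _ => is_derive_sin x).
  by apply/continuous_subspaceT => x; exact: continuous_sin.
by rewrite distrC h normrM [`|a - b|]distrC ler_piMl// cos_max.
Qed.

Section charge_integrals.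
Context (R : realType).
Implicit Types (f : R -> R).

Lemma bounded_integrable (m : {finite_measure set R -> \bar R}) f (K : R) :
  measurable_fun [set: R] f -> (forall x, `|f x| <= K) -> m.-integrable [set: R] (EFin \o f).
Proof.
move=> mf fK; apply: measurable_bounded_integrable => //.
  by rewrite -ge0_fin_numE// fin_num_measure.
by exists K; split; [exact: num_real|move=> x Kx y _; exact: le_trans (fK y) (ltW Kx)].
Qed.

Lemma adde_swap (a b p n : \bar R) : a \is a fin_num -> b \is a fin_num ->
  p \is a fin_num -> n \is a fin_num -> (a - b = p - n)%E -> (p + b = n + a)%E.
Proof.
by move: a b p n => [a||] [b||] [p||] [n||]// _ _ _ _ [H]; congr EFin; move: H; lra.
Qed.

(** Whatever Hahn decomposition is chosen, the positive part plus m2 and the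
    negative part plus m1 are the same measure. *)
Lemma charge_integral_diff (nu : {charge set R -> \bar R})
    (m1 m2 : {finite_measure set R -> \bar R}) f (K : R) :
  measurable_fun [set: R] f -> (forall x, `|f x| <= K) ->
  (forall A, measurable A -> nu A = (m1 A - m2 A)%E) ->
  charge_integral nu f = \int[m1]_x f x - \int[m2]_x f x.
Proof.
move=> mf fK nuE; rewrite /charge_integral.
set PN := cid _; set N := cid _; set h := projT2 N.
have i1 := bounded_integrable m1 mf fK; have i2 := bounded_integrable m2 mf fK.
have ip := bounded_integrable (jordan_pos h) mf fK.
have iN := bounded_integrable (jordan_neg h) mf fK.
have mEf : measurable_fun [set: R] (EFin \o f) by exact/measurable_EFinP.
have E : (\int[measure_add (jordan_pos h) m2]_x (EFin \o f) x =
          \int[measure_add (jordan_neg h) m1]_x (EFin \o f) x)%E.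
  apply: eq_measure_integral => A mA _.
  transitivity (jordan_pos h A + m2 A)%E; first exact: measure_addE.
  transitivity (jordan_neg h A + m1 A)%E; last by symmetry; exact: measure_addE.
  have := jordan_decomp h mA; rewrite nuE// /cadd/= cscaleN1.
  have fp := fin_num_measure (jordan_pos h) A mA; have fn := fin_num_measure (jordan_neg h) A mA.
  have f1 := fin_num_measure m1 A mA; have f2 := fin_num_measure m2 A mA.
  move=> H; apply: (@adde_swap (m1 A) (m2 A)) => //; exact: H.
move: E; rewrite !integral_measure_add//.
have F1 := integrable_fin_num measurableT i1; have F2 := integrable_fin_num measurableT i2.
have Fp := integrable_fin_num measurableT ip; have FN := integrable_fin_num measurableT iN.
rewrite /Rintegral -(fineK F1) -(fineK F2) -(fineK Fp) -(fineK FN).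
by move=> [H]; move: H; rewrite /=; lra.
Qed.

End charge_integrals.

(** leb1 is the image of Lebesgue measure under the identity, which links the
    integrals over the two presentations of the Borel sets of the line. *)
Lemma ge0_integral_leb1 (R : realType) (f : R -> \bar R) :
  measurable_fun [set: R] f -> (forall x, 0 <= f x)%E ->
  (\int[leb1]_x f x = \int[@lebesgue_measure R]_x f x)%E.
Proof.
move=> mf f0.
have mi : measurable_fun [set: measurableTypeR R] (id : measurableTypeR R -> R) by exact: measurable_id.
have [<-//] := @ge0_integral_pushforward _ _ (measurableTypeR R) R R id mi
  (@lebesgue_measure R) setT f measurableT mf (fun y _ => f0 y).
Qed.

(** (1 + u) e^-u <= 2 e^(-u/2), a multiple of the standard normal density at y
    when u = y^2. *)
Lemma gauss_weight (R : realType) : exists2 K : R, 0 <= K &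
  (\int[leb1]_y ((1 + y ^+ 2) * expR (- y ^+ 2))%:E <= K%:E)%E.
Proof.
pose g := @normal_pdf R 0 1; pose c : R := (@normal_peak R 1)^-1.
have pk0 : 0 < @normal_peak R 1 by apply: normal_peak_gt0; exact: oner_neq0.
have c0 : 0 <= c by rewrite invr_ge0 ltW.
have gE x : expR (- x ^+ 2 / 2) = c * g x.
  rewrite /g normal_pdfE ?oner_neq0// /normal_fun subr0 expr1n mulr2n.
  by rewrite /c mulrA mulVf ?mul1r// gt_eqF.
exists (2 * c); first by rewrite mulr_ge0.
apply: (@le_trans _ _ (\int[leb1]_y ((2 * c)%:E * (g y)%:E))%E).
  apply: ge0_le_integralW => x _.
    by rewrite lee_fin mulr_ge0 ?expR_ge0// addr_ge0// sqr_ge0.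
  rewrite -EFinM lee_fin -mulrA -gE.
  have -> : expR (- x ^+ 2) = expR (- (x ^+ 2 / 2)) * expR (- x ^+ 2 / 2).
    by rewrite -expRD; congr expR; field.
  rewrite mulrA ler_wpM2r ?expR_ge0// expRN ler_pdivrMr ?expR_gt0//.
  by have := expR_ge1Dx (x ^+ 2 / 2); have := sqr_ge0 x; nra.
rewrite ge0_integralZl_EFin//.
- rewrite -[leRHS]mule1; apply: lee_wpmul2l; first by rewrite lee_fin mulr_ge0.
  rewrite ge0_integral_leb1 ?(integral_normal_pdf 0 1)//.
    by apply/measurable_EFinP; exact: measurable_normal_pdf.
  by move=> x; rewrite lee_fin normal_pdf_ge0.
- by move=> x _; rewrite lee_fin; exact: normal_pdf_ge0.
- by apply/measurable_EFinP; exact: measurable_normal_pdf.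
- by rewrite mulr_ge0.
Qed.

Section law_embedding.
Context d (Omega : measurableType d) (R : realType) (P : probability Omega R).
Implicit Types (X : {RV P >-> R}).

(** The laws enter as constant random measures, for which the expectation in the
    inner product disappears; the modulus of the Fourier transform is compared
    with the weight 1 + y^2. *)
Lemma constant_rm_inner (nu : {charge set R -> \bar R}) (k K : R) : 0 <= k ->
  (\int[leb1]_y ((1 + y ^+ 2) * expR (- y ^+ 2))%:E <= K%:E)%E ->
  (forall y, (charge_integral nu (fun x => cos (x * y))) ^+ 2 +
             (charge_integral nu (fun x => sin (x * y))) ^+ 2 <= k * (1 + y ^+ 2)) ->
  (rm_inner P (fun=> nu) (fun=> nu) <= (k * K)%:E)%E.
Proof.
move=> k0 hK nuk; rewrite /rm_inner.
have cst (q : \bar R) : (\int[P]_w q = q)%E.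
  transitivity (q * P setT)%E; first exact: integral_cst.
  by rewrite probability_setT mule1.
rewrite cst.
apply: (@le_trans _ _ (\int[leb1]_y (k%:E * ((1 + y ^+ 2) * expR (- y ^+ 2))%:E))%E).
  have sq (a b : R) : a * a - - - b * - b = a ^+ 2 + b ^+ 2 by ring.
  apply: ge0_le_integralW => y _; rewrite -?EFinM lee_fin/= sq.
    by rewrite mulr_ge0 ?expR_ge0// addr_ge0// sqr_ge0.
  by rewrite mulrA ler_wpM2r ?expR_ge0.
rewrite ge0_integralZl_EFin//.
- by rewrite EFinM; apply: lee_wpmul2l.
- by move=> y _; rewrite lee_fin mulr_ge0 ?expR_ge0// addr_ge0// sqr_ge0.
- apply/measurable_EFinP/measurable_funM.
    by apply: measurable_funD => //; exact: measurable_funX.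
  by apply: measurableT_comp => //; apply: measurableT_comp => //; exact: measurable_funX.
Qed.

Lemma RV_integrable X (f : R -> R) (K : R) : measurable_fun [set: R] f ->
  (forall x, `|f x| <= K) -> P.-integrable [set: Omega] (EFin \o (fun w => f (X w))).
Proof.
move=> mf fK; apply: measurable_bounded_integrable => //.
- by apply: (@le_lt_trans _ _ 1%E); [exact: probability_le1|exact: ltry].
- exact: measurableT_comp.
- by exists K; split; [exact: num_real|move=> x Kx y _; exact: le_trans (fK _) (ltW Kx)].
Qed.

Lemma RV_integral X (f : R -> R) (K : R) : measurable_fun [set: R] f ->
  (forall x, `|f x| <= K) -> \int[distribution P X]_x f x = \int[P]_w f (X w).
Proof.
move=> mf fK; rewrite /Rintegral integral_distribution//; first exact/measurable_EFinP.
exact: RV_integrable fK.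
Qed.

Lemma law_integral X (f : R -> R) (K : R) : measurable_fun [set: R] f ->
  (forall x, `|f x| <= K) -> forall w, charge_integral (law X w) f = \int[P]_w f (X w).
Proof.
move=> mf fK w; rewrite (@charge_integral_diff _ _ (distribution P X) mzero _ K)//.
  rewrite [X in _ - X](_ : _ = 0) ?subr0; first exact: RV_integral fK.
  by rewrite /Rintegral integral_measure_zero.
by move=> A mA; rewrite /mzero sube0.
Qed.

Let mcos (y : R) : measurable_fun [set: R] (fun x : R => cos (x * y)).
Proof. by apply: measurableT_comp; [by apply: continuous_measurable_fun; exact: continuous_cos|exact: measurable_funM]. Qed.

Let msin (y : R) : measurable_fun [set: R] (fun x : R => sin (x * y)).
Proof. by apply: measurableT_comp; [by apply: continuous_measurable_fun; exact: continuous_sin|exact: measurable_funM]. Qed.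

Let bcos (y x : R) : `|cos (x * y)| <= 1. Proof. exact: cos_max. Qed.

Let bsin (y x : R) : `|sin (x * y)| <= 1. Proof. exact: sin_max. Qed.

(** The Fourier transform of a law is bounded, uniformly over all laws. *)
Lemma law_inner_bounded : exists2 k : R, 0 <= k & forall X, (rm_inner P (law X) (law X) <= k%:E)%E.
Proof.
have [K K0 hK] := @gauss_weight R.
have le1 X (f : R -> R) : measurable_fun [set: R] f -> (forall x, `|f x| <= 1) ->
    (\int[P]_w f (X w)) ^+ 2 <= 1.
  move=> mf f1; apply: square_Rintegral_le; first exact: measurableT_comp.
  apply: (@le_trans _ _ (\int[P]_w (cst 1%E w))%E).
    apply: ge0_le_integralW => w _; rewrite lee_fin ?sqr_ge0//.
    by rewrite -[leLHS]real_normK ?num_real// expr_le1// f1.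
  by rewrite [leLHS](_ : _ = P setT) ?probability_le1// integral_cst// mul1e.
exists (2 * K); first by rewrite mulr_ge0.
move=> X; apply: (constant_rm_inner _ hK) => // y.
rewrite (law_integral X (mcos y) (bcos y) point) (law_integral X (msin y) (bsin y) point).
have := le1 X _ (mcos y) (bcos y); have := le1 X _ (msin y) (bsin y).
by have := sqr_ge0 y; lra.
Qed.

Lemma law_preM X : preM P (law X).
Proof.
split; first by move=> A mA; exact: measurable_cst.
by have [k _ /(_ X)/le_lt_trans] := law_inner_bounded; apply; exact: ltry.
Qed.

Section completion.
Context (M : completeNormedModType R) (iota : completionM P M).

Lemma law_norm_bounded : exists2 k : R, 0 <= k & forall X, `|iota (law X)| <= k.
Proof.
have [k k0 hk] := law_inner_bounded.
exists (k + 1); first by rewrite addr_ge0.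
move=> X; have := hk X; rewrite -(embedM_norm iota (law_preM X)) lee_fin.
by have := normr_ge0 (iota (law X)); nra.
Qed.

(** In Fourier variables, |E e^{iyX} - E e^{iyX'}|^2 <= 2 y^2 E (X - X')^2, and
    y^2 is integrable against the Gaussian weight. *)
Lemma law_lipschitz : exists2 c : R, 0 <= c & forall X X' (h : R),
  (msq P [set: Omega] (fun w => X w - X' w)%R <= h%:E)%E ->
  `|iota (law X) - iota (law X')| ^+ 2 <= c * h.
Proof.
have [K K0 hK] := @gauss_weight R.
exists (2 * K); first by rewrite mulr_ge0.
move=> X X' h Xh.
have h0 : 0 <= h by rewrite -lee_fin; exact: le_trans (msq_ge0 _ _ _) Xh.
(* the difference of the laws, as a constant random measure *)
pose nu : {charge set R -> \bar R} := cadd (cscale (-1) (law X' point)) (law X point).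
pose p : @random_measure _ Omega R := fun=> nu.
have nuE (A : set R) : measurable A -> nu A = (distribution P X A - distribution P X' A)%E.
  by move=> mA; transitivity (- distribution P X' A + distribution P X A)%E; [rewrite -mulN1e|rewrite addeC].
have diff (f : R -> R) (y : R) : measurable_fun [set: R] f -> (forall x, `|f x| <= 1) ->
    (forall a b : R, `|f a - f b| <= `|y| * `|a - b|) ->
    (charge_integral nu f) ^+ 2 <= y ^+ 2 * h.
  move=> mf f1 fy; rewrite (charge_integral_diff mf f1 nuE) !(RV_integral _ mf f1).
  have fi (Z : {RV P >-> R}) : P.-integrable setT (EFin \o (fun w => f (Z w))) by exact: RV_integrable mf f1.
  rewrite -RintegralB//; apply: square_Rintegral_le.
    by apply: measurable_funB; exact: measurableT_comp.
  apply: (@le_trans _ _ (msq P setT (fun w => y * (X w - X' w)))).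
    by apply: msq_le => w _; rewrite normrM.
  rewrite msqZ//; last exact: measurable_funB.
  by rewrite [leRHS]EFinM; apply: lee_wpmul2l => //; rewrite lee_fin sqr_ge0.
have inner : (rm_inner P p p <= ((2 * h) * K)%:E)%E.
  apply: (constant_rm_inner _ hK); first by rewrite mulr_ge0.
  move=> y; have := diff _ y (mcos y) (bcos y); have := diff _ y (msin y) (bsin y).
  have lip (f : R -> R) : (forall a b, `|f a - f b| <= `|a - b|) ->
      forall a b, `|f (a * y) - f (b * y)| <= `|y| * `|a - b|.
    by move=> fl a b; apply: le_trans (fl _ _) _; rewrite -mulrBl normrM mulrC.
  move=> /(_ (lip _ (@sin_lipschitz R))) hs /(_ (lip _ (@cos_lipschitz R))) hc.
  by apply: le_trans (lerD hc hs) _; nra.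
have pM : preM P p.
  by split; [move=> A mA; exact: measurable_cst|exact: le_lt_trans inner (ltry _)].
have -> : iota (law X) - iota (law X') = iota p.
  have := @embedM_linear _ _ _ _ _ iota (-1) (law X') (law X) p
    (law_preM X') (law_preM X) pM (fun w A mA => erefl).
  by move=> ->; rewrite scaleN1r addrC.
rewrite -lee_fin (embedM_norm iota pM).
by have -> : 2 * K * h = 2 * h * K by ring.
Qed.

End completion.
End law_embedding.

(** * Coefficients *)

(** An open set is the union of those cells of the grids of mesh 1 / (n + 1)
    that it contains. *)
Lemma open_measurable_plane_line (R : realType) (V : set ((R * R) * R)) : open V -> measurable V.
Proof.
move=> oV.
pose e n : R := n.+1%:R.
have e0 n : 0 < e n by rewrite ltr0n.
pose cell n (i : int) : set R := [set t | i%:~R <= t * e n < (i + 1)%:~R].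
have mcell n i : measurable (cell n i).
  rewrite (_ : cell n i = `[i%:~R / e n, (i + 1)%:~R / e n[%classic); first exact: measurable_itv.
  by apply/seteqP; split => t; rewrite /cell/= in_itv/= ler_pdivrMr// ltr_pdivlMr.
pose box n (i : (int * int) * int) := (cell n i.1.1 `*` cell n i.1.2) `*` cell n i.2.
have mbox n i : measurable (box n i) by apply: measurableX => //; exact: measurableX.
pose G (k : nat * ((int * int) * int)) : set ((R * R) * R) :=
  if pselect (box k.1 k.2 `<=` V) then box k.1 k.2 else set0.
rewrite (_ : V = \bigcup_k G k).
  apply: countable_bigcupT_measurable => // k; rewrite /G.
  by case: pselect => ? /=; [exact: mbox|exact: measurable0].
apply/seteqP; split=> [p Vp|p [k _]]; last by rewrite /G; case: pselect => // h; exact: h.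
have /nbhs_ballP[r r0 rV] : nbhs p V by apply: open_nbhs_nbhs.
have [n nr] : exists n, (e n)^-1 < r.
  exists (Num.truncn r^-1); rewrite -[ltRHS]invrK ltf_pV2 ?posrE ?invr_gt0//.
  by rewrite /e truncnS_gt.
pose fl t := Num.floor (t * e n).
have fcell t : cell n (fl t) t by rewrite /cell/= floor_itv.
exists (n, ((fl p.1.1, fl p.1.2), fl p.2)) => //.
rewrite /G; case: pselect => [?|nV]/=; first by split; [split; exact: fcell|exact: fcell].
case: nV => q [[/= q1 q2] q3]; apply: rV.
have close (s t : R) : cell n (fl t) s -> ball t r s.
  move=> /andP[a b]; have /andP[a' b'] := fcell t.
  apply: (@lt_trans _ _ (e n)^-1) nr.
  rewrite -[ltRHS]mul1r ltr_pdivlMr// -[X in _ * X]gtr0_norm// -normrM mulrBl.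
  by move: a b a' b'; rewrite intrD ltr_norml => *; apply/andP; split; lra.
by split; [split|]; exact: close.
Qed.

Lemma measurable_select d (T : measurableType d) d' (T' : measurableType d') (D : set T) (idx : T -> nat)
    (F : nat -> T -> T') : measurable D -> (forall i, measurable (D `&` idx @^-1` [set i])) ->
  (forall i, measurable_fun D (F i)) -> measurable_fun D (fun x => F (idx x) x).
Proof.
move=> mD mi mF _ A mA.
rewrite (_ : D `&` _ = \bigcup_i ((D `&` idx @^-1` [set i]) `&` (D `&` F i @^-1` A))).
  by apply: bigcup_measurable => i _; apply: measurableI => //; exact: mF.
apply/seteqP; split=> [x [Dx Ax]|x [i _ [[Dx /= <-] [_ Ax]]]] //.
by exists (idx x).
Qed.

(** The number of the interval ](i * h), (i + 1) * h] that contains t, for t in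
    [0, N * h]; the point 0 is put in the first interval. *)
Definition cell_index (R : realType) (h : R) (N : nat) (t : R) : nat :=
  (\sum_(i < N) (i.+1%:R * h < t)%R)%N.

Section cell_index.
Context (R : realType) (h : R).
Hypothesis h0 : 0 < h.

Lemma cell_indexP N (t : R) : (0 < N)%N -> 0 <= t <= N%:R * h ->
  [/\ (cell_index h N t < N)%N, (cell_index h N t)%:R * h <= t,
      0 < t -> (cell_index h N t)%:R * h < t & t <= (cell_index h N t).+1%:R * h].
Proof.
case: N => // N _; elim: N => [|N ih] /andP[t0 tN].
  have -> : cell_index h 1 t = 0%N.
    by rewrite /cell_index big_ord_recl big_ord0/= ltNge tN.
  by rewrite mul0r.
have E : cell_index h N.+2 t = cell_index h N.+1 t.
  by rewrite /cell_index big_ord_recr/= ltNge tN addn0.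
rewrite E; have [tN'|tN'] := leP t (N.+1%:R * h).
  have [|a b c e] := ih; first by rewrite t0.
  by split => //; exact: leq_trans a _.
have -> : cell_index h N.+1 t = N.+1.
  rewrite /cell_index (eq_bigr (fun=> 1%N)) ?sum1_card ?card_ord// => i _.
  have -> // : i.+1%:R * h < t.
  by apply: le_lt_trans tN'; rewrite ler_pM2r// ler_nat ltn_ord.
by split => //; exact: ltW.
Qed.

Lemma cell_indexE N (t : R) (i : nat) : (0 < N)%N -> t <= N%:R * h ->
  i%:R * h < t <= i.+1%:R * h -> cell_index h N t = i.
Proof.
move=> N0 tN /andP[a b].
have t0 : 0 < t by apply: le_lt_trans a; rewrite mulr_ge0// ltW.
have [|_ _ c e] := @cell_indexP N t N0; first by rewrite tN ltW.
have {}c := c t0; set k := cell_index h N t in c e *.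
apply/eqP; rewrite eqn_leq; apply/andP; split; rewrite -ltnS.
  by rewrite -(ltr_nat R) -(ltr_pM2r h0); exact: lt_le_trans b.
by rewrite -(ltr_nat R) -(ltr_pM2r h0); exact: lt_le_trans e.
Qed.

Lemma measurable_cell_index N i : measurable [set t | cell_index h N t = i].
Proof.
have m : measurable_fun [set: R] (fun t => (cell_index h N t)%:R : R).
  rewrite (_ : (fun _ => _) = (fun t => \sum_(i < N) \1_(`]i.+1%:R * h, +oo[%classic) t)).
    by apply: measurable_sum => j; apply: measurable_indic; exact: measurable_itv.
  apply/funext => t; rewrite /cell_index natr_sum; apply: eq_bigr => j _.
  by rewrite indicE; congr (_%:R); congr nat_of_bool; apply/idP/idP; rewrite inE/= in_itv/= andbT.
have := m measurableT [set i%:R] (measurable_set1 _); rewrite setTI.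
rewrite (_ : _ @^-1` _ = [set t | cell_index h N t = i])//.
by apply/seteqP; split => t /=; [move=> /eqP; rewrite eqr_nat => /eqP|move=> ->].
Qed.

End cell_index.

Lemma continuous_pair_cst (U V : topologicalType) (v : V) : continuous (fun u : U => (u, v)).
Proof.
move=> u; exact: (@cvg_pair U U V (nbhs u) (nbhs u) (nbhs v) _ _ _ id (cst v)
  (@cvg_id _ _) (@cvg_cst _ _ _ _ _)).
Qed.

Section regular_coefficients.
Context (R : realType) (M : completeNormedModType R) (T : R).
Hypothesis T_gt0 : 0 < T.
Implicit Types (f : R * R -> R -> M -> R).

(** The properties of a coefficient on which the fixed point argument rests. *)
Record regular_coef f (C K0 : R) : Prop := RegularCoef {
  regular_C : 0 <= C ;
  regular_K0 : 0 <= K0 ;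
  regular_lip : forall z, square T z -> forall (y1 y2 : R) (m m' : M),
    `|f z y1 m - f z y2 m'| <= C * (`|y1 - y2| + `|m - m'|) ;
  regular_bound : forall z, square T z -> `|f z 0 0| <= K0 ;
  regular_measurable : forall m, measurable_fun (square T `*` [set: R]) (fun p => f p.1 p.2 m) }.

(** The inclusion p -> (p, m) is continuous, so Borel sets of the product pull
    back to Borel sets. *)
Lemma borel_coef_section f (m : M) : borel_coef T f ->
  measurable_fun (square T `*` [set: R]) (fun p => f p.1 p.2 m).
Proof.
move=> bf _ A mA.
pose j (p : (R * R) * R) : (R * R) * R * M := (p, m).
rewrite (_ : _ `&` _ = j @^-1` (coef_domain T `&` uncurry_coef f @^-1` A)); last first.
  by apply/seteqP; split => [p [[/= sp _] Ap]|p [/= sp Ap]].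
suff : <<s [set U : set (R * R * R * M) | open U] >> `<=` [set S | measurable (j @^-1` S)].
  by apply; exact: bf.
apply: smallest_sub.
  split => /=.
  - by rewrite preimage_set0; exact: measurable0.
  - by move=> S mS; rewrite setTD preimage_setC; exact: measurableC.
  - by move=> F mF; rewrite preimage_bigcup; exact: bigcupT_measurable.
move=> U oU /=; apply: open_measurable_plane_line.
by apply: open_comp => // p _; exact: continuous_pair_cst.
Qed.

(** Local boundedness at the points (x, 0, 0) and compactness of the square. *)
Lemma locally_bounded_base f : locally_bounded T f ->
  exists2 K0 : R, 0 <= K0 & forall z, square T z -> `|f z 0 0| <= K0.
Proof.
move=> lf.
have cS : compact (square T) by apply: compact_setX; exact: segment_compact.
have : near_covering (square T) by exact/compact_near_coveringP.
move=> /(_ _ (pinfty_nbhs R) (fun K x => square T x -> `|f x 0 0| <= K) _)[|K [Kr hK]].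
  move=> x sx; have [K hK] := lf (x, 0, 0) sx.
  have j : (fun x' : R * R => (x', 0, 0) : R * R * R * M) @ x --> (x, 0, 0).
    apply: (@cvg_comp _ _ _ (fun x' : R * R => (x', 0 : R)) (fun q => (q, 0 : M))).
      exact: continuous_pair_cst.
    exact: continuous_pair_cst.
  have hx := j _ hK.
  exists ([set x' | square T x' -> `|f x' 0 0| <= K], [set K' | K <= K']).
    split; first exact: hx.
    by exists K; split; [exact: num_real|move=> ? /ltW].
  by move=> [x' K'] [/= h1 h2] /h1 h3; exact: le_trans h2.
exists (`|K| + 1) => // z sz; apply: hK => //.
by apply: le_lt_trans (ler_norm K) _; rewrite ltrDl.
Qed.

Lemma regular_growth f C K0 : regular_coef f C K0 -> forall z, square T z ->
  forall y1 m, `|f z y1 m| <= K0 + C * (`|y1| + `|m|).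
Proof.
move=> rf z sz y1 m.
have -> : f z y1 m = f z 0 0 + (f z y1 m - f z 0 0) by ring.
apply: le_trans (ler_normD _ _) _; apply: lerD; first exact: regular_bound rf _ sz.
by apply: le_trans (regular_lip rf sz _ _ _ _) _; rewrite !subr0.
Qed.

End regular_coefficients.

(** * Freezing at the corners of a grid *)

Section grid.
Context d (Omega : measurableType d) (R : realType) (T : R).
Hypothesis T_gt0 : 0 < T.
Implicit Types (x : R * R) (N : nat).

Definition mesh N : R := T / N%:R.

Definition node N (i j : nat) : R * R := (i%:R * mesh N, j%:R * mesh N).

(** The corner lies below x in both coordinates: a value at the corner is in the
    past of x. *)
Definition corner N x : R * R :=
  node N (cell_index (mesh N) N x.1) (cell_index (mesh N) N x.2).

Lemma mesh_gt0 N : (0 < N)%N -> 0 < mesh N.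
Proof. by move=> N0; rewrite divr_gt0// ltr0n. Qed.

Lemma meshN N : (0 < N)%N -> N%:R * mesh N = T.
Proof. by move=> N0; rewrite mulrC divfK// pnatr_eq0 -lt0n. Qed.

Lemma squareP x : square T x <-> (0 <= x.1 <= T) /\ (0 <= x.2 <= T).
Proof. by rewrite /square /Rz; split => -[]; rewrite /= ?in_itv. Qed.

Lemma cornerP N x : (0 < N)%N -> square T x ->
  [/\ square T (corner N x), 0 <= x.1 - (corner N x).1 <= mesh N &
      0 <= x.2 - (corner N x).2 <= mesh N].
Proof.
move=> N0 /squareP[a b].
have h0 := mesh_gt0 N0.
have [|i1 l1 _ u1] := @cell_indexP _ _ h0 N x.1 N0; first by rewrite meshN.
have [|i2 l2 _ u2] := @cell_indexP _ _ h0 N x.2 N0; first by rewrite meshN.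
move: u1 u2; rewrite -!natr1 !mulrDl !mul1r => u1 u2.
split; [|by rewrite /=; lra..].
have p1 : 0 <= (cell_index (mesh N) N x.1)%:R * mesh N by rewrite mulr_ge0// ltW.
have p2 : 0 <= (cell_index (mesh N) N x.2)%:R * mesh N by rewrite mulr_ge0// ltW.
by apply/squareP; rewrite /=; split; lra.
Qed.

Let mcell N i (k : R * R -> R) : measurable_fun [set: R * R] k ->
  measurable (square T `*` [set: Omega] `&` (fun p => cell_index (mesh N) N (k p.1)) @^-1` [set i]).
Proof.
move=> mk; apply: measurableI; first exact: measurableXT (measurable_Rz _).
have mk' : measurable_fun [set: (R * R) * Omega] (fun p => k p.1) by exact: measurableT_comp.
by have := mk' measurableT _ (measurable_cell_index (mesh N) N i); rewrite setTI.
Qed.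

Lemma jm_corner N (F : R * R -> R * R -> Omega -> R) :
  (forall i j, jointly_measurable (square T) (F (node N i j))) ->
  jointly_measurable (square T) (fun x w => F (corner N x) x w).
Proof.
move=> mF; rewrite /jointly_measurable /corner.
apply: (@measurable_select _ _ _ _ _ (fun p : (R * R) * Omega => cell_index (mesh N) N p.1.1)
  (fun i p => F (node N i (cell_index (mesh N) N p.1.2)) p.1 p.2)).
- exact: measurableXT (measurable_Rz _).
- by move=> i; exact: mcell.
move=> i; apply: (@measurable_select _ _ _ _ _ (fun p : (R * R) * Omega => cell_index (mesh N) N p.1.2)
  (fun j p => F (node N i j) p.1 p.2)).
- exact: measurableXT (measurable_Rz _).
- by move=> j; exact: mcell.
- by move=> j; exact: mF.
Qed.

(** The diagonal is the limit of the functions in which the parameter is frozen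
    at the grid corner below x. *)
Lemma jm_diagonal (F : R * R -> R * R -> Omega -> R) (G : R * R -> R * R -> R) :
  (forall c, jointly_measurable (square T) (F c)) ->
  (forall c x w, square T c -> square T x -> `|F c x w - F x x w| <= G c x) ->
  (forall eps : R, 0 < eps -> exists del : R, 0 < del /\ forall c x, square T c -> square T x ->
      `|x.1 - c.1| <= del -> `|x.2 - c.2| <= del -> G c x <= eps) ->
  jointly_measurable (square T) (fun x w => F x x w).
Proof.
move=> mF FG Gcvg.
apply: (@measurable_fun_cvg _ _ _ _ (fun N (p : (R * R) * Omega) => F (corner N.+1 p.1) p.1 p.2)).
  by move=> N; apply: (@jm_corner N.+1 F) => i j; exact: mF.
move=> [x w] [/= sx _]; apply/cvgrPdist_le => /= eps eps0.
have [del [del0 hG]] := Gcvg _ eps0.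
exists (Num.truncn (T / del)) => // N /= leN.
have [sc c1 c2] := @cornerP N.+1 x (ltn0Sn _) sx.
have md : mesh N.+1 <= del.
  rewrite ler_pdivrMr ?ltr0n// mulrC -ler_pdivrMr//.
  by apply: le_trans (ltW (truncnS_gt _)) _; rewrite ler_nat.
rewrite distrC; apply: (le_trans (FG _ _ _ sc sx)); apply: hG => //.
- by have /andP[? /le_trans] := c1; rewrite ger0_norm//; exact.
- by have /andP[? /le_trans] := c2; rewrite ger0_norm//; exact.
Qed.

End grid.

(** * Coefficients along a regular process *)

Section regular_processes.
Context d (Omega : measurableType d) (R : realType) (P : probability Omega R).
Variable B : R * R -> Omega -> R.
Hypotheses (P_complete : measure_is_complete P) (B_sheet : brownian_sheet P B).
Context (M : completeNormedModType R) (iota : completionM P M).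
Variable T : R.
Hypothesis T_gt0 : 0 < T.
Implicit Types (x z : R * R) (X Z : R * R -> {RV P >-> R}) (f : R * R -> R -> M -> R).

Let qT : quadrant (T, T). Proof. by split; apply: ltW. Qed.

Definition dist1 x z : R := `|x.1 - z.1| + `|x.2 - z.2|.

(** The processes met along the Picard iteration. *)
Record good (K H : R) X : Prop := Good {
  good_jm : jointly_measurable (square T) X ;
  good_adapted : forall z, square T z -> sheet_measurable_at P B z (X z) ;
  good_L2 : forall z, square T z -> (msq P [set: Omega] (X z) <= K%:E)%E ;
  good_holder : forall z z', square T z -> square T z' ->
    (msq P [set: Omega] (fun w => X z w - X z' w)%R <= (H * dist1 z z')%:E)%E }.

(** The integrands whose drift and Ito integrals have regular adapted versions. *)
Record good_integrand (L : R) (phi : R * R -> Omega -> R) : Prop := GoodIntegrand {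
  gi_jm : jointly_measurable (square T) phi ;
  gi_adapted : forall x, square T x -> sheet_measurable_at P B x (phi x) ;
  gi_L2 : forall x, square T x -> (msq P [set: Omega] (phi x) <= L%:E)%E ;
  gi_approximable : approximable P B (T, T) phi }.

Let squareTT : square T (T, T). Proof. by apply/squareP; rewrite /= lexx ltW. Qed.

Lemma leb2_Rz_square z : square T z -> (leb2 (Rz z) <= (T ^+ 2)%:E)%E.
Proof.
move=> /squareP[/andP[a b] /andP[c e]]; rewrite leb2_Rz; last by split.
by rewrite lee_fin expr2 ler_pM.
Qed.

Lemma measurable_msq phi D : measurable D -> jointly_measurable D phi ->
  measurable_fun D (fun x => msq P [set: Omega] (phi x)).
Proof.
move=> mD mphi; apply: (@measurable_inner2 _ _ _ _ _ (fun x w => ((phi x w) ^+ 2)%:E)) => //.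
  by move=> x w _; rewrite lee_fin sqr_ge0.
exact: measurable_sqr.
Qed.

Lemma normsq_uniform phi (L : R) z : square T z -> jointly_measurable (Rz z) phi -> 0 <= L ->
  (forall x, rect (0, 0)%R z x -> msq P [set: Omega] (phi x) <= L%:E)%E ->
  (normsq_Rz P z phi <= (T ^+ 2 * L)%:E)%E.
Proof.
move=> sz mphi L0 hL.
have qz : quadrant z by have /squareP[/andP[? _] /andP[? _]] := sz; split.
rewrite normsq_swap// integral_Rz_rect//; first last.
- by apply: measurable_msq => //; exact: measurable_Rz.
- by move=> x _; exact: msq_ge0.
apply: (@le_trans _ _ (\int[leb2]_(x in rect (0, 0)%R z) cst L%:E x)%E).
  by apply: ge0_le_integralW => x xz; [exact: msq_ge0|exact: hL].
apply: (@le_trans _ _ (\int[leb2]_(x in Rz z) cst L%:E x)%E).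
  apply: ge0_subset_integral => //; [exact: measurable_rect|exact: measurable_Rz|].
  by move=> x [/andP[/ltW a b] /andP[/ltW c e]]; split; rewrite /= in_itv/=; apply/andP.
rewrite integral_cst; last exact: measurable_Rz.
by rewrite EFinM muleC lee_pmul// ?lee_fin// leb2_Rz_square.
Qed.

Variables (kl kn : R).
Hypotheses (kl0 : 0 <= kl) (kn0 : 0 <= kn).
Hypothesis law_lip : forall (X X' : {RV P >-> R}) (h : R),
  (msq P [set: Omega] (fun w => X w - X' w)%R <= h%:E)%E ->
  `|iota (law X) - iota (law X')| ^+ 2 <= kl * h.
Hypothesis law_bd : forall X : {RV P >-> R}, `|iota (law X)| <= kn.

Lemma msq_cst (a : R) : msq P [set: Omega] (fun=> a) = (a ^+ 2)%:E.
Proof.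
transitivity ((a ^+ 2)%:E * P [set: Omega])%E; first exact: integral_cst.
by rewrite probability_setT mule1.
Qed.

Section one_coefficient.
Variables (f : R * R -> R -> M -> R) (C K0 : R).
Hypothesis rf : regular_coef T f C K0.

Let C0 : 0 <= C := regular_C rf.

Lemma coef_measurable x (m : M) : square T x -> measurable_fun [set: R] (fun y => f x y m).
Proof.
move=> sx _ A mA; have := regular_measurable rf m (measurableX (measurable_Rz _) measurableT) mA.
move=> /measurable_xsection => /(_ x); rewrite setTI; congr measurable.
apply/seteqP; split => y; rewrite /xsection/= inE/=; first by case.
by move=> h; split.
Qed.

Definition coef_ext (m : M) : (R * R) * R -> R :=
  (fun q => f q.1 q.2 m) \_ (square T `*` [set: R]).

Lemma measurable_coef_ext m : measurable_fun [set: (R * R) * R] (coef_ext m).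
Proof.
have mD : measurable (square T `*` [set: R]) by apply: measurableX => //; exact: measurable_Rz.
by apply/(measurable_restrictT _ mD); exact: regular_measurable rf m.
Qed.

Lemma coef_extE m x (y : R) : square T x -> coef_ext m (x, y) = f x y m.
Proof. by move=> sx; rewrite /coef_ext patchE mem_set. Qed.

Lemma jm_coef_fixed (X : R * R -> Omega -> R) m : jointly_measurable (square T) X ->
  jointly_measurable (square T) (fun x w => f x (X x w) m).
Proof.
move=> mX; pose F := (fun p : (R * R) * Omega => X p.1 p.2) \_ (square T `*` [set: Omega]).
have mD := measurableXT (Omega := Omega) (measurable_Rz (T, T)).
have mF : measurable_fun [set: (R * R) * Omega] F by apply/(measurable_restrictT _ mD).
apply: (@eq_measurable_fun _ _ _ _ _ (fun p => coef_ext m (p.1, F p))).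
  move=> p /set_mem[/= sx _]; rewrite coef_extE// /F patchE mem_set//.
apply: measurable_funTS; apply: (measurableT_comp (measurable_coef_ext m)).
by apply: measurable_fun_pair.
Qed.

Lemma coef_msq x (Z : {RV P >-> R}) (K : R) : square T x ->
  (msq P [set: Omega] Z <= K%:E)%E ->
  (msq P [set: Omega] (fun w => f x (Z w) (iota (law Z))) <=
   (2 * (K0 + C * kn) ^+ 2 + 2 * (C ^+ 2 * K))%:E)%E.
Proof.
move=> sx ZK.
have A0 : 0 <= K0 + C * kn by rewrite addr_ge0 ?mulr_ge0// (regular_K0 rf).
apply: (@le_trans _ _ (msq P [set: Omega] (fun w => (K0 + C * kn) + C * `|Z w|))).
  apply: msq_le => w _; rewrite [leRHS]ger0_norm; last by rewrite addr_ge0// mulr_ge0.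
  apply: (le_trans (regular_growth rf sx _ _)).
  by have := ler_wpM2l C0 (law_bd Z); lra.
have mZ : measurable_fun [set: Omega] (fun w => `|Z w|) by exact: measurableT_comp.
apply: (le_trans (msqD P _ _ _)) => //; first exact: measurable_funM.
rewrite msq_cst msqZ// [leRHS]EFinD !EFinM leeD2l// lee_pmul2l ?lte_fin//.
apply: lee_wpmul2l; first by rewrite lee_fin sqr_ge0.
by apply: le_trans ZK; apply: msq_le => w _; rewrite normr_id.
Qed.

(** The distance of the laws is itself bounded by the mean square distance, so
    that both arguments of the coefficient contribute a multiple of h. *)
Lemma coef_diff_msq x (Z Z' : {RV P >-> R}) (h : R) : square T x ->
  (msq P [set: Omega] (fun w => Z w - Z' w)%R <= h%:E)%E ->
  (msq P [set: Omega] (fun w => f x (Z w) (iota (law Z)) - f x (Z' w) (iota (law Z')))%R <=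
   (2 * C ^+ 2 * (1 + kl) * h)%:E)%E.
Proof.
move=> sx Zh; have lh := law_lip Zh.
set mu := `|iota (law Z) - iota (law Z')| in lh *.
apply: (@le_trans _ _ (msq P [set: Omega] (fun w => C * (`|Z w - Z' w| + mu)))).
  apply: msq_le => w _; rewrite [leRHS]ger0_norm; first exact: regular_lip rf _ sx _ _ _ _.
  by rewrite mulr_ge0// addr_ge0// normr_ge0.
have mZ : measurable_fun [set: Omega] (fun w => `|Z w - Z' w|).
  by apply: measurableT_comp => //; exact: measurable_funB.
rewrite msqZ//; last exact: measurable_funD.
apply: (@le_trans _ _ ((C ^+ 2)%:E * (2 * h + 2 * mu ^+ 2)%:E)%E).
  apply: lee_wpmul2l; first by rewrite lee_fin sqr_ge0.
  apply: (le_trans (msqD P _ _ _)) => //.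
  rewrite msq_cst [leRHS]EFinD !EFinM leeD2r// lee_pmul2l ?lte_fin//.
  by apply: le_trans Zh; apply: msq_le => w _; rewrite normr_id.
by rewrite -EFinM lee_fin; have := sqr_ge0 C; nra.
Qed.

(** Mean square continuity of X makes its law continuous in x. *)
Lemma jm_coef (K H : R) X : good K H X ->
  jointly_measurable (square T) (fun x w => f x (X x w) (iota (law (X x)))).
Proof.
move=> gX; have mX := good_jm gX.
have H0 : 0 <= `|H| by [].
apply: (@jm_diagonal _ _ _ _ T_gt0 (fun c x w => f x (X x w) (iota (law (X c))))
  (fun c x => C * `|iota (law (X c)) - iota (law (X x))|)).
- by move=> c; exact: jm_coef_fixed.
- move=> c x w sc sx; apply: (le_trans (regular_lip rf sx _ _ _ _)).
  by rewrite subrr normr0 add0r.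
move=> eps eps0.
pose q := C ^+ 2 * (kl * (`|H| * 2)) + 1.
have q0 : 0 < q by rewrite ltr_wpDl// !mulr_ge0// sqr_ge0.
exists (eps ^+ 2 / q); split; first by rewrite divr_gt0// exprn_gt0.
move=> c x sc sx d1 d2.
have hc := law_lip (good_holder gX sc sx).
rewrite -(@ler_pXn2r _ 2)// ?nnegrE ?mulr_ge0//; last exact: ltW.
rewrite exprMn; apply: (@le_trans _ _ (C ^+ 2 * (kl * (`|H| * (2 * (eps ^+ 2 / q)))))).
  apply: ler_wpM2l; first exact: sqr_ge0.
  apply: (le_trans hc); apply: ler_wpM2l => //.
  apply: (@le_trans _ _ (`|H| * dist1 c x)).
    by apply: ler_wpM2r; [rewrite addr_ge0|exact: ler_norm].
  apply: ler_wpM2l => //; rewrite /dist1 distrC [`|c.2 - _|]distrC; lra.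
rewrite (_ : C ^+ 2 * _ = (q - 1) / q * eps ^+ 2); last by rewrite /q; field; rewrite gt_eqF.
rewrite ler_piMl ?sqr_ge0// ler_pdivrMr// mul1r; lra.
Qed.

Lemma coef_adapted x (m : M) (Z : Omega -> R) : square T x -> sheet_measurable_at P B x Z ->
  sheet_measurable_at P B x (fun w => f x (Z w) m).
Proof.
move=> sx aZ U mU; have := coef_measurable m sx measurableT mU; rewrite setTI.
exact: aZ.
Qed.

Let cell_sum N (g : nat -> nat -> R) (i0 j0 : nat) : (i0 < N)%N -> (j0 < N)%N ->
  \sum_(i < N) \sum_(j < N) g i j * ((i == i0 :> nat) && (j == j0 :> nat))%:R = g i0 j0.
Proof.
move=> iN jN; rewrite (bigD1 (Ordinal iN))//= (bigD1 (Ordinal jN))//= !eqxx mulr1.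
rewrite big1 ?addr0 => [|j]; last by rewrite -val_eqE/= => /negbTE ->; rewrite mulr0.
rewrite big1 ?addr0// => i; rewrite -val_eqE/= => /negbTE ni.
by rewrite big1// => j _; rewrite ni mulr0.
Qed.

Definition frozen_coef N X x w : R :=
  \sum_(i < N) \sum_(j < N)
    frozen (node T N i j) (node T N i.+1 j.+1) (X (node T N i j))
      (coef_ext (iota (law (X (node T N i j))))) x w.

Lemma frozen_coefE N X x w : (0 < N)%N -> rect (0, 0)%R (T, T) x ->
  frozen_coef N X x w = f x (X (corner T N x) w) (iota (law (X (corner T N x)))).
Proof.
move=> N0 /=[/= /andP[a b] /andP[c e]].
have sx : square T x by apply/squareP; rewrite !(ltW a) !(ltW c).
have h0 := mesh_gt0 T_gt0 N0.
have [|i1 l1 lt1 u1] := @cell_indexP _ _ h0 N x.1 N0; first by rewrite meshN// b (ltW a).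
have [|i2 l2 lt2 u2] := @cell_indexP _ _ h0 N x.2 N0; first by rewrite meshN// e (ltW c).
rewrite -(cell_sum (fun i j => f x (X (node T N i j) w) (iota (law (X (node T N i j))))) i1 i2).
apply: eq_bigr => i _; apply: eq_bigr => j _.
rewrite /frozen coef_extE//; congr (_ * _); rewrite indicE; congr (nat_of_bool _)%:R.
apply/idP/andP => [/set_mem[/= r1 r2]|[/eqP-> /eqP->]].
  split; apply/eqP; symmetry; apply: cell_indexE => //; rewrite meshN//.
by rewrite inE; split; rewrite /= ?lt1 ?lt2 ?u1 ?u2.
Qed.

Let qnode N i j : (0 < N)%N -> quadrant (node T N i j).
Proof. by move=> /(mesh_gt0 T_gt0)/ltW h0; split; rewrite /= mulr_ge0. Qed.

Let node_square N (i j : nat) : (0 < N)%N -> (i <= N)%N -> (j <= N)%N -> square T (node T N i j).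
Proof.
move=> N0 iN jN; have h0 := mesh_gt0 T_gt0 N0.
have le k : (k <= N)%N -> k%:R * mesh T N <= T.
  by move=> kN; rewrite -[leRHS](meshN T N0) ler_pM2r// ler_nat.
by have [? ?] := qnode i j N0; apply/squareP; split; apply/andP; split => //; exact: le.
Qed.

Lemma frozen_coef_approximable (K H : R) N X : (0 < N)%N -> good K H X ->
  jointly_measurable (square T) (frozen_coef N X) /\
  approximable P B (T, T) (frozen_coef N X).
Proof.
move=> N0 gX.
have h0 := mesh_gt0 T_gt0 N0.
pose F i j := frozen (node T N i j) (node T N i.+1 j.+1) (X (node T N i j))
      (coef_ext (iota (law (X (node T N i j))))).
have F_ok (i j : 'I_N) : jointly_measurable (square T) (F i j) /\ approximable P B (T, T) (F i j).
  have sn : square T (node T N i j) by apply: node_square => //; exact: ltnW.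
  have pr : proper_rect (node T N i j) (node T N i.+1 j.+1).
    by split; [exact: qnode|rewrite /= ltr_pM2r// ltr_nat..].
  have aX := good_adapted gX sn.
  have jF : jointly_measurable (square T) (F i j).
    exact: (jm_frozen P_complete B_sheet (node T N i.+1 j.+1) aX (measurable_coef_ext _)).
  split => //; apply: approximable_frozen => //; first exact: measurable_coef_ext.
  apply: (le_lt_trans _ (ltry (T ^+ 2 * `|2 * (K0 + C * kn) ^+ 2 + 2 * (C ^+ 2 * K)|))).
  apply: (normsq_uniform squareTT jF) => // x [/andP[/ltW x10 x1T] /andP[/ltW x20 x2T]].
  have sx : square T x by apply/squareP; rewrite x10 x20.
  apply: (@le_trans _ _ (2 * (K0 + C * kn) ^+ 2 + 2 * (C ^+ 2 * K))%:E); last first.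
    by rewrite lee_fin ler_norm.
  apply: le_trans (coef_msq sx (good_L2 gX sn)).
  apply: msq_le => w _; rewrite /F /frozen coef_extE// normrM ler_piMr// indicE.
  by case: (_ \in _); rewrite ?normr1 ?normr0.
have sum_ok (n : nat) (G : 'I_n -> R * R -> Omega -> R) :
    (forall i, jointly_measurable (square T) (G i) /\ approximable P B (T, T) (G i)) ->
    jointly_measurable (square T) (fun x w => \sum_(i < n) G i x w) /\
    approximable P B (T, T) (fun x w => \sum_(i < n) G i x w).
  by move=> hG; apply: approximable_sum => // i; have [] := hG i.
by apply: (sum_ok N (fun i x w => \sum_(j < N) F i j x w)) => i; exact: sum_ok.
Qed.

(** Freezing X and its law at the corners of the grid of N^2 cells changes the
    coefficient by O(1 / N) in mean square, and the frozen coefficient is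
    approximable cell by cell. *)
Lemma coef_good_integrand (K H : R) X : 0 <= K -> 0 <= H -> good K H X ->
  good_integrand (2 * (K0 + C * kn) ^+ 2 + 2 * (C ^+ 2 * K)) (fun x w => f x (X x w) (iota (law (X x)))).
Proof.
move=> Kge0 Hge0 gX; have jX := jm_coef gX.
split => //.
- by move=> x sx; apply: coef_adapted => //; exact: good_adapted gX _ sx.
- by move=> x sx; apply: coef_msq => //; exact: good_L2 gX _ sx.
apply: (approximable_limit P_complete B_sheet) => // eps eps0.
pose q := T ^+ 2 * (2 * C ^+ 2 * (1 + kl) * (H * (2 * T))) + 1.
have q0 : 0 < q.
  by rewrite ltr_wpDl// !mulr_ge0 ?sqr_ge0// ?addr_ge0// ltW.
pose N := (Num.truncn (q / eps)).+1.
have [jF aF] := @frozen_coef_approximable K H N X (ltn0Sn _) gX.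
exists (frozen_coef N X); split => //.
have h0 := mesh_gt0 T_gt0 (ltn0Sn (Num.truncn (q / eps))).
apply: (@le_trans _ _ (T ^+ 2 * (2 * C ^+ 2 * (1 + kl) * (H * (2 * mesh T N))))%:E).
  apply: (normsq_uniform squareTT).
  - exact: jmB.
  - by rewrite !mulr_ge0 ?sqr_ge0// ?addr_ge0// ltW.
  move=> x rx; have /= [/andP[/ltW x10 x1T] /andP[/ltW x20 x2T]] := rx.
  have sx : square T x by apply/squareP; rewrite x10 x20.
  have [sc c1 c2] := cornerP T_gt0 (ltn0Sn (Num.truncn (q / eps))) sx.
  have -> : msq P [set: Omega] (fun w => f x (X x w) (iota (law (X x))) - frozen_coef N X x w) =
      msq P [set: Omega] (fun w => f x (X x w) (iota (law (X x))) -
         f x (X (corner T N x) w) (iota (law (X (corner T N x))))).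
    by apply: eq_msq => w _; rewrite frozen_coefE.
  apply: coef_diff_msq => //; apply: le_trans (good_holder gX sx sc) _.
  rewrite lee_fin ler_wpM2l// /dist1; move: c1 c2 => /andP[? ?] /andP[? ?].
  by rewrite !ger0_norm//; lra.
rewrite lee_fin.
have -> : T ^+ 2 * (2 * C ^+ 2 * (1 + kl) * (H * (2 * mesh T N))) = (q - 1) / N%:R.
  by rewrite /q /mesh; field; rewrite pnatr_eq0.
rewrite ler_pdivrMr ?ltr0n//; apply: (@le_trans _ _ q); first by lra.
by rewrite mulrC -ler_pdivrMr// ltW// truncnS_gt.
Qed.

End one_coefficient.

End regular_processes.

(** * Integrals over varying rectangles *)

Section integrals.
Context d (Omega : measurableType d) (R : realType) (P : probability Omega R).
Variable B : R * R -> Omega -> R.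
Hypotheses (P_complete : measure_is_complete P) (B_sheet : brownian_sheet P B).
Implicit Types (x z : R * R) (phi psi : R * R -> Omega -> R) (J : Omega -> R).
Local Notation step := (@step _ Omega R).
Implicit Types (s : seq step).

Definition cut z phi x w : R := phi x w * \1_(Rz z) x.

(** The squared L^2 distance on the plane times the sample space; through cut it
    compares integrands over different rectangles. *)
Definition gap phi psi : \bar R :=
  msq (leb2 \x P)%E [set: (R * R) * Omega] (fun p => phi p.1 p.2 - psi p.1 p.2)%R.

Lemma jm_cut z phi : jointly_measurable (Rz z) phi -> jointly_measurable setT (cut z phi).
Proof.
move=> mphi; have mD := measurableXT (Omega := Omega) (measurable_Rz z).
rewrite /jointly_measurable setXTT.
rewrite (_ : (fun p => _) = (fun p : (R * R) * Omega => phi p.1 p.2) \_ (Rz z `*` [set: Omega])).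
  by apply/(measurable_restrictT _ mD).
apply/funext => -[x w]; rewrite /cut patchE indicE.
have -> : ((x, w) \in Rz z `*` [set: Omega]) = (x \in Rz z).
  by apply/idP/idP; rewrite !inE => // -[].
by case: (_ \in _); rewrite ?mulr1 ?mulr0.
Qed.

Lemma gap_inner phi psi : jointly_measurable setT phi -> jointly_measurable setT psi ->
  gap phi psi = (\int[P]_w \int[leb2]_x ((phi x w - psi x w) ^+ 2)%:E)%E.
Proof.
move=> mphi mpsi.
rewrite -(@joint_tonelli1 _ _ _ P setT (fun x w => ((phi x w - psi x w) ^+ 2)%:E))//.
- by rewrite setXTT.
- by move=> x w _; rewrite lee_fin sqr_ge0.
- apply: (@measurable_sqr _ _ _ _ (fun p : (R * R) * Omega => phi p.1 p.2 - psi p.1 p.2)).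
  exact: measurable_funB.
Qed.

Lemma gap_normsq z phi psi : jointly_measurable (Rz z) phi -> jointly_measurable (Rz z) psi ->
  gap (cut z phi) (cut z psi) = normsq_Rz P z (fun x w => phi x w - psi x w).
Proof.
move=> mphi mpsi; rewrite gap_inner; [|exact: jm_cut..].
apply: eq_integral => w _; rewrite [RHS]integral_mkcond; apply: eq_integral => x _.
rewrite patchE /cut indicE; case: (_ \in _); rewrite ?mulr1//.
by rewrite !mulr0 subrr expr0n.
Qed.

Lemma gap_triangle phi psi chi (a b : R) : jointly_measurable setT phi ->
  jointly_measurable setT psi -> jointly_measurable setT chi ->
  (gap phi psi <= a%:E)%E -> (gap psi chi <= b%:E)%E -> (gap phi chi <= (2 * a + 2 * b)%:E)%E.
Proof.
rewrite /jointly_measurable !setXTT => m1 m2 m3.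
exact: (msq_triangle measurableT m1 m2 m3).
Qed.

Lemma gapC phi psi : gap phi psi = gap psi phi.
Proof. exact: msqBC. Qed.

Lemma simple_gap s s' z z' : quadrant z -> quadrant z' ->
  admissible P B s -> admissible P B s' ->
  msq P [set: Omega] (fun w => simple_integral B s z w - simple_integral B s' z' w) =
  gap (cut z (simple_process s)) (cut z' (simple_process s')).
Proof.
move=> qz qz' hs hs'; rewrite (simple_integral_isometry P_complete B_sheet qz qz' hs hs').
rewrite gap_inner//; apply: jm_cut; exact: (jm_simple_Rz P_complete B_sheet).
Qed.

Lemma cvge0_le (u : nat -> \bar R) (e : R) : 0 < e -> u @ \oo --> 0%E ->
  \forall n \near \oo, (u n <= e%:E)%E.
Proof.
move=> e0 u0; have h : nbhs 0%E [set y : \bar R | (y < e%:E)%E].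
  by apply: open_nbhs_nbhs; split; [exact: open_ereal_lt_ereal|rewrite /= lte_fin].
have [N _ hN] := u0 _ h.
by exists N => // n /hN /ltW.
Qed.

(** A step whose corner lo is not below z is clipped to a degenerate rectangle. *)
Lemma simple_integral_adapted s z : quadrant z -> admissible P B s ->
  sheet_measurable_at P B z (simple_integral B s z).
Proof.
move=> [z1 z2] hs; apply/adapted_atP; rewrite /adapted_at.
have aB (c : R * R) : quadrant c -> c.1 <= z.1 -> c.2 <= z.2 -> adapted_at P B z (B c).
  move=> [c1 c2] cz1 cz2; apply/adapted_atP => U mU; apply: sub_sigma_algebra; left.
  by exists c, U; split=> //; apply/andP.
have m1 (a b : R) : Num.min a b <= b by rewrite ge_min lexx orbT.
have m0 (a b : R) : 0 <= a -> 0 <= b -> 0 <= Num.min a b by rewrite le_min => -> ->.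
elim: s hs => [_|e s ih hs].
  by rewrite /simple_integral; under eq_fun do rewrite big_nil; exact: measurable_cst.
rewrite /simple_integral; under eq_fun do rewrite big_cons.
apply: measurable_funD; last by apply: ih => f fs; apply: hs; right.
have [[[l1 l2] lu1 lu2] _ ae] := hs e (or_introl erefl).
have u1 := le_trans l1 (ltW lu1); have u2 := le_trans l2 (ltW lu2).
have [lz1|zl1] := leP (lo e).1 z.1; last first.
  rewrite (_ : (fun _ => _) = cst 0); first exact: measurable_cst.
  apply/funext => w; rewrite /incr /pmin/= (min_idPr (ltW zl1)).
  by rewrite (min_idPr (ltW (lt_trans zl1 lu1))); ring.
have [lz2|zl2] := leP (lo e).2 z.2; last first.
  rewrite (_ : (fun _ => _) = cst 0); first exact: measurable_cst.
  apply/funext => w; rewrite /incr /pmin/= (min_idPr (ltW zl2)).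
  by rewrite (min_idPr (ltW (lt_trans zl2 lu2))); ring.
apply: measurable_funM.
  by apply/adapted_atP; exact: sheet_measurable_mono ae.
apply: measurable_funD; last by apply: aB; rewrite /quadrant /=; [split; exact: m0|exact: m1..].
apply: measurable_funB; last by apply: aB; rewrite /quadrant /=; [split; exact: m0|exact: m1..].
apply: measurable_funB; by apply: aB; rewrite /quadrant /=; [split; exact: m0|exact: m1..].
Qed.

Lemma simple_integral_measurable s z : quadrant z -> admissible P B s ->
  measurable_fun [set: Omega] (simple_integral B s z).
Proof.
by move=> qz hs; apply: (sheet_measurable_fun P_complete B_sheet (simple_integral_adapted qz hs)).
Qed.

(** The isometry of simple processes passes to the limit. Passing through two
    approximating sequences costs the factor 16. With z = z' this compares
    integrands, with phi = phi' it gives the mean square modulus of the integral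
    in z. *)
Lemma ito_gap z z' phi phi' J J' (q : R) : quadrant z -> quadrant z' ->
  is_ito_integral P B z phi J -> is_ito_integral P B z' phi' J' ->
  (gap (cut z phi) (cut z' phi') <= q%:E)%E ->
  (msq P [set: Omega] (fun w => J w - J' w)%R <= (16 * q)%:E)%E.
Proof.
move=> qz qz' [[mphi _ _] mJ [S [aS S1 S2]]] [[mphi' _ _] mJ' [S' [aS' S1' S2']]] hq.
apply/lee_addgt0Pr => e e0.
have e30 : 0 < e / 30 by rewrite divr_gt0.
have [n1 _ h1] := cvge0_le e30 S1; have [n2 _ h2] := cvge0_le e30 S1'.
have [n3 _ h3] := cvge0_le e30 S2; have [n4 _ h4] := cvge0_le e30 S2'.
pose n := (n1 + n2 + n3 + n4)%N.
have a1 := h1 n ltac:(rewrite /= /n; lia); have a1' := h2 n ltac:(rewrite /= /n; lia).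
have a2 := h3 n ltac:(rewrite /= /n; lia); have a2' := h4 n ltac:(rewrite /= /n; lia).
have mS := @jm_simple_Rz _ _ _ _ _ P_complete B_sheet z _ (aS n).
have mS' := @jm_simple_Rz _ _ _ _ _ P_complete B_sheet z' _ (aS' n).
rewrite -gap_normsq// in a1; rewrite -gap_normsq// in a1'; rewrite gapC in a1.
have c1 := gap_triangle (jm_cut mphi) (jm_cut mphi') (jm_cut mS') hq a1'.
have := gap_triangle (jm_cut mS) (jm_cut mphi) (jm_cut mS') a1 c1.
rewrite -(simple_gap qz qz' (aS n) (aS' n)).
have mI := simple_integral_measurable qz (aS n).
have mI' := simple_integral_measurable qz' (aS' n).
move=> c2; have a3' : (msq P [set: Omega] (fun w => simple_integral B (S' n) z' w - J' w)%R <= (e / 30)%:E)%E.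
  by rewrite msqBC; exact: a2'.
have c3 := msq_triangle measurableT mI mI' mJ' c2 a3'.
apply: le_trans (msq_triangle measurableT mJ mI mJ' a2 c3) _.
by rewrite -EFinD lee_fin; lra.
Qed.

Lemma msq0_ae (f : Omega -> R) : measurable_fun [set: Omega] f ->
  (forall e : R, 0 < e -> (msq P [set: Omega] f <= e%:E)%E) -> {ae P, forall w, f w = 0}.
Proof.
move=> mf hf.
have msq0 : msq P [set: Omega] f = 0%E.
  apply/eqP; rewrite eq_le msq_ge0 andbT; apply/lee_addgt0Pr => e e0.
  by rewrite add0e; exact: hf.
have := @ae_eq_integral_abs _ _ _ P setT measurableT (fun w => ((f w) ^+ 2)%:E) (measurable_sqr mf).
move=> [+ _]; rewrite (eq_integral (fun w => ((f w) ^+ 2)%:E)); last first.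
  by move=> w _; rewrite gee0_abs// lee_fin sqr_ge0.
move=> /(_ msq0); apply: filterS => w /(_ I) [/eqP]; rewrite sqrf_eq0 => /eqP.
by [].
Qed.

(** Cauchy-Schwarz; the right-hand side may be infinite. *)
Lemma Rintegral_square_le d' (X : measurableType d') (mu : {measure set X -> \bar R}) (D : set X)
    (g : X -> R) (m : R) : measurable D -> measurable_fun D g -> 0 < m -> (mu D <= m%:E)%E ->
  (((\int[mu]_(x in D) g x) ^+ 2)%:E <= m%:E * msq mu D g)%E.
Proof.
move=> mD mg m0 muD; have := msq_ge0 mu D g.
have [|] := ltP (msq mu D g) +oo%E; last first.
  by rewrite leye_eq => /eqP -> _; rewrite gt0_muley ?leey// lte_fin.
move=> fin g0; have fn : msq mu D g \is a fin_num by rewrite ge0_fin_numE.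
have hq : (msq mu D g <= (fine (msq mu D g))%:E)%E by rewrite fineK.
have [gi [A [A0 gA Aq]]] := square_integral_le mD mg m0 muD hq.
rewrite -(fineK fn) -EFinM lee_fin; apply: le_trans Aq.
have : `|\int[mu]_(x in D) g x| <= A.
  by apply: (le_trans (le_normr_Rintegral mD gi)); rewrite /Rintegral gA.
by move=> h; rewrite -[leLHS]real_normK ?num_real// ler_sqr ?nnegrE.
Qed.

Lemma normsq_ae z phi : jointly_measurable (Rz z) phi -> (normsq_Rz P z phi < +oo)%E ->
  {ae P, forall w, (msq leb2 (Rz z) (phi ^~ w) < +oo)%E}.
Proof.
move=> mphi nphi.
have mF : measurable_fun [set: Omega] (fun w => msq leb2 (Rz z) (phi ^~ w)).
  apply: (@measurable_inner1 _ _ _ (Rz z) (fun x w => ((phi x w) ^+ 2)%:E)).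
  - exact: measurable_Rz.
  - by move=> x w _; rewrite lee_fin sqr_ge0.
  - exact: measurable_sqr.
have iF : P.-integrable [set: Omega] (fun w => msq leb2 (Rz z) (phi ^~ w)).
  apply/integrableP; split => //; apply: le_lt_trans nphi.
  by apply: ge0_le_integralW => // w _; rewrite gee0_abs// msq_ge0.
have := integrable_ae measurableT iF; apply: filterS => w /(_ I).
by rewrite ge0_fin_numE// msq_ge0.
Qed.

Section drift.
Variable T : R.
Hypothesis T_gt0 : 0 < T.

Definition drift phi z w : R := \int[leb2]_(x in Rz z) phi x w.

Lemma square_quadrant z : square T z -> quadrant z.
Proof. by move=> /squareP[/andP[? _] /andP[? _]]; split. Qed.

Lemma Rz_square z : square T z -> Rz z `<=` square T.
Proof. by move=> /squareP[/andP[_ ?] /andP[_ ?]]; exact: Rz_subset. Qed.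

Let T20 : 0 < T ^+ 2. Proof. exact: exprn_gt0. Qed.

Let leb2_Rz_le z : square T z -> (leb2 (Rz z) <= (T ^+ 2)%:E)%E.
Proof. exact: leb2_Rz_square. Qed.

Lemma measurable_drift z phi : jointly_measurable (Rz z) phi ->
  measurable_fun [set: Omega] (drift phi z).
Proof.
move=> mphi; apply: measurableT_comp => //.
under eq_fun do rewrite integralE.
have mE : measurable_fun (Rz z `*` [set: Omega]) (fun p => (phi p.1 p.2)%:E) by exact/measurable_EFinP.
apply: emeasurable_funB.
  apply: (@measurable_inner1 _ _ _ (Rz z) (fun x w => ((fun x => (phi x w)%:E)^\+ x)%E)).
  - exact: measurable_Rz.
  - by move=> x w _; exact: funepos_ge0.
  - by have := measurable_funepos mE; apply: eq_measurable_fun => p _; rewrite !funeposE.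
apply: (@measurable_inner1 _ _ _ (Rz z) (fun x w => ((fun x => (phi x w)%:E)^\- x)%E)).
- exact: measurable_Rz.
- by move=> x w _; exact: funeneg_ge0.
- by have := measurable_funeneg mE; apply: eq_measurable_fun => p _; rewrite !funenegE.
Qed.

Let cut_restrict z phi w : square T z ->
  ((EFin \o (cut z phi ^~ w)) \_ (square T) = (EFin \o (phi ^~ w)) \_ (Rz z))%E.
Proof.
move=> sz; apply/funext => x; rewrite !patchE /cut /= indicE.
case: ifPn => [|xs]; first by case: ifPn => _ _; rewrite ?mulr1 ?mulr0.
by rewrite ifN//; apply: contra xs; rewrite !inE; exact: Rz_square.
Qed.

Lemma drift_cut z phi w : square T z -> drift phi z w = \int[leb2]_(x in square T) cut z phi x w.
Proof.
move=> sz; rewrite /drift /Rintegral integral_mkcond [in RHS]integral_mkcond.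
by have := cut_restrict phi w sz; rewrite /comp => ->.
Qed.

Lemma square_integrable z phi w : square T z -> measurable_fun (Rz z) (phi ^~ w) ->
  (msq leb2 (Rz z) (phi ^~ w) < +oo)%E -> leb2.-integrable (Rz z) (EFin \o (phi ^~ w)).
Proof.
move=> sz mphi fin.
have fn : msq leb2 (Rz z) (phi ^~ w) \is a fin_num by rewrite ge0_fin_numE// msq_ge0.
have hq : (msq leb2 (Rz z) (phi ^~ w) <= (fine (msq leb2 (Rz z) (phi ^~ w)))%:E)%E by rewrite fineK.
by have [] := square_integral_le (measurable_Rz z) mphi T20 (leb2_Rz_le sz) hq.
Qed.

Lemma cut_integrable z phi w : square T z -> leb2.-integrable (Rz z) (EFin \o (phi ^~ w)) ->
  leb2.-integrable (square T) (EFin \o (cut z phi ^~ w)).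
Proof.
move=> sz ip; apply/(integrable_mkcond _ _).2 => //; first exact: measurable_Rz.
by rewrite cut_restrict//; apply/(integrable_mkcond _ _).1 => //; exact: measurable_Rz.
Qed.

(** Cauchy-Schwarz for almost every sample point, on the square of area T^2. *)
Lemma drift_gap z z' phi psi (q : R) : square T z -> square T z' ->
  jointly_measurable (Rz z) phi -> jointly_measurable (Rz z') psi ->
  (normsq_Rz P z phi < +oo)%E -> (normsq_Rz P z' psi < +oo)%E ->
  (gap (cut z phi) (cut z' psi) <= q%:E)%E ->
  (msq P [set: Omega] (fun w => drift phi z w - drift psi z' w)%R <= (T ^+ 2 * q)%:E)%E.
Proof.
move=> sz sz' mphi mpsi nphi npsi hq.
have mc := jm_cut mphi; have mc' := jm_cut mpsi.
have mS := measurable_Rz (T, T).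
have mdiff : jointly_measurable (square T) (fun x w => cut z phi x w - cut z' psi x w).
  by apply: jmB; apply: (jmS (D := setT)).
pose F w := (\int[leb2]_(x in square T) ((cut z phi x w - cut z' psi x w) ^+ 2)%:E)%E.
apply: (@le_trans _ _ (\int[P]_w ((T ^+ 2)%:E * F w))%E).
  apply: ae_ge0_le_integral => //.
  - by move=> w _; rewrite lee_fin sqr_ge0.
  - by apply: measurable_sqr; apply: measurable_funB; exact: measurable_drift.
  - by move=> w _; apply: mule_ge0; [rewrite lee_fin ltW|exact: msq_ge0].
  - apply: emeasurable_funM; first exact: measurable_cst.
    apply: (@measurable_inner1 _ _ _ (square T) (fun x w => ((cut z phi x w - cut z' psi x w) ^+ 2)%:E)) => //.
      by move=> x w _; rewrite lee_fin sqr_ge0.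
    exact: measurable_sqr.
  have := normsq_ae mpsi npsi; have := normsq_ae mphi nphi.
  apply: filterS2 => w f1 f2 _.
  have i1 := cut_integrable sz (square_integrable sz (jm_section w (measurable_Rz z) mphi) f1).
  have i2 := cut_integrable sz' (square_integrable sz' (jm_section w (measurable_Rz z') mpsi) f2).
  rewrite !drift_cut// -RintegralB//.
  apply: Rintegral_square_le => //; first exact: jm_section mdiff.
  by apply: leb2_Rz_le; apply/squareP; rewrite /= lexx ltW.
rewrite ge0_integralZl_EFin//; last 3 first.
- by move=> w _; exact: msq_ge0.
- apply: (@measurable_inner1 _ _ _ (square T) (fun x w => ((cut z phi x w - cut z' psi x w) ^+ 2)%:E)) => //.
    by move=> x w _; rewrite lee_fin sqr_ge0.
  exact: measurable_sqr.
- exact: ltW.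
rewrite [leRHS]EFinM; apply: lee_wpmul2l; first by rewrite lee_fin ltW.
apply: le_trans hq; rewrite gap_inner//; apply: ge0_le_integralW => w _; first exact: msq_ge0.
apply: msq_subset => //; apply: (@jm_section _ _ _ setT (fun x w => cut z phi x w - cut z' psi x w)) => //.
by apply: measurable_funB.
Qed.

End drift.

End integrals.

(** * Adapted versions of the integrals *)
Section good_integrands.
Context d (Omega : measurableType d) (R : realType) (P : probability Omega R).
Variable B : R * R -> Omega -> R.
Hypotheses (P_complete : measure_is_complete P) (B_sheet : brownian_sheet P B).
Variable T : R.
Hypothesis T_gt0 : 0 < T.
Implicit Types (x z : R * R) (phi psi : R * R -> Omega -> R) (J : Omega -> R).
Local Notation step := (@step _ Omega R).
Implicit Types (s : seq step).

Let squareTT : square T (T, T). Proof. by apply/squareP; rewrite /= lexx ltW. Qed.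

Let T20 : 0 < T ^+ 2. Proof. exact: exprn_gt0. Qed.

Lemma drift_simple s z w : quadrant z ->
  drift (simple_process s) z w =
  \sum_(e <- s) coef e w * fine (leb2 (rect (lo e) (up e) `&` Rz z)).
Proof.
move=> qz; have mz := measurable_Rz z.
have mr (e : step) := measurable_rect (lo e) (up e).
have fz : (leb2 (Rz z) < +oo)%E by rewrite leb2_Rz// ltry.
have fi (e : step) : leb2.-integrable (Rz z) (EFin \o (\1_(rect (lo e) (up e)) : R * R -> R)).
  apply: measurable_bounded_integrable => //.
  exists 1; split; first exact: num_real.
  move=> t t1 x _ /=; apply: le_trans (ltW t1); rewrite indicE; case: (_ \in _) => /=; rewrite ?normr1 ?normr0//.
rewrite /drift /simple_process.
have [|-> _] := @Rintegral_sum _ _ _ leb2 _ mz _ s (fun e x => coef e w * \1_(rect (lo e) (up e)) x).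
  by move=> e _; exact: (integrableZl mz (coef e w) (fi e)).
apply: eq_bigr => e _; rewrite RintegralZl//; congr (_ * _).
by rewrite /Rintegral integral_indic.
Qed.

Lemma drift_simple_adapted s z : quadrant z -> admissible P B s ->
  sheet_measurable_at P B z (drift (simple_process s) z).
Proof.
move=> qz hs; apply/adapted_atP; rewrite /adapted_at.
rewrite (_ : drift _ z = (fun w => \sum_(e <- s) coef e w * fine (leb2 (rect (lo e) (up e) `&` Rz z)))); last first.
  by apply/funext => w; exact: drift_simple.
elim: s hs => [_|e s ih hs]; first by under eq_fun do rewrite big_nil; exact: measurable_cst.
under eq_fun do rewrite big_cons.
apply: measurable_funD; last by apply: ih => f fs; apply: hs; right.
have [_ _ ae] := hs e (or_introl erefl).
have [/andP[l1 l2]|nl] := boolP (((lo e).1 <= z.1) && ((lo e).2 <= z.2)).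
  apply: measurable_funM; last exact: measurable_cst.
  by apply/adapted_atP; exact: sheet_measurable_mono ae.
rewrite (_ : _ `&` _ = set0).
  by under eq_fun do rewrite measure0 mulr0; exact: measurable_cst.
apply/seteqP; split => // x [[/andP[a1 _] /andP[a2 _]] [/=]]; rewrite !in_itv/=.
move=> /andP[_ b1] /andP[_ b2]; case/negP: nl.
by rewrite (ltW (lt_le_trans a1 b1)) (ltW (lt_le_trans a2 b2)).
Qed.

Section approximations.
Variables (L : R) (phi : R * R -> Omega -> R).
Hypotheses (L0 : 0 <= L) (gphi : good_integrand P B T L phi).

Let mphi : jointly_measurable (square T) phi := gi_jm gphi.

Lemma good_normsq z : square T z -> (normsq_Rz P z phi <= (T ^+ 2 * L)%:E)%E.
Proof.
move=> sz; apply: (normsq_uniform sz) => //.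
  by apply: jmS mphi; [exact: measurable_Rz|exact: Rz_square].
move=> x [/andP[/ltW a b] /andP[/ltW c e]]; apply: (gi_L2 gphi).
by apply: (Rz_square sz); split; rewrite /= in_itv/=; apply/andP.
Qed.

(** One sequence of simple processes serves all rectangles in the square. *)
Lemma fast_simple : exists S : nat -> seq step, (forall k, admissible P B (S k)) /\
  forall z, square T z -> forall k,
    (gap P (cut z phi) (cut z (simple_process (S k))) <= ((16 ^+ k)^-1)%:E)%E.
Proof.
have e0 k : 0 < (16 ^+ k)^-1 :> R by rewrite invr_gt0 exprn_gt0.
have /choice[S hS] : forall k, exists s, admissible P B s /\
    (normsq_Rz P (T, T) (fun x w => phi x w - simple_process s x w)%R <= ((16 ^+ k)^-1)%:E)%E.
  by move=> k; exact: (gi_approximable gphi (e0 k)).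
exists S; split => [k|z sz k]; first by have [] := hS k.
have [aS nS] := hS k.
have mS := @jm_simple_Rz _ _ _ _ _ P_complete B_sheet (T, T) _ aS.
have sub := @jmS _ Omega R (square T) (Rz z) _ (measurable_Rz (T, T)) (Rz_square sz).
rewrite gap_normsq; [|exact: sub|exact: sub].
apply: le_trans nS; have /squareP[/andP[_ ?] /andP[_ ?]] := sz.
by apply: normsq_mono => //; exact: jmB.
Qed.

(** The limit along fastlim is adapted exactly, not only up to a modification. *)
Lemma ito_exists : exists J : R * R -> Omega -> R, forall z, square T z ->
  is_ito_integral P B z phi (J z) /\ sheet_measurable_at P B z (J z).
Proof.
have [S [aS nS]] := fast_simple.
exists (fun z => fastlim (fun k => simple_integral B (S k) z)) => z sz.
have qz := square_quadrant sz.
have mz : jointly_measurable (Rz z) phi.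
  by apply: jmS mphi; [exact: measurable_Rz|exact: Rz_square].
have mSz k := @jm_simple_Rz _ _ _ _ _ P_complete B_sheet z _ (aS k).
have aJ : sheet_measurable_at P B z (fastlim (fun k => simple_integral B (S k) z)).
  apply/adapted_atP; apply: measurable_fastlim => k; apply/adapted_atP.
  exact: simple_integral_adapted.
have mI k := simple_integral_measurable P_complete B_sheet qz (aS k).
split => //; split.
- split => //.
  + by move=> x zx; apply: (gi_adapted gphi); exact: Rz_square zx.
  + exact: le_lt_trans (good_normsq sz) (ltry _).
- exact: (sheet_measurable_fun P_complete B_sheet aJ).
have e0 : (fun k => ((16 ^+ k)^-1)%:E) @ \oo --> (0%E : \bar R).
  apply: cvg_EFin; first exact: nearW.
  under eq_fun do rewrite -exprVn.
  by apply: cvg_expr; rewrite ger0_norm ?invr_ge0//; lra.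
exists S; split; first exact: aS.
  apply: (@squeeze_cvge _ _ _ _ (fun=> 0%E) _ (fun k => ((16 ^+ k)^-1)%:E)) => //; last exact: cvg_cst.
  apply: nearW => k; rewrite normsq_ge0/= -gap_normsq//; exact: nS.
have fc k : (msq P [set: Omega] (fun w => simple_integral B (S k.+1) z w - simple_integral B (S k) z w)%R
    <= (4 * (16 ^+ k)^-1)%:E)%E.
  rewrite (simple_gap P_complete B_sheet qz qz (aS _) (aS _)).
  have h := nS z sz k.+1; rewrite gapC in h.
  apply: le_trans (gap_triangle (jm_cut (mSz _)) (jm_cut mz) (jm_cut (mSz _)) h (nS z sz k)) _.
  rewrite lee_fin exprS invfM; set a := (16 ^+ k)^-1.
  have : 0 <= a by rewrite invr_ge0 exprn_ge0.
  lra.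
have lim := fast_cauchy_lim measurableT mI fc.
apply: (@squeeze_cvge _ _ _ _ (fun=> 0%E) _ (fun k => (16%:E * ((16 ^+ k)^-1)%:E)%E)).
- apply: nearW => k; apply/andP; split; first exact: msq_ge0.
  apply: le_trans (lim k) _; rewrite -EFinM lee_fin; lra.
- exact: cvg_cst.
- rewrite -[X in _ --> X](mule0 16%:E); apply: cvgeZl => //.
Qed.

(** The drift of a simple process is visibly adapted, and an almost sure limit
    of adapted variables has an adapted version. *)
Lemma drift_version : exists D : R * R -> Omega -> R, forall z, square T z ->
  sheet_measurable_at P B z (D z) /\ {ae P, forall w, D z w = drift phi z w}.
Proof.
have [S [aS nS]] := fast_simple.
exists (fun z => fastlim (fun k => drift (simple_process (S k)) z)) => z sz.
have qz := square_quadrant sz.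
have mz : jointly_measurable (Rz z) phi.
  by apply: jmS mphi; [exact: measurable_Rz|exact: Rz_square].
have mSz k := @jm_simple_Rz _ _ _ _ _ P_complete B_sheet z _ (aS k).
have aD k := drift_simple_adapted qz (aS k).
have mD k := sheet_measurable_fun P_complete B_sheet (aD k).
have aJ : sheet_measurable_at P B z (fastlim (fun k => drift (simple_process (S k)) z)).
  by apply/adapted_atP; apply: measurable_fastlim => k; apply/adapted_atP.
split => //.
have nphi : (normsq_Rz P z phi < +oo)%E by exact: le_lt_trans (good_normsq sz) (ltry _).
have nSz k : (normsq_Rz P z (simple_process (S k)) < +oo)%E.
  have h := nS z sz k; rewrite gapC in h.
  have j0 : jointly_measurable (Rz z) (fun (_ : R * R) (_ : Omega) => 0 : R) by exact: measurable_cst.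
  have h0 : (gap P (cut z phi) (cut z (fun _ _ => 0%R)) <= (T ^+ 2 * L)%:E)%E.
    rewrite gap_normsq//; apply: le_trans (good_normsq sz).
    by apply: normsq_le => x w _; rewrite subr0.
  have := gap_triangle (jm_cut (mSz k)) (jm_cut mz) (jm_cut j0) h h0.
  rewrite (gap_normsq P (mSz k) j0) => /le_lt_trans/(_ (ltry _)); apply: le_lt_trans.
  by apply: normsq_le => x w _; rewrite subr0.
have dk k : (msq P [set: Omega] (fun w => drift phi z w - drift (simple_process (S k)) z w)%R
    <= (T ^+ 2 * (16 ^+ k)^-1)%:E)%E.
  by exact: (drift_gap T_gt0 sz sz mz (mSz k) nphi (nSz k) (nS z sz k)).
have mdr := measurable_drift mz.
have fc k : (msq P [set: Omega] (fun w => drift (simple_process (S k.+1)) z w - drift (simple_process (S k)) z w)%R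
    <= (4 * T ^+ 2 * (16 ^+ k)^-1)%:E)%E.
  have h := dk k.+1; rewrite msqBC in h.
  apply: le_trans (msq_triangle measurableT (mD _) mdr (mD _) h (dk k)) _.
  rewrite lee_fin (exprS 16) invfM; set a := (16 ^+ k)^-1.
  have : 0 <= a by rewrite invr_ge0 exprn_ge0.
  by move: T20; set t := T ^+ 2; nra.
have lim k := fast_cauchy_lim measurableT mD fc k.
have mJ := sheet_measurable_fun P_complete B_sheet aJ.
have : {ae P, forall w, fastlim (fun k => drift (simple_process (S k)) z) w - drift phi z w = 0}.
  apply: msq0_ae; first exact: measurable_funB.
  move=> e e0; pose k := Num.truncn (34 * T ^+ 2 / e).
  have h := dk k; rewrite msqBC in h.
  apply: le_trans (msq_triangle measurableT mJ (mD k) mdr (lim k) h) _.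
  rewrite lee_fin (_ : _ + _ = 34 * T ^+ 2 / 16 ^+ k); last by field; rewrite expf_neq0.
  rewrite ler_pdivrMr ?exprn_gt0// -ler_pdivrMl// [leLHS]mulrC ltW//.
  by apply: lt_le_trans (truncnS_gt _) _; rewrite -natrX ler_nat ltn_expl.
by apply: filterS => w /eqP; rewrite subr_eq0 => /eqP.
Qed.

End approximations.
End good_integrands.

(** * The Picard map *)

Section picard_map.
Context d (Omega : measurableType d) (R : realType) (P : probability Omega R).
Variable B : R * R -> Omega -> R.
Hypotheses (P_complete : measure_is_complete P) (B_sheet : brownian_sheet P B).
Variable T : R.
Hypothesis T_gt0 : 0 < T.
Implicit Types (x z : R * R) (phi psi : R * R -> Omega -> R) (Z : R * R -> Omega -> R).

Lemma RV_family Z : (forall z, square T z -> measurable_fun [set: Omega] (Z z)) ->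
  exists X : R * R -> {RV P >-> R}, forall z, square T z -> X z = Z z :> (Omega -> R).
Proof.
move=> mZ.
have mZ' z : measurable_fun [set: Omega] (if pselect (square T z) then Z z else cst 0).
  by case: pselect => sz /=; [exact: mZ|exact: measurable_cst].
pose X z : {RV P >-> R} :=
  HB.pack (if pselect (square T z) then Z z else cst 0) (isMeasurableFun.Build _ _ _ _ _ (mZ' z)).
by exists X => z sz; rewrite /X /=; case: pselect.
Qed.

Lemma ae_eq_msq (f g : Omega -> R) : measurable_fun [set: Omega] f -> measurable_fun [set: Omega] g ->
  {ae P, forall w, f w = g w} -> msq P [set: Omega] f = msq P [set: Omega] g.
Proof.
move=> mf mg fg; apply: ae_eq_integral => //; [exact: measurable_sqr..|].
by apply: filterS fg => w -> _.
Qed.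

(** The symmetric difference of two rectangles is covered by two strips. *)
Lemma gap_holder (L : R) phi z z' : 0 <= L -> good_integrand P B T L phi ->
  square T z -> square T z' ->
  (gap P (cut z phi) (cut z' phi) <= (L * T * dist1 z z')%:E)%E.
Proof.
move=> L0 gphi sz sz'.
have sub y : square T y -> jointly_measurable (Rz y) phi.
  by move=> sy; apply: jmS (gi_jm gphi); [exact: measurable_Rz|exact: Rz_square].
have mz := jm_cut (sub _ sz); have mz' := jm_cut (sub _ sz').
pose I (a b : R) : set R := `[Num.min a b, Num.max a b]%classic.
pose A1 : set (R * R) := I z.1 z'.1 `*` `[0, T].
pose A2 : set (R * R) := `[0, T] `*` I z.2 z'.2.
have mA1 : measurable A1 by apply: measurableX; exact: measurable_itv.
have mA2 : measurable A2 by apply: measurableX; exact: measurable_itv.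
rewrite /gap /msq -[X in (\int[_]_(_ in X) _)%E](_ : setT `*` setT = _); last by rewrite setXTT.
rewrite (@joint_tonelli2 _ _ _ P setT (fun x w => ((cut z phi x w - cut z' phi x w) ^+ 2)%:E)) => //; first last.
- by apply: (@measurable_sqr _ _ _ _ (fun p : (R * R) * Omega => cut z phi p.1 p.2 - cut z' phi p.1 p.2));
    exact: measurable_funB.
- by move=> x w _; rewrite lee_fin sqr_ge0.
apply: (@le_trans _ _ (\int[leb2]_x (L%:E * ((\1_A1 x)%:E + (\1_A2 x)%:E)))%E).
  apply: ge0_le_integralW => x _; first exact: msq_ge0.
  have in_strips y y' : square T y -> Rz y x -> ~ Rz y' x ->
      (y = z /\ y' = z') \/ (y = z' /\ y' = z) -> square T x /\ (A1 x \/ A2 x).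
    move=> sy yx ny' zz; have sx := Rz_square sy yx; split => //.
    have [/andP[x10 x1T] /andP[x20 x2T]] := (squareP T x).1 sx.
    move: yx => [/=]; rewrite !in_itv/= => /andP[_ xy1] /andP[_ xy2].
    have [x1|x1] := leP x.1 y'.1; last first.
      left; split; rewrite /I /= in_itv/= ?x20//.
      by case: zz => -[e e']; subst; rewrite ge_min le_max ?xy1 ?(ltW x1) ?orbT.
    right; split; rewrite /I /= in_itv/= ?x10//.
    have x2 : y'.2 < x.2.
      by rewrite ltNge; apply/negP => x2; apply: ny'; split; rewrite /= in_itv/=; apply/andP.
    by case: zz => -[e e']; subst; rewrite ge_min le_max ?xy2 ?(ltW x2) ?orbT.
  have strips : square T x /\ (A1 x \/ A2 x) -> (L%:E <= L%:E * ((\1_A1 x)%:E + (\1_A2 x)%:E))%E.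
    move=> [_ Ax]; rewrite -EFinD -EFinM lee_fin ler_peMr//.
    by case: Ax => /mem_set h; rewrite !indicE h ?lerDl ?lerDr.
  have rhs0 : (0 <= L%:E * ((\1_A1 x)%:E + (\1_A2 x)%:E))%E.
    by rewrite -EFinD -EFinM lee_fin mulr_ge0// addr_ge0.
  have [zx|nzx] := pselect (Rz z x); have [z'x|nz'x] := pselect (Rz z' x).
  - under eq_integral do rewrite /cut !indicE !mem_set// subrr expr0n/=.
    by rewrite integral0.
  - have h := in_strips _ _ sz zx nz'x (or_introl (conj erefl erefl)).
    apply: le_trans (strips h); apply: le_trans (gi_L2 gphi h.1).
    by apply: msq_le => w _; rewrite /cut !indicE mem_set// memNset// mulr1 mulr0 subr0.
  - have h := in_strips _ _ sz' z'x nzx (or_intror (conj erefl erefl)).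
    apply: le_trans (strips h); apply: le_trans (gi_L2 gphi h.1).
    by apply: msq_le => w _; rewrite /cut !indicE memNset// mem_set// mulr1 mulr0 sub0r normrN.
  - under eq_integral do rewrite /cut !indicE !memNset// subrr expr0n/=.
    by rewrite integral0.
have m1 (A : set (R * R)) : measurable A -> measurable_fun setT (fun x => (\1_A x : R)%:E).
  by move=> mA; apply/measurable_EFinP; exact: measurable_indic.
rewrite ge0_integralZl_EFin//; last first.
- by apply: emeasurable_funD; exact: m1.
- by move=> x _; rewrite -EFinD lee_fin addr_ge0.
rewrite ge0_integralD//; [|exact: m1..].
rewrite !integral_indic// !setIT.
have mI a b : measurable (I a b) by exact: measurable_itv.
have leb1I (a b : R) : leb1 (I a b) = `|a - b|%:E.
  rewrite [LHS]lebesgue_measure_itv/= lte_fin.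
  case: (ltP a b) => ab.
    by rewrite ab -EFinD ltr0_norm ?subr_lt0// opprB.
  case: ifPn => [ba|]; first by rewrite -EFinD ger0_norm ?subr_ge0.
  rewrite -leNgt => ba; have -> : a = b by apply/eqP; rewrite eq_le ba ab.
  by rewrite subrr normr0.
have leb1T : leb1 (`[0, T]%classic) = T%:E.
  by rewrite [LHS]lebesgue_measure_itv/= lte_fin T_gt0 oppr0 adde0.
have l1 : leb2 A1 = (`|z.1 - z'.1| * T)%:E by rewrite /A1 leb2X// leb1I leb1T EFinM.
have l2 : leb2 A2 = (T * `|z.2 - z'.2|)%:E by rewrite /A2 leb2X// leb1I leb1T EFinM.
rewrite [X in (_ * (X + _))%E](_ : _ = (`|z.1 - z'.1| * T)%:E)//.
rewrite [X in (_ * (_ + X))%E](_ : _ = (T * `|z.2 - z'.2|)%:E)//.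
rewrite -EFinD -EFinM lee_fin /dist1.
by rewrite le_eqVlt; apply/orP; left; apply/eqP; ring.
Qed.

(** A process that is regular in mean square has a jointly measurable version that
    is still adapted: the values at the lower left corners of finer and finer grids
    converge almost surely. *)
Lemma holder_version (K H : R) Z : 0 <= H ->
  (forall z, square T z -> sheet_measurable_at P B z (Z z)) ->
  (forall z, square T z -> (msq P [set: Omega] (Z z) <= K%:E)%E) ->
  (forall z z', square T z -> square T z' ->
    (msq P [set: Omega] (fun w => Z z w - Z z' w)%R <= (H * dist1 z z')%:E)%E) ->
  exists X : R * R -> {RV P >-> R}, good B T K H X /\
    forall z, square T z -> {ae P, forall w, X z w = Z z w}.
Proof.
move=> H0 aZ KZ HZ.
have mZ z : square T z -> measurable_fun [set: Omega] (Z z).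
  by move=> sz; exact: (sheet_measurable_fun P_complete B_sheet (aZ z sz)).
have [Z1 Z1E] := RV_family mZ.
(* the mesh 16^-k matches the rate required by fastlim *)
pose c k := corner T (16 ^ k).
have c0 k : (0 < 16 ^ k)%N by rewrite expn_gt0.
have cP k x : square T x -> [/\ square T (c k x), 0 <= x.1 - (c k x).1 <= T * (16 ^+ k)^-1 &
    0 <= x.2 - (c k x).2 <= T * (16 ^+ k)^-1].
  by move=> sx; have := cornerP T_gt0 (c0 k) sx; rewrite /mesh natrX.
pose Y x := fastlim (fun k => Z1 (c k x)).
have jY : jointly_measurable (square T) Y.
  apply: (@measurable_fastlim _ _ _ _ (fun k (p : (R * R) * Omega) => Z1 (c k p.1) p.2)) => k.
  apply: (@jm_corner _ Omega _ _ (16 ^ k) (fun c0 _ w => Z1 c0 w)) => i j.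
  by rewrite /jointly_measurable; apply: measurable_funTS; apply: measurableT_comp.
have fc x : square T x -> forall k,
    (msq P [set: Omega] (fun w => Z1 (c k.+1 x) w - Z1 (c k x) w)%R <= (4 * T * H * (16 ^+ k)^-1)%:E)%E.
  move=> sx k; have [s1 a1 b1] := cP k.+1 x sx; have [s2 a2 b2] := cP k x sx.
  rewrite !Z1E//; apply: le_trans (HZ _ _ s1 s2) _; rewrite lee_fin mulrAC [leLHS]mulrC.
  apply: ler_wpM2r => //; rewrite /dist1.
  have e16 : T * (16 ^+ k.+1)^-1 = T * (16 ^+ k)^-1 / 16.
    by rewrite exprS; field; rewrite expf_neq0.
  rewrite e16 in a1 b1; rewrite -mulrA; set t := T * (16 ^+ k)^-1 in a1 b1 a2 b2 *.
  move: a1 b1 a2 b2 => /andP[? ?] /andP[? ?] /andP[? ?] /andP[? ?].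
  have : `|(c k.+1 x).1 - (c k x).1| <= 2 * t by rewrite ler_norml; apply/andP; split; lra.
  have : `|(c k.+1 x).2 - (c k x).2| <= 2 * t by rewrite ler_norml; apply/andP; split; lra.
  by lra.
have aY x : square T x -> sheet_measurable_at P B x (Y x).
  move=> sx; apply/adapted_atP; apply: measurable_fastlim => k; apply/adapted_atP.
  have [s1 /andP[a1 _] /andP[b1 _]] := cP k x sx.
  by rewrite Z1E//; apply: sheet_measurable_mono (aZ _ s1); rewrite -subr_ge0.
have mY x : square T x -> measurable_fun [set: Omega] (Y x).
  by move=> sx; exact: (sheet_measurable_fun P_complete B_sheet (aY x sx)).
have YZ x : square T x -> {ae P, forall w, Y x w = Z x w}.
  move=> sx; have mYx := mY x sx; have mZx := mZ x sx.
  have : {ae P, forall w, Y x w - Z x w = 0}.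
    apply: msq0_ae; first exact: measurable_funB.
    move=> e e0; pose k := Num.truncn (36 * T * H / e).
    have l1 := fast_cauchy_lim measurableT (fun k => measurable_funPT (Z1 (c k x))) (fc x sx) k.
    have [s1 /andP[a1 a2] /andP[b1 b2]] := cP k x sx.
    have l2 : (msq P [set: Omega] (fun w => Z1 (c k x) w - Z x w)%R <= (2 * T * H * (16 ^+ k)^-1)%:E)%E.
      rewrite Z1E//; apply: le_trans (HZ _ _ s1 sx) _; rewrite lee_fin mulrAC [leLHS]mulrC.
      apply: ler_wpM2r => //; rewrite /dist1 distrC [`|(c k x).2 - _|]distrC !ger0_norm//.
      by rewrite -mulrA; lra.
    apply: le_trans (msq_triangle measurableT mYx (measurable_funPT (Z1 (c k x))) mZx l1 l2) _.
    rewrite lee_fin (_ : _ + _ = 36 * T * H / 16 ^+ k); last by field; rewrite expf_neq0.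
    rewrite ler_pdivrMr ?exprn_gt0// -ler_pdivrMl// [leLHS]mulrC ltW//.
    by apply: lt_le_trans (truncnS_gt _) _; rewrite -natrX ler_nat ltn_expl.
  by apply: filterS => w /eqP; rewrite subr_eq0 => /eqP.
have [X XE] := RV_family mY.
exists X; split; last by move=> z sz; rewrite XE//; exact: YZ.
split.
- apply: eq_measurable_fun jY => -[x w] /set_mem[/= sx _].
  by rewrite XE.
- by move=> z sz; rewrite XE//; exact: aY.
- by move=> z sz; rewrite XE// (ae_eq_msq (mY z sz) (mZ z sz) (YZ z sz)); exact: KZ.
- move=> z z' sz sz'; rewrite !XE//.
  rewrite (@ae_eq_msq _ (fun w => Z z w - Z z' w)); first exact: HZ.
  + by apply: measurable_funB; exact: mY.
  + by apply: measurable_funB; exact: mZ.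
  + by have := YZ z' sz'; have := YZ z sz; apply: filterS2 => w -> ->.
Qed.

Lemma is_ito0 z : quadrant z -> is_ito_integral P B z (fun _ _ => 0) (fun=> 0).
Proof.
move=> qz.
have n0 : normsq_Rz P z (fun _ _ => 0 : R) = 0%E.
  rewrite /normsq_Rz; under eq_integral do under eq_integral do rewrite expr0n/=.
  under eq_integral do rewrite integral0.
  by rewrite integral0.
have i0 x w : simple_process [::] x w = 0 :> R by rewrite /simple_process big_nil.
have s0 w : simple_integral B [::] z w = 0 by rewrite /simple_integral big_nil.
split; [split| |exists (fun=> [::]); split] => //.
- move=> x _; apply/adapted_atP; exact: measurable_cst.
- by rewrite n0 ltry.
- rewrite (_ : (fun _ => _) = cst 0%E); first exact: cvg_cst.
  by apply/funext => n; rewrite -[RHS]n0; apply: eq_normsq => x w _; rewrite i0 subr0.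
- rewrite (_ : (fun _ => _) = cst 0%E); first exact: cvg_cst.
  apply/funext => n; under eq_integral do rewrite s0 subr0 expr0n/=.
  by rewrite integral0.
Qed.

Section step.
Context (M : completeNormedModType R) (iota : completionM P M).
Variables (kl kn : R).
Hypotheses (kl0 : 0 <= kl) (kn0 : 0 <= kn).
Hypothesis law_lip : forall (X X' : {RV P >-> R}) (h : R),
  (msq P [set: Omega] (fun w => X w - X' w)%R <= h%:E)%E ->
  `|iota (law X) - iota (law X')| ^+ 2 <= kl * h.
Hypothesis law_bd : forall X : {RV P >-> R}, `|iota (law X)| <= kn.
Variables (alpha beta : R * R -> R -> M -> R) (C K0 y : R).
Hypotheses (ra : regular_coef T alpha C K0) (rb : regular_coef T beta C K0).

(** Z is the right-hand side of the equation evaluated along X. *)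
Definition solves (X Z : R * R -> {RV P >-> R}) : Prop := forall z, square T z ->
  exists2 J : Omega -> R,
    is_ito_integral P B z (fun x w => beta x (X x w) (iota (law (X x)))) J &
    {ae P, forall w,
      let a x := alpha x (X x w) (iota (law (X x))) in
      leb2.-integrable (Rz z) (EFin \o a) /\
      Z z w = y + \int[leb2]_(x in Rz z) a x + J w}.

(** The constant of the output depends on the mean square bound K of the input
    but not on its modulus H; this keeps the constants bounded along the
    iteration. *)
Lemma picard_step (K : R) : 0 <= K -> exists2 K' : R, 0 <= K' & forall (H : R) (X : R * R -> {RV P >-> R}),
  0 <= H -> good B T K H X -> exists2 Z, good B T K' K' Z & solves X Z.
Proof.
move=> Kge0.
pose L := 2 * (K0 + C * kn) ^+ 2 + 2 * (C ^+ 2 * K).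
have L0 : 0 <= L.
  by apply: addr_ge0; apply: mulr_ge0 => //; [|apply: mulr_ge0 => //]; exact: sqr_ge0.
pose K1 := 2 * y ^+ 2 + 2 * (2 * (T ^+ 2 * (T ^+ 2 * L)) + 2 * (16 * (T ^+ 2 * L))).
pose H1 := 2 * (T ^+ 2 * (L * T)) + 2 * (16 * (L * T)).
have T0 := ltW T_gt0; have T20 := sqr_ge0 T.
have LT0 : 0 <= L * T by exact: mulr_ge0.
have H10 : 0 <= H1 by apply: addr_ge0; apply: mulr_ge0 => //; apply: mulr_ge0.
have TL0 : 0 <= T ^+ 2 * L by exact: mulr_ge0.
have K10 : 0 <= K1.
  apply: addr_ge0; apply: mulr_ge0 => //; first exact: sqr_ge0.
  by apply: addr_ge0; apply: mulr_ge0 => //; exact: mulr_ge0.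
exists (K1 + H1); first by rewrite addr_ge0.
move=> H X H0 gX.
have ga := coef_good_integrand P_complete B_sheet T_gt0 kl0 kn0 law_lip law_bd ra Kge0 H0 gX.
have gb := coef_good_integrand P_complete B_sheet T_gt0 kl0 kn0 law_lip law_bd rb Kge0 H0 gX.
rewrite -/L in ga gb.
set phia := (fun x w => alpha _ _ _) in ga.
set phib := (fun x w => beta _ _ _) in gb.
have [J hJ] := ito_exists P_complete B_sheet L0 gb.
have [D hD] := drift_version P_complete B_sheet T_gt0 L0 ga.
pose Z z w := y + (D z w + J z w).
have mD z : square T z -> measurable_fun [set: Omega] (D z).
  by move=> sz; exact: (sheet_measurable_fun P_complete B_sheet (hD z sz).1).
have mJ z : square T z -> measurable_fun [set: Omega] (J z).
  by move=> sz; exact: (sheet_measurable_fun P_complete B_sheet (hJ z sz).2).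
have mDJ z : square T z -> measurable_fun [set: Omega] (fun w => D z w + J z w).
  by move=> sz; apply: measurable_funD; [exact: mD|exact: mJ].
have mphia z : square T z -> jointly_measurable (Rz z) phia.
  by move=> sz; apply: jmS (gi_jm ga); [exact: measurable_Rz|exact: Rz_square].
have mphib z : square T z -> jointly_measurable (Rz z) phib.
  by move=> sz; apply: jmS (gi_jm gb); [exact: measurable_Rz|exact: Rz_square].
have mdr z : square T z -> measurable_fun [set: Omega] (drift phia z).
  by move=> sz; apply: measurable_drift; exact: mphia.
have nphia z : square T z -> (normsq_Rz P z phia < +oo)%E.
  by move=> sz; apply: le_lt_trans (good_normsq L0 ga sz) (ltry _).
have j0 z : jointly_measurable (Rz z) (fun (_ : R * R) (_ : Omega) => 0 : R).
  exact: measurable_cst.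
have aZ z : square T z -> sheet_measurable_at P B z (Z z).
  move=> sz; apply/adapted_atP; apply: measurable_funD; first exact: measurable_cst.
  by apply: measurable_funD; apply/adapted_atP; [have [] := hD z sz|have [] := hJ z sz].
have KZ z : square T z -> (msq P [set: Omega] (Z z) <= K1%:E)%E.
  move=> sz; have qz := square_quadrant sz.
  have g0 phi : jointly_measurable (Rz z) phi -> (normsq_Rz P z phi <= (T ^+ 2 * L)%:E)%E ->
      (gap P (cut z phi) (cut z (fun _ _ => 0%R)) <= (T ^+ 2 * L)%:E)%E.
    move=> mphi hphi; rewrite (gap_normsq P mphi (j0 z)); apply: le_trans hphi.
    by apply: normsq_le => x w _; rewrite subr0.
  have n0 : (normsq_Rz P z (fun _ _ => 0%R) < +oo)%E by have [[]] := is_ito0 qz.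
  have := drift_gap T_gt0 sz sz (mphia z sz) (j0 z) (nphia z sz) n0 (g0 _ (mphia z sz) (good_normsq L0 ga sz)).
  have := ito_gap P_complete B_sheet qz qz (hJ z sz).1 (is_ito0 qz) (g0 _ (mphib z sz) (good_normsq L0 gb sz)).
  rewrite (@eq_msq _ _ _ _ _ _ (J z)) => [bJ|w _]; last by rewrite subr0.
  rewrite (@eq_msq _ _ _ _ _ _ (drift phia z)) => [bD|w _]; last first.
    by rewrite {2}/drift /Rintegral integral0 subr0.
  rewrite -(ae_eq_msq (mD z sz) (mdr z sz) (hD z sz).2) in bD.
  apply: (le_trans (msqD P measurableT (measurable_cst y) (mDJ z sz))).
  rewrite msq_cst /K1 [leRHS]EFinD !EFinM leeD// lee_pmul2l ?lte_fin//.
  apply: (le_trans (msqD P measurableT (mD z sz) (mJ z sz))).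
  by rewrite [leRHS]EFinD !EFinM leeD// lee_pmul2l ?lte_fin//.
have HZ z z' : square T z -> square T z' ->
    (msq P [set: Omega] (fun w => Z z w - Z z' w)%R <= (H1 * dist1 z z')%:E)%E.
  move=> sz sz'; have qz := square_quadrant sz; have qz' := square_quadrant sz'.
  have ha := gap_holder L0 ga sz sz'; have hb := gap_holder L0 gb sz sz'.
  have bD := drift_gap T_gt0 sz sz' (mphia z sz) (mphia z' sz') (nphia z sz) (nphia z' sz') ha.
  have bJ := ito_gap P_complete B_sheet qz qz' (hJ z sz).1 (hJ z' sz').1 hb.
  have mDD : measurable_fun [set: Omega] (fun w => D z w - D z' w).
    by apply: measurable_funB; exact: mD.
  have mJJ : measurable_fun [set: Omega] (fun w => J z w - J z' w).
    by apply: measurable_funB; exact: mJ.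
  have bD' : (msq P [set: Omega] (fun w => D z w - D z' w)%R <= (T ^+ 2 * (L * T * dist1 z z'))%:E)%E.
    apply: le_trans bD; rewrite (@ae_eq_msq _ (fun w => drift phia z w - drift phia z' w))//.
      by apply: measurable_funB; exact: mdr.
    by have := (hD z' sz').2; have := (hD z sz).2; apply: filterS2 => w -> ->.
  rewrite (@eq_msq _ _ _ _ _ _ (fun w => (D z w - D z' w) + (J z w - J z' w))); last first.
    by move=> w _; rewrite /Z; ring.
  apply: (le_trans (msqD P measurableT mDD mJJ)).
  apply: (le_trans (leeD (lee_wpmul2l _ bD') (lee_wpmul2l _ bJ))); rewrite ?lee_fin//.
  by rewrite /H1 le_eqVlt; apply/orP; left; apply/eqP; ring.
have [X' [gX' X'Z]] := holder_version H10 aZ KZ HZ.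
exists X'.
  split; [exact: good_jm gX'|exact: good_adapted gX'| |].
    move=> z sz; apply: le_trans (good_L2 gX' sz) _; rewrite lee_fin; lra.
  move=> z z' sz sz'; apply: le_trans (good_holder gX' sz sz') _; rewrite lee_fin.
  by rewrite ler_wpM2r ?addr_ge0//; lra.
move=> z sz; exists (J z); first by have [] := hJ z sz.
have := normsq_ae (mphia z sz) (nphia z sz); have := (hD z sz).2; have := X'Z z sz.
move=> h1 h2 h3; have h12 : {ae P, forall w, X' z w = y + drift phia z w + J z w}.
  by apply: filterS2 h1 h2 => w -> h; rewrite /Z h addrA.
apply: filterS2 h12 h3 => w -> h; split => //.
exact: (square_integrable T_gt0 sz (jm_section w (measurable_Rz z) (mphia z sz)) h).
Qed.

End step.
End picard_map.

(** * Contraction in an exponentially weighted norm *)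

Lemma exp_integral (R : realType) (lam t : R) : 0 < lam -> 0 <= t ->
  (\int[leb1]_s (expR (lam * s) * \1_(`[0%R, t]%classic) s)%:E <= (lam^-1 * expR (lam * t))%:E)%E.
Proof.
move=> lam0 t0.
have me : measurable_fun [set: R] (fun s : R => expR (lam * s)).
  by apply: measurableT_comp => //; exact: mulrl_measurable.
rewrite ge0_integral_leb1; first last.
- by move=> s; rewrite lee_fin mulr_ge0// expR_ge0.
- apply/measurable_EFinP; apply: measurable_funM => //; apply: measurable_indic; exact: measurable_itv.
apply: (@le_trans _ _ (\int[lebesgue_measure]_(s in `[0%R, t]%classic) (expR (lam * s))%:E)%E).
  rewrite [leRHS]integral_mkcond le_eqVlt; apply/orP; left; apply/eqP; apply: eq_integral => s _.
  by rewrite patchE indicE; case: ifPn => _; rewrite ?mulr1 ?mulr0.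
move: t0; rewrite le_eqVlt => /orP[/eqP<-|t0].
  by rewrite set_itv1 integral_set1 lee_fin mulr_ge0 ?expR_ge0// invr_ge0 ltW.
pose F (s : R) : R := lam^-1 * expR (lam * s).
have dF (s : R) : is_derive s 1 F (expR (lam * s)).
  apply: is_derive_eq; rewrite /GRing.scale/=; by field; rewrite gt_eqF.
have cF : continuous F.
  by move=> s; apply: differentiable_continuous; apply/derivable1_diffP; have := dF s => -[].
have ce : continuous (fun s : R => expR (lam * s)).
  move=> s; apply: continuous_comp; last exact: continuous_expR.
  by apply: cvgM; [exact: cvg_cst|exact: cvg_id].
rewrite (@continuous_FTC2 _ _ F)//.
- by rewrite -EFinB lee_fin /F gerBl mulr_ge0 ?expR_ge0// invr_ge0 ltW.
- exact: continuous_subspaceT.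
- split; [by move=> s _; have := dF s => -[]| |].
    by apply: cvg_at_right_filter; exact: cF.
  by apply: cvg_at_left_filter; exact: cF.
- by move=> s _; rewrite derive1E; have := dF s => -[_ ->].
Qed.

Lemma exp_weight_integral (R : realType) (T lam : R) (z : R * R) : 0 < T -> 0 < lam -> square T z ->
  (\int[leb2]_(x in Rz z) (expR (lam * x.1))%:E <= (T / lam * expR (lam * z.1))%:E)%E.
Proof.
move=> T0 lam0 /squareP[/andP[z10 z1T] /andP[z20 z2T]].
have me : measurable_fun [set: R] (fun s : R => expR (lam * s)).
  by apply: measurableT_comp => //; exact: mulrl_measurable.
have mI (a : R) : measurable (`[0, a]%classic : set R) by exact: measurable_itv.
pose u (s : R) : R := expR (lam * s) * \1_(`[0, z.1]%classic) s.
pose v (s : R) : R := \1_(`[0, z.2]%classic) s.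
have mu : measurable_fun [set: R] u by apply: measurable_funM => //; exact: measurable_indic.
have mv : measurable_fun [set: R] v by exact: measurable_indic.
have u0 s : 0 <= u s by rewrite mulr_ge0// expR_ge0.
have v0 s : 0 <= v s by rewrite /v.
pose F (x : R * R) : \bar R := (u x.1 * v x.2)%:E.
have F0 x : (0 <= F x)%E by rewrite lee_fin mulr_ge0.
have mF : measurable_fun [set: R * R] F.
  apply/measurable_EFinP; apply: measurable_funM.
    exact: (measurableT_comp mu).
  exact: (measurableT_comp mv).
apply: (@le_trans _ _ (\int[leb2]_x F x)%E).
  rewrite integral_mkcond; apply: ge0_le_integralW => x _.
    by rewrite patchE; case: ifPn => // _; rewrite lee_fin expR_ge0.
  rewrite patchE; case: ifPn => [/set_mem[h1 h2]|_] //.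
  by rewrite /F /u /v !indicE !mem_set// !mulr1.
rewrite /leb2 fubini_tonelli1//.
apply: (@le_trans _ _ (\int[leb1]_s (T%:E * (u s)%:E))%E).
  apply: ge0_le_integralW => s _; first exact: integral_ge0.
  rewrite /fubini_F /F/=; under eq_integral do rewrite EFinM.
  rewrite ge0_integralZl_EFin//; [|by move=> t _; rewrite lee_fin|exact/measurable_EFinP].
  rewrite muleC; apply: lee_wpmul2r; first by rewrite lee_fin.
  rewrite /v integral_indic// setIT [leLHS]lebesgue_measure_itv/= lte_fin.
  by case: ifPn => _; rewrite ?oppr0 ?adde0 lee_fin// ltW.
rewrite ge0_integralZl_EFin//; [|by move=> t _; rewrite lee_fin|exact/measurable_EFinP|exact: ltW].
rewrite -mulrA EFinM; apply: lee_wpmul2l; first by rewrite lee_fin ltW.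
exact: exp_integral.
Qed.

Section contraction.
Context d (Omega : measurableType d) (R : realType) (P : probability Omega R).
Variable B : R * R -> Omega -> R.
Hypotheses (P_complete : measure_is_complete P) (B_sheet : brownian_sheet P B).
Variable T : R.
Hypothesis T_gt0 : 0 < T.
Context (M : completeNormedModType R) (iota : completionM P M).
Variables (kl kn : R).
Hypotheses (kl0 : 0 <= kl) (kn0 : 0 <= kn).
Hypothesis law_lip : forall (X X' : {RV P >-> R}) (h : R),
  (msq P [set: Omega] (fun w => X w - X' w)%R <= h%:E)%E ->
  `|iota (law X) - iota (law X')| ^+ 2 <= kl * h.
Hypothesis law_bd : forall X : {RV P >-> R}, `|iota (law X)| <= kn.
Variables (alpha beta : R * R -> R -> M -> R) (C K0 y : R).
Hypotheses (ra : regular_coef T alpha C K0) (rb : regular_coef T beta C K0).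
Implicit Types (x z : R * R) (X Z : R * R -> {RV P >-> R}).
Local Notation solves := (solves B T iota alpha beta y).

Let C0 : 0 <= C := regular_C ra.

Let T20 : 0 < T ^+ 2. Proof. exact: exprn_gt0. Qed.

(** Cauchy-Schwarz in the plane, for almost every sample point, and the
    Lipschitz bound of alpha. *)
Lemma solves_difference X X' Z Z' z : solves X Z -> solves X' Z' -> square T z ->
  exists J J' : Omega -> R,
    [/\ is_ito_integral P B z (fun x w => beta x (X x w) (iota (law (X x)))) J,
        is_ito_integral P B z (fun x w => beta x (X' x w) (iota (law (X' x)))) J' &
        {ae P, forall w, (((Z z w - Z' z w - (J w - J' w)) ^+ 2)%:E <=
          (T ^+ 2)%:E * msq leb2 (Rz z) (fun x =>
            C * (`|X x w - X' x w| + `|iota (law (X x)) - iota (law (X' x))|))%R)%E}].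
Proof.
move=> sX sX' sz; have [J iJ aJ] := sX z sz; have [J' iJ' aJ'] := sX' z sz.
exists J, J'; split => //; apply: filterS2 aJ aJ' => w /= [i1 ->] [i2 ->].
have mz := measurable_Rz z.
set a := fun x => alpha x (X x w) _ in i1 *; set a' := fun x => alpha x (X' x w) _ in i2 *.
have -> : y + \int[leb2]_(x in Rz z) a x + J w - (y + \int[leb2]_(x in Rz z) a' x + J' w) -
    (J w - J' w) = \int[leb2]_(x in Rz z) (a x - a' x).
  by rewrite RintegralB//; ring.
have ma := measurable_int _ i1; have ma' := measurable_int _ i2.
apply: (le_trans (Rintegral_square_le mz _ T20 (leb2_Rz_square sz))).
  by apply: measurable_funB; apply/measurable_EFinP.
apply: lee_wpmul2l; first by rewrite lee_fin ltW.
apply: msq_le => x zx; rewrite [leRHS]ger0_norm; last by rewrite mulr_ge0// addr_ge0.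
by apply: (regular_lip ra); exact: (Rz_square sz).
Qed.

Definition kappa : R := 2 * C ^+ 2 * (1 + kl).

Let kappa0 : 0 <= kappa.
Proof. by apply: mulr_ge0; [apply: mulr_ge0 => //; exact: sqr_ge0|exact: addr_ge0]. Qed.

(** The drifts contribute 2 T^2 through Cauchy-Schwarz, the stochastic integrals
    2 * 16 through the isometry. *)
Definition contraction_rate : R := kappa * (2 * T ^+ 2 + 32).

(** Drifts and stochastic integrals both differ by at most a multiple of the
    integral over R_z of the squared distance of the inputs; integrating the
    weight e^(lam t) gains the factor 1 / lam. *)
Lemma solves_contraction X X' Z Z' (q lam : R) : 0 <= q -> 0 < lam ->
  jointly_measurable (square T) X -> jointly_measurable (square T) X' ->
  solves X Z -> solves X' Z' ->
  (forall x, square T x -> (msq P [set: Omega] (fun w => X x w - X' x w)%R <= (q * expR (lam * x.1))%:E)%E) ->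
  forall z, square T z -> (msq P [set: Omega] (fun w => Z z w - Z' z w)%R <=
    (contraction_rate * q * (T / lam) * expR (lam * z.1))%:E)%E.
Proof.
move=> q0 lam0 mX mX' sX sX' hX z sz; have qz := square_quadrant sz; have mz := measurable_Rz z.
have [J [J' [iJ iJ' aZ]]] := solves_difference sX sX' sz.
pose e x := expR (lam * x.1).
have e0 x : 0 <= e x by exact: expR_ge0.
have me : measurable_fun [set: R * R] e.
  apply: measurableT_comp => //; apply: measurable_funM => //; exact: measurable_fst.
have IE : (\int[leb2]_(x in Rz z) (kappa * (q * e x))%:E <= (kappa * (q * (T / lam * e z)))%:E)%E.
  under eq_integral do rewrite EFinM (EFinM q).
  have h x : (0 <= (e x)%:E)%E by rewrite lee_fin.
  rewrite ge0_integralZl_EFin//; last first.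
  - by apply: emeasurable_funM => //; apply: measurable_funTS; apply/measurable_EFinP.
  - by move=> x _; rewrite mule_ge0// lee_fin.
  rewrite ge0_integralZl_EFin//; last by apply: measurable_funTS; apply/measurable_EFinP.
  rewrite [leRHS]EFinM; apply: lee_wpmul2l; first by rewrite lee_fin.
  rewrite [leRHS]EFinM; apply: lee_wpmul2l; first by rewrite lee_fin.
  exact: exp_weight_integral.
set I := kappa * (q * (T / lam * e z)) in IE.
have mJJ : measurable_fun [set: Omega] (fun w => J w - J' w).
  by case: iJ => _ ? _; case: iJ' => _ ? _; exact: measurable_funB.
have ZZ : measurable_fun [set: Omega] (fun w => Z z w - Z' z w) by exact: measurable_funB.
have bJ : (msq P [set: Omega] (fun w => J w - J' w)%R <= (16 * I)%:E)%E.
  apply: (ito_gap P_complete B_sheet qz qz iJ iJ').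
  have mb : jointly_measurable (Rz z) (fun x w => beta x (X x w) (iota (law (X x)))).
    by case: iJ => -[].
  have mb' : jointly_measurable (Rz z) (fun x w => beta x (X' x w) (iota (law (X' x)))).
    by case: iJ' => -[].
  rewrite (gap_normsq P mb mb') normsq_swap; last exact: jmB.
  apply: le_trans IE; apply: ge0_le_integralW => x zx; first exact: msq_ge0.
  have sx := Rz_square sz zx.
  exact: (coef_diff_msq law_lip rb sx (hX x sx)).
(* a measurable majorant of the difference of the drift coefficients *)
pose g x w : R := C * (`|X x w - X' x w| + Num.sqrt (kl * (q * e x))).
have mXX : jointly_measurable (square T) (fun x w => `|X x w - X' x w|).
  by apply: measurableT_comp => //; exact: measurable_funB.
have msq_e : measurable_fun [set: R * R] (fun x => Num.sqrt (kl * (q * e x))).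
  apply: (@measurableT_comp _ _ _ _ _ _ (@Num.sqrt R)).
    by apply: continuous_measurable_fun; exact: sqrt_continuous.
  by do 2 apply: measurable_funM => //.
have mg : jointly_measurable (Rz z) g.
  apply: (jmS (D := square T)); [exact: measurable_Rz|exact: Rz_square|].
  apply: measurable_funM => //; apply: measurable_funD => //.
  by apply: measurable_funTS; apply: (measurableT_comp msq_e).
have mgw : measurable_fun [set: Omega] (fun w => msq leb2 (Rz z) (g ^~ w)).
  apply: (@measurable_inner1 _ _ _ (Rz z) (fun x w => ((g x w) ^+ 2)%:E)) => //.
    by move=> x w _; rewrite lee_fin sqr_ge0.
  exact: measurable_sqr.
have ng : (normsq_Rz P z g <= I%:E)%E.
  rewrite normsq_swap//; apply: le_trans IE; apply: ge0_le_integralW => x zx; first exact: msq_ge0.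
  have sx := Rz_square sz zx.
  have mn : measurable_fun [set: Omega] (fun w => `|X x w - X' x w|).
    by apply: measurableT_comp => //; exact: measurable_funB.
  rewrite /g msqZ//; last exact: measurable_funD.
  apply: (@le_trans _ _ ((C ^+ 2)%:E * (2 * (q * e x) + 2 * (kl * (q * e x)))%:E)%E).
    apply: lee_wpmul2l; first by rewrite lee_fin sqr_ge0.
    apply: (le_trans (msqD P measurableT mn (measurable_cst _))).
    rewrite msq_cst sqr_sqrtr ?mulr_ge0// [leRHS]EFinD !EFinM leeD2r// lee_pmul2l ?lte_fin//.
    rewrite -EFinM; apply: le_trans (hX x sx).
    by apply: msq_le => w _; rewrite normr_id.
  by rewrite -EFinM lee_fin /kappa le_eqVlt; apply/orP; left; apply/eqP; ring.
have bD : (msq P [set: Omega] (fun w => (Z z w - Z' z w) - (J w - J' w))%R <= (T ^+ 2 * I)%:E)%E.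
  apply: (@le_trans _ _ (\int[P]_w ((T ^+ 2)%:E * msq leb2 (Rz z) (g ^~ w)))%E).
    apply: ae_ge0_le_integral => //.
    - by move=> w _; rewrite lee_fin sqr_ge0.
    - by apply: measurable_sqr; exact: measurable_funB.
    - by move=> w _; apply: mule_ge0; [rewrite lee_fin ltW|exact: msq_ge0].
    - by apply: emeasurable_funM => //; exact: measurable_cst.
    apply: filterS aZ => w h _; apply: (le_trans h); apply: lee_wpmul2l; first by rewrite lee_fin ltW.
    apply: msq_le => x zx; have sx := Rz_square sz zx.
    rewrite [leLHS]ger0_norm; last by rewrite mulr_ge0// addr_ge0.
    rewrite [leRHS]ger0_norm; last by rewrite mulr_ge0// addr_ge0// sqrtr_ge0.
    rewrite /g ler_wpM2l// lerD2l -[leLHS]ger0_norm// -sqrtr_sqr ler_wsqrtr//.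
    exact: law_lip (hX x sx).
  rewrite ge0_integralZl_EFin//; last 2 first.
  - by move=> w _; exact: msq_ge0.
  - exact: ltW.
  by rewrite [leRHS]EFinM; apply: lee_wpmul2l => //; rewrite lee_fin ltW.
have -> : (fun w => Z z w - Z' z w) = (fun w => ((Z z w - Z' z w) - (J w - J' w)) + (J w - J' w)).
  by apply/funext => w; rewrite subrK.
apply: (le_trans (msqD P measurableT (measurable_funB ZZ mJJ) mJJ)).
apply: (le_trans (leeD (lee_wpmul2l _ bD) (lee_wpmul2l _ bJ))); rewrite ?lee_fin//.
by rewrite /contraction_rate /I le_eqVlt; apply/orP; left; apply/eqP; rewrite /e; ring.
Qed.

End contraction.

(** * Existence *)

Section existence.
Context d (Omega : measurableType d) (R : realType) (P : probability Omega R).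
Variable B : R * R -> Omega -> R.
Hypotheses (P_complete : measure_is_complete P) (B_sheet : brownian_sheet P B).
Variable T : R.
Hypothesis T_gt0 : 0 < T.
Context (M : completeNormedModType R) (iota : completionM P M).
Variables (kl kn : R).
Hypotheses (kl0 : 0 <= kl) (kn0 : 0 <= kn).
Hypothesis law_lip : forall (X X' : {RV P >-> R}) (h : R),
  (msq P [set: Omega] (fun w => X w - X' w)%R <= h%:E)%E ->
  `|iota (law X) - iota (law X')| ^+ 2 <= kl * h.
Hypothesis law_bd : forall X : {RV P >-> R}, `|iota (law X)| <= kn.
Variables (alpha beta : R * R -> R -> M -> R) (C K0 y : R).
Hypotheses (ra : regular_coef T alpha C K0) (rb : regular_coef T beta C K0).
Implicit Types (x z : R * R) (X Z : R * R -> {RV P >-> R}).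
Local Notation solves := (solves B T iota alpha beta y).
Local Notation rate := (contraction_rate T kl C).

Let C0 : 0 <= C := regular_C ra.

Lemma contraction_rate_ge0 : 0 <= rate.
Proof.
apply: mulr_ge0; last by rewrite addr_ge0// mulr_ge0// sqr_ge0.
by apply: mulr_ge0; [apply: mulr_ge0 => //; exact: sqr_ge0|exact: addr_ge0].
Qed.

(** An exponent for which the Picard map contracts by 1/16. *)
Definition exponent : R := 16 * rate * T + 1.

Lemma exponent_gt0 : 0 < exponent.
Proof.
apply: ltr_wpDl => //; apply: mulr_ge0; last exact: ltW.
by apply: mulr_ge0 => //; exact: contraction_rate_ge0.
Qed.

Local Notation e z := (expR (exponent * z.1)).

Lemma weight_ge1 z : square T z -> 1 <= e z.
Proof.
move=> /squareP[/andP[z0 _] _]; rewrite -expR0 ler_expR mulr_ge0//.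
exact: ltW exponent_gt0.
Qed.

Lemma weight_le z : square T z -> e z <= expR (exponent * T).
Proof.
by move=> /squareP[/andP[_ z1] _]; rewrite ler_expR ler_wpM2l// ltW// exponent_gt0.
Qed.

Lemma picard_contraction X X' Z Z' (q : R) : 0 <= q ->
  jointly_measurable (square T) X -> jointly_measurable (square T) X' ->
  solves X Z -> solves X' Z' ->
  (forall x, square T x -> (msq P [set: Omega] (fun w => X x w - X' x w)%R <= (q * e x)%:E)%E) ->
  forall z, square T z ->
    (msq P [set: Omega] (fun w => Z z w - Z' z w)%R <= (q / 16 * e z)%:E)%E.
Proof.
move=> q0 mX mX' sX sX' hX z sz.
have := solves_contraction P_complete B_sheet T_gt0 kl0 law_lip ra rb q0 exponent_gt0 mX mX' sX sX' hX sz.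
move/le_trans; apply; rewrite lee_fin ler_wpM2r ?expR_ge0//.
have h : rate * (T / exponent) <= 16^-1.
  by rewrite mulrA ler_pdivrMr ?exponent_gt0// /exponent; lra.
by have := ler_wpM2l q0 h; lra.
Qed.

Let constant_process : R * R -> {RV P >-> R} := fun=> cst y.

Let good_constant : good B T (y ^+ 2) 0 constant_process.
Proof.
split => //.
- exact: measurable_cst.
- by move=> z _; apply/adapted_atP; exact: measurable_cst.
- by move=> z _; rewrite msq_cst.
- move=> z z' _ _; rewrite mul0r (@eq_msq _ _ _ _ _ _ (fun=> 0)) ?msq_cst ?expr0n//.
  by move=> w _; rewrite /= subrr.
Qed.

Lemma geometric_small (c eps : R) : 0 < eps -> exists n, c * (16 ^+ n)^-1 <= eps.
Proof.
move=> eps0; exists (Num.truncn (c / eps)).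
rewrite ler_pdivrMr ?exprn_gt0// -ler_pdivrMl// [leLHS]mulrC ltW//.
by apply: lt_le_trans (truncnS_gt _) _; rewrite -natrX ler_nat ltn_expl.
Qed.

(** The Picard iterates converge at the rate 16^-n to a regular process Y. One
    more application of the map to Y gives a process Z, and the contraction
    between the iterates and Y shows Y = Z almost surely. *)
Lemma existence : exists Y, strong_solution iota B T alpha beta y Y.
Proof.
have step := picard_step P_complete B_sheet T_gt0 kl0 kn0 law_lip law_bd y ra rb.
pose G := {X : R * R -> {RV P >-> R} | exists K H, [/\ 0 <= K, 0 <= H & good B T K H X]}.
have /choice[F hF] : forall g : G, exists g' : G, solves (sval g) (sval g').
  move=> [X [K [H [Kge0 Hge0 gX]]]]; have [K' K'0 hK'] := step K Kge0.
  have [Z gZ sZ] := hK' H X Hge0 gX.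
  by exists (exist _ Z (ex_intro _ K' (ex_intro _ K' (And3 K'0 K'0 gZ)))).
have g0 : exists K H, [/\ 0 <= K, 0 <= H & good B T K H constant_process].
  by exists (y ^+ 2), 0; split => //; exact: sqr_ge0.
pose X n := sval (iter n F (exist _ constant_process g0)).
have sX n : solves (X n) (X n.+1) by exact: hF.
have gX n : exists K H, [/\ 0 <= K, 0 <= H & good B T K H (X n)] by exact: (proj2_sig (iter n F _)).
have jX n : jointly_measurable (square T) (X n) by have [K [H [_ _ /good_jm]]] := gX n.
have mX n z : measurable_fun [set: Omega] (X n z) by [].
have [K1 [H1 [K10 _ gX1]]] := gX 1%N.
(* a bound on the first increment, which starts the geometric estimate *)
pose q := 2 * K1 + 2 * y ^+ 2.
have q0 : 0 <= q by rewrite addr_ge0// mulr_ge0// sqr_ge0.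
have diff n : forall z, square T z ->
    (msq P [set: Omega] (fun w => X n.+1 z w - X n z w)%R <= (q * (16 ^+ n)^-1 * e z)%:E)%E.
  elim: n => [z sz|n ih z sz].
    rewrite expr0 invr1 mulr1; apply: (@le_trans _ _ q%:E); last first.
      by rewrite lee_fin ler_peMr// weight_ge1.
    have h1 := good_L2 gX1 sz; have h0 := good_L2 good_constant sz.
    rewrite (@eq_msq _ _ _ _ _ _ (fun w => X 1%N z w + - y))//.
    apply: (le_trans (msqD P measurableT (mX 1%N z) (measurable_cst _))).
    by rewrite msq_cst sqrrN [leRHS]EFinD !EFinM leeD2r// lee_pmul2l ?lte_fin.
  have q'0 : 0 <= q * (16 ^+ n)^-1 by rewrite mulr_ge0// invr_ge0 exprn_ge0.
  apply: le_trans (picard_contraction q'0 (jX _) (jX _) (sX _) (sX _) ih sz) _.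
  by rewrite lee_fin ler_wpM2r ?expR_ge0// exprS invfM; lra.
pose c := q * expR (exponent * T).
have c0 : 0 <= c by rewrite mulr_ge0// expR_ge0.
have fc z : square T z -> forall n,
    (msq P [set: Omega] (fun w => X n.+1 z w - X n z w)%R <= (c * (16 ^+ n)^-1)%:E)%E.
  move=> sz n; apply: le_trans (diff n z sz) _; rewrite lee_fin mulrAC.
  by rewrite ler_wpM2r ?invr_ge0 ?exprn_ge0// ler_wpM2l// weight_le.
pose K2 := 2 * (4 * c) + 2 * y ^+ 2.
have K20 : 0 <= K2 by rewrite /K2; have := sqr_ge0 y; lra.
have XK2 n z : square T z -> (msq P [set: Omega] (X n z) <= K2%:E)%E.
  move=> sz; have := fast_cauchy_msq measurableT (mX^~ z) (fc z sz) 0 n.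
  rewrite add0n expr0 invr1 mulr1 => h.
  rewrite (@eq_msq _ _ _ _ _ _ (fun w => (X n z w - X 0%N z w) + y)); last first.
    by move=> w _; rewrite /= subrK.
  apply: (le_trans (msqD P measurableT (measurable_funB (mX n z) (mX 0%N z)) (measurable_cst _))).
  by rewrite msq_cst [leRHS]EFinD !EFinM leeD2r// lee_pmul2l ?lte_fin// -EFinM.
have [H2 H20 hH2] := step K2 K20.
have XH2 n z z' : square T z -> square T z' ->
    (msq P [set: Omega] (fun w => X n.+1 z w - X n.+1 z' w)%R <= (H2 * dist1 z z')%:E)%E.
  move=> sz sz'; have [K [H [_ Hge0 gXn]]] := gX n.
  have gXn' : good B T K2 H (X n).
    split; [exact: jX|exact: good_adapted gXn|by move=> *; exact: XK2|exact: good_holder gXn].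
  (* Z is a version of the next iterate whose constants do not depend on n *)
  have [Z gZ sZ] := hH2 H (X n) Hge0 gXn'.
  have XZ u : square T u -> {ae P, forall w, X n.+1 u w = Z u w}.
    move=> su; have : {ae P, forall w, X n.+1 u w - Z u w = 0}.
      apply: msq0_ae; first exact: measurable_funB.
      move=> eps eps0.
      have := picard_contraction (lexx 0) (jX n) (jX n) (sX n) sZ _ su.
      rewrite !mul0r => h; apply: (@le_trans _ _ 0%:E); last by rewrite lee_fin ltW.
      apply: h => x _; rewrite (@eq_msq _ _ _ _ _ _ (fun=> 0)) ?msq_cst ?expr0n ?mul0r//.
      by move=> w _; rewrite subrr.
    by apply: filterS => w /eqP; rewrite subr_eq0 => /eqP.
  rewrite (@ae_eq_msq _ _ _ _ _ (fun w => Z z w - Z z' w)); first exact: (good_holder gZ sz sz').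
  - exact: measurable_funB.
  - exact: measurable_funB.
  - by apply: filterS2 (XZ z sz) (XZ z' sz') => w -> ->.
have [Y YE] : exists Y : R * R -> {RV P >-> R}, forall z, square T z -> Y z = fastlim (X^~ z) :> (Omega -> R).
  by apply: RV_family => z sz; exact: measurable_fastlim.
have lim z : square T z -> forall n,
    (msq P [set: Omega] (fun w => Y z w - X n z w)%R <= (4 * (c * (16 ^+ n)^-1))%:E)%E.
  by move=> sz n; rewrite YE//; exact: (fast_cauchy_lim measurableT (mX^~ z) (fc z sz) n).
have gY : good B T (2 * K2 + 2 * (4 * c)) (4 * H2) Y.
  split.
  - have : measurable_fun (square T `*` [set: Omega]) (fastlim (fun n (p : (R * R) * Omega) => X n p.1 p.2)).
      by apply: measurable_fastlim => n; exact: jX.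
    by apply: eq_measurable_fun => -[x w] /set_mem[/= sx _]; rewrite YE.
  - move=> z sz; rewrite YE//; apply/adapted_atP; apply: measurable_fastlim => n; apply/adapted_atP.
    by have [K [H [_ _ gXn]]] := gX n; exact: good_adapted gXn _ sz.
  - move=> z sz; have := lim z sz 0%N; rewrite expr0 invr1 mulr1 => h.
    rewrite (@eq_msq _ _ _ _ _ _ (fun w => X 0%N z w + (Y z w - X 0%N z w))); last first.
      by move=> w _; rewrite addrC subrK.
    apply: (le_trans (msqD P measurableT (mX 0%N z) (measurable_funB _ (mX 0%N z)))) => //.
    rewrite [leRHS]EFinD !EFinM leeD// lee_pmul2l ?lte_fin// -?EFinM//; exact: XK2.
  - move=> z z' sz sz'; apply/lee_addgt0Pr => eps eps0.
    have [n hn] := geometric_small (24 * c) eps0.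
    have nn : c * (16 ^+ n.+1)^-1 <= c * (16 ^+ n)^-1.
      by rewrite ler_wpM2l// lef_pV2 ?posrE ?exprn_gt0// ler_eXn2l//; lra.
    have h1 := lim z sz n.+1; have h2 := XH2 n z z' sz sz'; have h3 := lim z' sz' n.+1.
    rewrite msqBC in h3.
    have mY u : measurable_fun [set: Omega] (Y u) by [].
    have h4 := msq_triangle measurableT (mX _ z) (mX _ z') (mY z') h2 h3.
    apply: le_trans (msq_triangle measurableT (mY z) (mX _ z) (mY z') h1 h4) _.
    by rewrite -EFinD lee_fin; lra.
have K30 : 0 <= 2 * K2 + 2 * (4 * c) by lra.
have [K4 K40 hK4] := step _ K30.
have H30 : 0 <= 4 * H2 by rewrite mulr_ge0.
have [Z gZ sZ] := hK4 _ Y H30 gY.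
have YZ z : square T z -> {ae P, forall w, Y z w = Z z w}.
  move=> sz; have : {ae P, forall w, Y z w - Z z w = 0}.
    apply: msq0_ae; first exact: measurable_funB.
    move=> eps eps0.
    have [n hn] := geometric_small (16 * c * (1 + expR (exponent * T))) eps0.
    have a0 : 0 <= 4 * (c * (16 ^+ n)^-1).
      by rewrite mulr_ge0// mulr_ge0// invr_ge0 exprn_ge0.
    have YX x : square T x ->
        (msq P [set: Omega] (fun w => X n x w - Y x w)%R <= (4 * (c * (16 ^+ n)^-1) * e x)%:E)%E.
      move=> sx; rewrite msqBC; apply: le_trans (lim x sx n) _.
      by rewrite lee_fin ler_peMr// weight_ge1.
    have h := picard_contraction a0 (jX n) (good_jm gY) (sX n) sZ YX sz.
    apply: le_trans (msq_triangle measurableT _ (mX n.+1 z) _ (lim z sz n.+1) h) _ => //.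
    rewrite lee_fin; apply: le_trans hn; rewrite exprS invfM.
    have := weight_le sz; set E := expR (_ * T) => eE.
    have : 0 <= c * (16 ^+ n)^-1 by rewrite mulr_ge0// invr_ge0 exprn_ge0.
    set a := c * _ => ha; have -> : c * (16^-1 / 16 ^+ n) = a / 16 by rewrite /a; ring.
    have -> : 16 * c * (1 + E) / 16 ^+ n = 16 * a * (1 + E) by rewrite /a; ring.
    have := ler_wpM2l ha eE; have : 0 <= a * E by rewrite mulr_ge0// expR_ge0.
    lra.
  by apply: filterS => w /eqP; rewrite subr_eq0 => /eqP.
exists Y; split; [exact: good_jm gY|exact: good_adapted gY|].
move=> z sz; have [J iJ aJ] := sZ z sz; exists J => //.
by apply: filterS2 (YZ z sz) aJ => w -> /= [].
Qed.

End existence.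

(** * Uniqueness *)

(** The infimum of the probabilities of the measurable supersets of S is attained, by
    an intersection of supersets of nearly least probability. *)
Lemma measurable_hull d (Omega : measurableType d) (R : realType) (P : probability Omega R)
    (S : set Omega) : exists H, [/\ measurable H, S `<=` H &
  forall A, measurable A -> S `<=` A -> P (H `\` A) = 0%E].
Proof.
pose E := [set p : R | exists A, [/\ measurable A, S `<=` A & P A = p%:E]].
have PA A : measurable A -> P A = (fine (P A))%:E by move=> mA; rewrite fineK// fin_num_measure.
have E0 : E !=set0 by exists (fine (P setT)); exists setT; split => //; exact: PA.
have lbE : has_lbound E by exists 0 => p [A [mA _ PAp]]; rewrite -lee_fin -PAp.
have hE : has_inf E by split.
have approx n : exists A, [/\ measurable A, S `<=` A & (P A <= (inf E + n.+1%:R^-1)%:E)%E].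
  have n0 : 0 < n.+1%:R^-1 :> R by rewrite invr_gt0 ltr0n.
  have [p [A [mA SA PAp]] pE] := inf_adherent n0 hE.
  by exists A; split => //; rewrite PAp lee_fin ltW.
have /choice[A hA] := approx.
have mA n : measurable (A n) by have [] := hA n.
have mH : measurable (\bigcap_n A n) by exact: bigcapT_measurable.
exists (\bigcap_n A n); split => //; first by move=> w Sw n _; have [_ SA _] := hA n; exact: SA.
move=> A' mA' SA'; set H := \bigcap_n A n.
have HE : P H = (inf E)%:E.
  apply/eqP; rewrite eq_le; apply/andP; split.
    apply/lee_addgt0Pr => e e0.
    have [n ne] : exists n : nat, n.+1%:R^-1 <= e.
      exists (Num.truncn e^-1); rewrite -[leRHS]invrK lef_pV2 ?posrE ?invr_gt0 ?ltr0n//.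
      by rewrite ltW// truncnS_gt.
    have [_ _ hn] := hA n.
    apply: (@le_trans _ _ (P (A n))); first by apply: le_measure; rewrite ?inE//; apply: bigcap_inf.
    by apply: (le_trans hn); rewrite -EFinD lee_fin lerD2l.
  rewrite (PA _ mH) lee_fin; apply: ge_inf => //; exists H; split => //; last exact: PA.
  by move=> w Sw n _; have [_ SA _] := hA n; exact: SA.
have mHA : measurable (H `&` A') by exact: measurableI.
have HAE : ((inf E)%:E <= P (H `&` A'))%E.
  rewrite (PA _ mHA) lee_fin; apply: ge_inf => //; exists (H `&` A'); split => //; last exact: PA.
  by move=> w Sw; split; [move=> n _; have [_ SA _] := hA n; exact: SA|exact: SA'].
have : P H = (P (H `\` A') + P (H `&` A'))%E by exact: (measureDI P mH mA').
rewrite HE (PA _ mHA) (PA _ (measurableD mH mA')).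
move: HAE; rewrite (PA _ mHA) lee_fin -EFinD => h1 [h2]; congr EFin.
apply/eqP; rewrite eq_le fine_ge0// andbT; move: h1 h2; lra.
Qed.

Section uniqueness.
Context d (Omega : measurableType d) (R : realType) (P : probability Omega R).
Variable B : R * R -> Omega -> R.
Hypotheses (P_complete : measure_is_complete P) (B_sheet : brownian_sheet P B).
Variable T : R.
Hypothesis T_gt0 : 0 < T.
Context (M : completeNormedModType R) (iota : completionM P M).
Variables (kl kn : R).
Hypotheses (kl0 : 0 <= kl) (kn0 : 0 <= kn).
Hypothesis law_lip : forall (X X' : {RV P >-> R}) (h : R),
  (msq P [set: Omega] (fun w => X w - X' w)%R <= h%:E)%E ->
  `|iota (law X) - iota (law X')| ^+ 2 <= kl * h.
Hypothesis law_bd : forall X : {RV P >-> R}, `|iota (law X)| <= kn.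
Variables (alpha beta : R * R -> R -> M -> R) (C K0 y : R).
Hypotheses (ra : regular_coef T alpha C K0) (rb : regular_coef T beta C K0).
Local Notation solves := (solves B T iota alpha beta y).
Variables (Y Y' : R * R -> {RV P >-> R}).
Hypotheses (sY : strong_solution iota B T alpha beta y Y).
Hypotheses (sY' : strong_solution iota B T alpha beta y Y').
Implicit Types (x z : R * R) (Om : set Omega).

Let C0 : 0 <= C := regular_C ra.
Let T20 : 0 < T ^+ 2. Proof. exact: exprn_gt0. Qed.
Let squareTT : square T (T, T). Proof. by apply/squareP; rewrite /= lexx ltW. Qed.
Let solY : solves Y Y := solution_equation sY.
Let solY' : solves Y' Y' := solution_equation sY'.
Let jY : jointly_measurable (square T) Y := solution_measurable sY.
Let jY' : jointly_measurable (square T) Y' := solution_measurable sY'.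

Let D x w : R := `|Y x w - Y' x w|.

Let jD : jointly_measurable (square T) D.
Proof. by apply: measurableT_comp => //; exact: measurable_funB. Qed.

Let mD x : measurable_fun [set: Omega] (D x).
Proof. by apply: measurableT_comp => //; exact: measurable_funB. Qed.

(** The stochastic integrands are square integrable by definition of the integral,
    so the martingale parts of two solutions are uniformly close in mean square. *)
Let martingale_bound : exists2 g : R, 0 <= g & forall z J J', square T z ->
  is_ito_integral P B z (fun x w => beta x (Y x w) (iota (law (Y x)))) J ->
  is_ito_integral P B z (fun x w => beta x (Y' x w) (iota (law (Y' x)))) J' ->
  (msq P [set: Omega] (fun w => J w - J' w)%R <= g%:E)%E.
Proof.
set b := fun x w => beta x (Y x w) _; set b' := fun x w => beta x (Y' x w) _.
have [J1 [[mb _ nb] _ _] _] := solY squareTT; have [J1' [[mb' _ nb'] _ _] _] := solY' squareTT.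
have nbb : (normsq_Rz P (T, T) (fun x w => b x w - b' x w)%R < +oo)%E.
  have j0 : jointly_measurable (square T) (fun (_ : R * R) (_ : Omega) => 0 : R) by exact: measurable_cst.
  have fin phi : (normsq_Rz P (T, T) phi < +oo)%E -> normsq_Rz P (T, T) phi \is a fin_num.
    by move=> h; rewrite ge0_fin_numE// normsq_ge0.
  have h : (normsq_Rz P (T, T) (fun x w => b x w - 0)%R <= (fine (normsq_Rz P (T, T) b))%:E)%E.
    by rewrite (fineK (fin _ nb)); apply: normsq_le => x w _; rewrite subr0.
  have h' : (normsq_Rz P (T, T) (fun x w => 0 - b' x w)%R <= (fine (normsq_Rz P (T, T) b'))%:E)%E.
    by rewrite (fineK (fin _ nb')); apply: normsq_le => x w _; rewrite sub0r normrN.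
  exact: le_lt_trans (normsq_triangle mb j0 mb' h h') (ltry _).
set G := normsq_Rz _ _ _ in nbb.
have Gf : G \is a fin_num by rewrite ge0_fin_numE// normsq_ge0.
exists (16 * fine G); first by rewrite mulr_ge0// fine_ge0// normsq_ge0.
move=> z J J' sz iJ iJ'; have qz := square_quadrant sz.
apply: (ito_gap P_complete B_sheet qz qz iJ iJ').
have [[mz _ _] _ _] := iJ; have [[mz' _ _] _ _] := iJ'.
rewrite (gap_normsq P mz mz') (fineK Gf); have /squareP[/andP[_ ?] /andP[_ ?]] := sz.
exact: (normsq_mono P (jmB mb mb')).
Qed.

Section with_bound.
Variables (g : R).
Hypothesis g0 : 0 <= g.
Hypothesis martingale_le : forall z J J', square T z ->
  is_ito_integral P B z (fun x w => beta x (Y x w) (iota (law (Y x)))) J ->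
  is_ito_integral P B z (fun x w => beta x (Y' x w) (iota (law (Y' x)))) J' ->
  (msq P [set: Omega] (fun w => J w - J' w)%R <= g%:E)%E.

Let majorant Om x w : R := C * (D x w + 2 * kn) * \1_Om w.

Let jm_majorant Om : measurable Om -> jointly_measurable (square T) (majorant Om).
Proof.
move=> mO; apply: measurable_funM.
  by apply: measurable_funM => //; apply: measurable_funD.
by apply: measurable_funTS; apply: (@measurableT_comp _ _ _ _ _ _ (\1_Om : Omega -> R)).
Qed.

(** On the event Om the difference of the drifts is bounded through D and the
    bound kn on the norm of a law, which is deterministic. *)
Lemma truncated_difference Om z : measurable Om -> square T z ->
  (msq P [set: Omega] (fun w => D z w * \1_Om w)%R <=
   (2 * T ^+ 2)%:E * normsq_Rz P z (majorant Om) + (2 * g)%:E)%E.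
Proof.
move=> mO sz; have mz := measurable_Rz z.
have [J [J' [iJ iJ' aZ]]] := solves_difference T_gt0 ra solY solY' sz.
have gJ := martingale_le sz iJ iJ'.
have mJJ : measurable_fun [set: Omega] (fun w => J w - J' w).
  by case: iJ => _ ? _; case: iJ' => _ ? _; exact: measurable_funB.
have mI : measurable_fun [set: Omega] (\1_Om : Omega -> R) by exact: measurable_indic.
have mZ : measurable_fun [set: Omega] (fun w => (Y z w - Y' z w - (J w - J' w)) * \1_Om w).
  by apply: measurable_funM => //; apply: measurable_funB => //; exact: measurable_funB.
have mm : jointly_measurable (Rz z) (majorant Om).
  by apply: jmS (jm_majorant mO); [exact: measurable_Rz|exact: Rz_square].
have mmw : measurable_fun [set: Omega] (fun w => msq leb2 (Rz z) (majorant Om ^~ w)).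
  apply: (@measurable_inner1 _ _ _ (Rz z) (fun x w => ((majorant Om x w) ^+ 2)%:E)) => //.
    by move=> x w _; rewrite lee_fin sqr_ge0.
  exact: measurable_sqr.
have mJO : measurable_fun [set: Omega] (fun w => (J w - J' w) * \1_Om w) by exact: measurable_funM.
apply: (@le_trans _ _ (msq P [set: Omega] (fun w =>
    (Y z w - Y' z w - (J w - J' w)) * \1_Om w + (J w - J' w) * \1_Om w)%R)).
  by apply: msq_le => w _; rewrite -mulrDl subrK !normrM normr_id.
apply: (le_trans (msqD P measurableT mZ mJO)).
apply: leeD; last first.
  rewrite EFinM; apply: lee_wpmul2l => //; apply: le_trans gJ.
  by apply: msq_le => w _; rewrite normrM ler_piMr// indicE; case: (_ \in _); rewrite ?normr1 ?normr0.
rewrite EFinM -muleA; apply: lee_wpmul2l => //.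
rewrite /normsq_Rz -ge0_integralZl_EFin//; last 2 first.
- by move=> w _; exact: msq_ge0.
- exact: ltW.
apply: ae_ge0_le_integral => //.
- by move=> w _; rewrite lee_fin sqr_ge0.
- exact: measurable_sqr.
- by move=> w _; apply: mule_ge0; [rewrite lee_fin ltW|exact: msq_ge0].
- by apply: emeasurable_funM => //; exact: measurable_cst.
apply: filterS aZ => w h _; rewrite indicE; case: (boolP (w \in Om)) => wO; last first.
  rewrite mulr0 expr0n; apply: mule_ge0; [by rewrite lee_fin ltW|exact: msq_ge0].
rewrite mulr1; apply: (le_trans h); apply: lee_wpmul2l; first by rewrite lee_fin ltW.
apply: msq_le => x zx; rewrite /majorant indicE wO mulr1 !normrM ler_wpM2l//.
rewrite [leLHS]ger0_norm; last by rewrite addr_ge0.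
rewrite [leRHS]ger0_norm; last by apply: addr_ge0; [exact: normr_ge0|exact: mulr_ge0].
rewrite /D lerD2l; apply: (le_trans (ler_normB _ _)).
by have := law_bd (Y x); have := law_bd (Y' x); lra.
Qed.

(** The total variation of both drifts; nothing says that it is measurable in w. *)
Let V w : \bar R :=
  (\int[leb2]_(x in square T) `|alpha x (Y x w) (iota (law (Y x)))|%:E +
   \int[leb2]_(x in square T) `|alpha x (Y' x w) (iota (law (Y' x)))|%:E)%E.

Let V_finite : {ae P, forall w, (V w < +oo)%E}.
Proof.
have [J _ aJ] := solY squareTT; have [J' _ aJ'] := solY' squareTT.
apply: filterS2 aJ aJ' => w [/integrableP[_ h] _] [/integrableP[_ h'] _].
exact: lte_add_pinfty.
Qed.

Let drift_le z : square T z -> exists J J' : Omega -> R,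
  [/\ is_ito_integral P B z (fun x w => beta x (Y x w) (iota (law (Y x)))) J,
      is_ito_integral P B z (fun x w => beta x (Y' x w) (iota (law (Y' x)))) J' &
      {ae P, forall w, ((D z w)%:E <= V w + `|J w - J' w|%:E)%E}].
Proof.
move=> sz; have [J iJ aJ] := solY sz; have [J' iJ' aJ'] := solY' sz.
exists J, J'; split => //; apply: filterS2 aJ aJ' => w [i1 h1] [i2 h2].
have mz := measurable_Rz z.
have le (f : R * R -> R) : leb2.-integrable (Rz z) (EFin \o f) ->
    (`|\int[leb2]_(x in Rz z) f x|%:E <= \int[leb2]_(x in square T) `|f x|%:E)%E.
  move=> fi; apply: (@le_trans _ _ (\int[leb2]_(x in Rz z) `|f x|%:E)%E).
    have fin : (\int[leb2]_(x in Rz z) `|f x|%:E)%E \is a fin_num.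
      have /integrableP[_ h] := fi; rewrite ge0_fin_numE//; apply: integral_ge0 => x _; rewrite lee_fin//.
    by rewrite -(fineK fin) lee_fin; exact: le_normr_Rintegral.
  rewrite integral_mkcond [leRHS]integral_mkcond; apply: ge0_le_integralW => x _; rewrite !patchE.
    by case: ifPn => // _; rewrite lee_fin.
  case: ifPn => [/set_mem zx|_]; first by rewrite mem_set//; exact: (Rz_square sz).
  by case: ifPn => // _; rewrite lee_fin.
rewrite /D h1 h2; set a := fun x => alpha x (Y x w) _ in i1 *; set a' := fun x => alpha x (Y' x w) _ in i2 *.
set A := \int[leb2]_(x in _) _; set A' := \int[leb2]_(x in _) _.
have -> : y + A + J w - (y + A' + J' w) = (A - A') + (J w - J' w) by ring.
apply: (@le_trans _ _ (`|A|%:E + `|A'|%:E + `|J w - J' w|%:E)%E).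
  by rewrite -!EFinD lee_fin (le_trans (ler_normD _ _))// lerD2r ler_normB.
by apply: leeD => //; apply: leeD; exact: le.
Qed.

(** Bounding by V on a measurable hull of {V <= n} gives a first, rough integrability
    of the square of the difference. *)
Let rough_integrability : {ae P, forall w, (msq leb2 (square T) (D ^~ w) < +oo)%E}.
Proof.
have mT := measurable_Rz (T, T).
have hull n := measurable_hull P [set w | (V w <= n%:R%:E)%E].
have /choice[H hH] := hull.
have mH n : measurable (H n) by have [] := hH n.
have on_hull n z : square T z ->
    (msq P [set: Omega] (fun w => D z w * \1_(H n) w)%R <= (2 * n%:R ^+ 2 + 2 * g)%:E)%E.
  move=> sz; have [J [J' [iJ iJ' aD]]] := drift_le sz.
  have gJ := martingale_le sz iJ iJ'.
  have mJJ : measurable_fun [set: Omega] (fun w => J w - J' w).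
    by case: iJ => _ ? _; case: iJ' => _ ? _; exact: measurable_funB.
  have mN : measurable_fun [set: Omega] (fun w => `|J w - J' w|) by exact: measurableT_comp.
  have ae_le : {ae P, forall w, H n w -> D z w <= n%:R + `|J w - J' w|}.
    pose bad := [set w | ~ ((D z w)%:E <= V w + `|J w - J' w|%:E)%E].
    have nbad : P.-negligible bad by exact: aD.
    (* on {V <= n} the bound holds off the null event bad, so A is a measurable superset *)
    pose A := [set w | D z w <= n%:R + `|J w - J' w|] `|` bad.
    have mA : measurable A.
      apply: measurableU; last exact: (negligible_measurable P_complete nbad).
      have mR : measurable_fun [set: Omega] (fun w => n%:R + `|J w - J' w|) by exact: measurable_funD.
      have mtrue : measurable ([set true] : set bool) by [].
      by have := measurable_fun_ler (mD z) mR measurableT mtrue; rewrite setTI.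
    have [_ _ hA] := hH n.
    have SA : [set w | (V w <= n%:R%:E)%E] `<=` A.
      move=> w /= Vn; have [h|] := pselect ((D z w)%:E <= V w + `|J w - J' w|%:E)%E; last by right.
      by left; rewrite /= -lee_fin EFinD; apply: (le_trans h); exact: leeD.
    have nHA : P.-negligible (H n `\` A).
      by exists (H n `\` A); split => //; [exact: measurableD|exact: hA].
    have : {ae P, forall w, ~ (H n `\` A) w}.
      by move: nHA; apply: negligibleS => w /=/contrapT.
    apply: filterS2 aD => w h1 h2 Hw; apply: contrapT => h3; apply: h2; split => //.
    by move=> [/h3|/(_ h1)].
  apply: (@le_trans _ _ (msq P [set: Omega] (fun w => n%:R + `|J w - J' w|))).
    apply: ae_ge0_le_integral => //.
    - by move=> w _; rewrite lee_fin sqr_ge0.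
    - by apply: measurable_sqr; apply: measurable_funM => //; exact: measurable_indic.
    - by apply: measurable_sqr; exact: measurable_funD.
    apply: filterS ae_le => w h _; rewrite lee_fin indicE.
    case: (boolP (w \in H n)) => [/set_mem/h {}h|_]; last by rewrite mulr0 expr0n sqr_ge0.
    by rewrite mulr1 ler_pXn2r// nnegrE ?addr_ge0// normr_ge0.
  apply: (le_trans (msqD P measurableT (measurable_cst _) mN)).
  rewrite msq_cst [leRHS]EFinD !EFinM leeD2l// lee_pmul2l ?lte_fin//.
  by apply: le_trans gJ; apply: msq_le => w _; rewrite normr_id.
have fin n : {ae P, forall w, H n w -> (msq leb2 (square T) (D ^~ w) < +oo)%E}.
  pose F x w := D x w * \1_(H n) w.
  have jF : jointly_measurable (square T) F.
    apply: measurable_funM => //; apply: measurable_funTS.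
    by apply: (@measurableT_comp _ _ _ _ _ _ (\1_(H n) : Omega -> R)) => //; exact: measurable_indic.
  have nF : (normsq_Rz P (T, T) F < +oo)%E.
    apply: le_lt_trans (ltry (T ^+ 2 * (2 * n%:R ^+ 2 + 2 * g))).
    apply: (normsq_uniform squareTT jF).
      by apply: addr_ge0; apply: mulr_ge0 => //; exact: sqr_ge0.
    move=> x [/andP[/ltW x10 x1T] /andP[/ltW x20 x2T]].
    by apply: on_hull; apply/squareP; rewrite x10 x20.
  apply: filterS (normsq_ae jF nF) => w h Hw.
  rewrite (@eq_msq _ _ _ _ _ _ (F ^~ w))// => x _; by rewrite /F indicE mem_set// mulr1.
have : {ae P, forall w, forall n, H n w -> (msq leb2 (square T) (D ^~ w) < +oo)%E}.
  exact/ae_foralln.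
apply: filterS2 V_finite => w Vw h.
have V0 : (0 <= V w)%E by apply: adde_ge0; apply: integral_ge0 => x _; rewrite lee_fin.
have Vf : V w \is a fin_num by rewrite ge0_fin_numE.
apply: (h (Num.truncn (fine (V w))).+1); have [_ sub _] := hH (Num.truncn (fine (V w))).+1.
apply: sub; apply: (@le_trans _ _ (fine (V w))%:E); first by rewrite fineK.
by rewrite lee_fin ltW// truncnS_gt.
Qed.

Let lam : R := 8 * T ^+ 3 * C ^+ 2 + 1.

Let lam0 : 0 < lam.
Proof. by apply: ltr_wpDl => //; apply: mulr_ge0; [apply: mulr_ge0 => //; exact/exprn_ge0/ltW|exact: sqr_ge0]. Qed.

Local Notation e z := (expR (lam * z.1)).

Let defect : R := 16 * T ^+ 4 * C ^+ 2 * kn ^+ 2 + 2 * g.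

Let defect0 : 0 <= defect.
Proof.
apply: addr_ge0; last exact: mulr_ge0.
by apply: mulr_ge0; [apply: mulr_ge0; [apply: mulr_ge0 => //; exact/exprn_ge0/ltW|]|]; exact: sqr_ge0.
Qed.

(** The exponent lam is such that integrating the weight halves q; the defect
    collects the terms that do not depend on D. *)
Let gronwall_step Om (q : R) : measurable Om -> 0 <= q ->
  (forall x, square T x -> (msq P [set: Omega] (fun w => D x w * \1_Om w)%R <= (q * e x)%:E)%E) ->
  forall z, square T z ->
    (msq P [set: Omega] (fun w => D z w * \1_Om w)%R <= ((q / 2 + defect) * e z)%:E)%E.
Proof.
move=> mO q0 hq z sz; have mz := measurable_Rz z.
have mI : measurable_fun [set: Omega] (\1_Om : Omega -> R) by exact: measurable_indic.
have me : measurable_fun [set: R * R] (fun x => e x).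
  by apply: measurableT_comp => //; apply: measurable_funM => //; exact: measurable_fst.
have e1 : 1 <= e z.
  have /squareP[/andP[z0 _] _] := sz.
  by rewrite -expR0 ler_expR mulr_ge0// ltW.
have mm : jointly_measurable (Rz z) (majorant Om).
  by apply: jmS (jm_majorant mO); [exact: measurable_Rz|exact: Rz_square].
have slice x : square T x -> (msq P [set: Omega] (majorant Om x) <=
    (2 * C ^+ 2 * q)%:E * (e x)%:E + (8 * C ^+ 2 * kn ^+ 2)%:E)%E.
  move=> sx; pose F w := D x w * \1_Om w; pose G w := 2 * kn * \1_Om w.
  have mF : measurable_fun [set: Omega] F by exact: measurable_funM.
  have mG : measurable_fun [set: Omega] G by exact: measurable_funM.
  rewrite (@eq_msq _ _ _ _ _ _ (fun w => C * (F w + G w))); last first.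
    by move=> w _; rewrite /majorant /F /G; ring.
  rewrite msqZ//; last exact: measurable_funD.
  apply: (@le_trans _ _ ((C ^+ 2)%:E * (2 * (q * e x) + 2 * (2 * kn) ^+ 2)%:E)%E).
    apply: lee_wpmul2l; first by rewrite lee_fin sqr_ge0.
    apply: (le_trans (msqD P measurableT mF mG)); rewrite [leRHS]EFinD.
    apply: leeD; rewrite [leRHS]EFinM; apply: lee_wpmul2l => //; first exact: hq.
    rewrite -(msq_cst P); apply: msq_le => w _; rewrite /G normrM ler_piMr// indicE.
    by case: (_ \in _); rewrite ?normr1 ?normr0.
  by rewrite -!EFinM -EFinD lee_fin le_eqVlt; apply/orP; left; apply/eqP; ring.
have C20 : 0 <= 2 * C ^+ 2 * q.
  by apply: mulr_ge0 => //; apply: mulr_ge0 => //; exact: sqr_ge0.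
have K20 : 0 <= 8 * C ^+ 2 * kn ^+ 2.
  by apply: mulr_ge0; [apply: mulr_ge0 => //|]; exact: sqr_ge0.
have e0 x : (0 <= (e x)%:E)%E by rewrite lee_fin expR_ge0.
have mee : measurable_fun (Rz z) (fun x => (e x)%:E) by apply: measurable_funTS; exact/measurable_EFinP.
have nb : (normsq_Rz P z (majorant Om) <=
    (2 * C ^+ 2 * q * (T / lam * e z) + 8 * C ^+ 2 * kn ^+ 2 * T ^+ 2)%:E)%E.
  rewrite normsq_swap//.
  apply: (@le_trans _ _ (\int[leb2]_(x in Rz z)
      ((2 * C ^+ 2 * q)%:E * (e x)%:E + (8 * C ^+ 2 * kn ^+ 2)%:E))%E).
    apply: ge0_le_integralW => x zx; first exact: msq_ge0.
    exact: slice (Rz_square sz zx).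
  rewrite ge0_integralD//; last 2 first.
  - by move=> x _; apply: mule_ge0 => //; rewrite lee_fin.
  - by apply: emeasurable_funM => //; exact: measurable_cst.
  rewrite ge0_integralZl_EFin// integral_cst// [leRHS]EFinD; apply: leeD; rewrite [leRHS]EFinM.
    by apply: lee_wpmul2l; [rewrite lee_fin|exact: exp_weight_integral].
  by apply: lee_wpmul2l; [rewrite lee_fin|exact: leb2_Rz_square].
apply: (le_trans (truncated_difference mO sz)).
apply: (@le_trans _ _ ((2 * T ^+ 2)%:E *
    (2 * C ^+ 2 * q * (T / lam * e z) + 8 * C ^+ 2 * kn ^+ 2 * T ^+ 2)%:E + (2 * g)%:E)%E).
  by apply: leeD => //; apply: lee_wpmul2l => //; rewrite lee_fin mulr_ge0// ltW.
rewrite -EFinM -EFinD lee_fin.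
have half : 4 * T ^+ 3 * C ^+ 2 / lam <= 2^-1.
  by rewrite ler_pdivrMr// /lam; lra.
have -> : 2 * T ^+ 2 * (2 * C ^+ 2 * q * (T / lam * e z) + 8 * C ^+ 2 * kn ^+ 2 * T ^+ 2) + 2 * g =
    q * e z * (4 * T ^+ 3 * C ^+ 2 / lam) + defect by rewrite /defect; ring.
have qe : 0 <= q * e z by rewrite mulr_ge0// expR_ge0.
by have := ler_wpM2l qe half; have := ler_peMr defect0 e1; lra.
Qed.

(** Under iteration the initial bound q, which may depend on Om, is forgotten. *)
Let gronwall Om (q : R) : measurable Om -> 0 <= q ->
  (forall x, square T x -> (msq P [set: Omega] (fun w => D x w * \1_Om w)%R <= (q * e x)%:E)%E) ->
  forall z, square T z ->
    (msq P [set: Omega] (fun w => D z w * \1_Om w)%R <= ((2 * defect + 1) * e z)%:E)%E.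
Proof.
move=> mO q0 hq.
have iter k : forall z, square T z -> (msq P [set: Omega] (fun w => D z w * \1_Om w)%R <=
    ((2 * defect + q / 2 ^+ k) * e z)%:E)%E.
  elim: k => [|k ih] z sz.
    apply: le_trans (hq z sz) _; rewrite lee_fin ler_wpM2r ?expR_ge0// expr0 divr1.
    by rewrite lerDr mulr_ge0.
  have q'0 : 0 <= 2 * defect + q / 2 ^+ k.
    by apply: addr_ge0; [exact: mulr_ge0|apply: divr_ge0 => //; exact: exprn_ge0].
  apply: le_trans (gronwall_step mO q'0 ih sz) _; rewrite lee_fin ler_wpM2r ?expR_ge0//.
  by rewrite exprS invfM; lra.
move=> z sz; pose k := Num.truncn q; apply: le_trans (iter k.+1 z sz) _.
rewrite lee_fin ler_wpM2r ?expR_ge0// lerD2l ler_pdivrMr ?exprn_gt0// mul1r ltW//.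
apply: lt_le_trans (truncnS_gt _) _; rewrite -natrX ler_nat.
by apply: ltnW; exact: ltn_expl.
Qed.

(** On the event that the integral of D^2 is at most n, the truncated squares
    have a finite bound depending on n, hence the bound of the previous lemma,
    uniform in n; these events exhaust the sample space. *)
Lemma square_bound : exists2 q : R, 0 <= q & forall z, square T z ->
  (msq P [set: Omega] (fun w => Y z w - Y' z w)%R <= q%:E)%E.
Proof.
pose W w := msq leb2 (square T) (D ^~ w).
have W0 w : (0 <= W w)%E by exact: msq_ge0.
have mW : measurable_fun [set: Omega] W.
  apply: (@measurable_inner1 _ _ _ (square T) (fun x w => ((D x w) ^+ 2)%:E)).
  - exact: measurable_Rz.
  - by move=> x w _; rewrite lee_fin sqr_ge0.
  - exact: measurable_sqr.
pose Om n := [set w | (W w <= n%:R%:E)%E].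
have mOm n : measurable (Om n).
  by rewrite -[Om n]setTI; exact: emeasurable_fun_infty_c.
have nd n m : (n <= m)%N -> Om n `<=` Om m.
  by move=> nm w /= h; apply: (le_trans h); rewrite lee_fin ler_nat.
have trunc n z : square T z ->
    (msq P [set: Omega] (fun w => D z w * \1_(Om n) w)%R <= ((2 * defect + 1) * e z)%:E)%E.
  move=> sz; pose r := 2 * C ^+ 2 * (n%:R + 4 * kn ^+ 2 * T ^+ 2).
  have C20 := sqr_ge0 C; have k20 := sqr_ge0 kn.
  have n0 : 0 <= n%:R :> R by [].
  have s0 : 0 <= n%:R + 4 * kn ^+ 2 * T ^+ 2.
    by apply: addr_ge0 => //; apply: mulr_ge0; [exact: mulr_ge0|exact: ltW].
  have r0 : 0 <= r by apply: mulr_ge0 => //; exact: mulr_ge0.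
  apply: (@gronwall (Om n) (2 * T ^+ 2 * r + 2 * g)) => //.
    by apply: addr_ge0; apply: mulr_ge0 => //; apply: mulr_ge0 => //; exact: ltW.
  move=> x sx; apply: (le_trans (truncated_difference (mOm n) sx)).
  apply: (@le_trans _ _ (2 * T ^+ 2 * r + 2 * g)%:E); last first.
    have /squareP[/andP[x0 _] _] := sx.
    rewrite lee_fin ler_peMr//; last by rewrite -expR0 ler_expR mulr_ge0// ltW.
    by apply: addr_ge0; apply: mulr_ge0 => //; apply: mulr_ge0 => //; exact: ltW.
  rewrite [leRHS]EFinD; apply: leeD => //; rewrite [leRHS]EFinM; apply: lee_wpmul2l.
    by rewrite lee_fin mulr_ge0// ltW.
  have mx := measurable_Rz x.
  apply: (@le_trans _ _ (\int[P]_w cst r%:E w)%E); last first.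
    rewrite [leLHS](_ : _ = r%:E * P setT)%E; last exact: integral_cst.
    by rewrite probability_setT mule1.
  apply: ge0_le_integralW => w _; first exact: msq_ge0.
  rewrite /= /majorant indicE; case: (boolP (w \in Om n)) => [/set_mem wO|_]; last first.
    under eq_integral do rewrite mulr0 expr0n/=.
    by rewrite integral0 lee_fin.
  under eq_integral do rewrite mulr1.
  have mDw : measurable_fun (Rz x) (D ^~ w).
    apply: measurable_funS (jm_section w (measurable_Rz (T, T)) jD) => //.
      exact: measurable_Rz.
    exact: Rz_square.
  have mD2 : measurable_fun (Rz x) (fun u => D u w + 2 * kn) by exact: measurable_funD.
  rewrite (_ : (\int[leb2]_(u in Rz x) _)%E = msq leb2 (Rz x) (fun u => C * (D u w + 2 * kn)))//.
  have -> : r = C ^+ 2 * (2 * n%:R + 2 * (4 * kn ^+ 2 * T ^+ 2)) by rewrite /r; ring.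
  rewrite msqZ// [leRHS]EFinM; apply: lee_wpmul2l; first by rewrite lee_fin.
  apply: (le_trans (msqD leb2 mx mDw (measurable_cst _))).
  rewrite [leRHS]EFinD; apply: leeD; rewrite [leRHS]EFinM; apply: lee_wpmul2l => //.
    apply: le_trans wO; apply: msq_subset => //; [exact: measurable_Rz| |exact: Rz_square].
    exact: (jm_section w (measurable_Rz (T, T)) jD).
  have -> : msq leb2 (Rz x) (cst (2 * kn)) = ((4 * kn ^+ 2)%:E * leb2 (Rz x))%E.
    have -> : 4 * kn ^+ 2 = (2 * kn) ^+ 2 by ring.
    exact: (integral_cst leb2 mx ((2 * kn) ^+ 2)%:E).
  by rewrite [leRHS]EFinM; apply: lee_wpmul2l; [rewrite lee_fin mulr_ge0|exact: leb2_Rz_square].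
exists ((2 * defect + 1) * expR (lam * T)).
  by apply: mulr_ge0; [apply: addr_ge0 => //; exact: mulr_ge0|exact: expR_ge0].
move=> z sz; apply: (@le_trans _ _ ((2 * defect + 1) * e z)%:E); last first.
  have /squareP[/andP[_ z1] _] := sz.
  rewrite lee_fin ler_wpM2l//; first by apply: addr_ge0 => //; exact: mulr_ge0.
  by rewrite ler_expR ler_wpM2l// ltW.
pose f n w := ((D z w * \1_(Om n) w) ^+ 2)%:E.
pose Oc := \bigcup_n Om n.
have mOc : measurable Oc by exact: bigcupT_measurable.
have mf n : measurable_fun [set: Omega] (f n).
  by apply: measurable_sqr; apply: measurable_funM => //; exact: measurable_indic.
have f0 n w : [set: Omega] w -> (0 <= f n w)%E by rewrite lee_fin sqr_ge0.
have ndf w : [set: Omega] w -> {homo f ^~ w : n m / (n <= m)%N >-> (n <= m)%E}.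
  move=> _ n m nm; rewrite lee_fin !exprMn ler_wpM2l ?sqr_ge0// !indicE.
  case: (boolP (w \in Om n)) => [/set_mem/(nd _ _ nm)/mem_set -> //|_].
  by rewrite expr0n sqr_ge0.
have limf w : limn (f ^~ w) = ((D z w * \1_Oc w) ^+ 2)%:E.
  apply: cvg_lim => //; apply: cvg_near_cst.
  have [[n _ On]|nO] := pselect (Oc w).
    exists n => // m /= nm; have Oc_w : Oc w by exists n.
    by rewrite /f !indicE (mem_set (nd _ _ nm _ On)) (mem_set Oc_w).
  apply: nearW => m; rewrite /f !indicE (memNset nO) memNset// => Omw.
  by apply: nO; exists m.
have OcT : {ae P, forall w, Y z w - Y' z w = (Y z w - Y' z w) * \1_Oc w}.
  apply: filterS rough_integrability => w Ww.
  have Wf : W w \is a fin_num by rewrite ge0_fin_numE.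
  rewrite indicE mem_set ?mulr1//; exists (Num.truncn (fine (W w))).+1 => //.
  apply: (@le_trans _ _ (fine (W w))%:E); first by rewrite fineK.
  by rewrite lee_fin ltW// truncnS_gt.
have mI : measurable_fun [set: Omega] (\1_Oc : Omega -> R) by exact: measurable_indic.
have mYY : measurable_fun [set: Omega] (fun w => Y z w - Y' z w) by exact: measurable_funB.
rewrite (ae_eq_msq mYY (measurable_funM mYY mI) OcT).
apply: (@le_trans _ _ (\int[P]_w limn (f ^~ w))%E).
  apply: ge0_le_integralW => w _; first by rewrite lee_fin sqr_ge0.
  by rewrite limf lee_fin !exprMn /D -normrX [`|_ ^+ 2|]ger0_norm ?sqr_ge0.
rewrite (monotone_convergence P measurableT mf f0 ndf).
apply: lime_le; last by apply: nearW => n; exact: trunc.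
apply: ereal_nondecreasing_is_cvgn => n m nm; apply: ge0_le_integralW => w _; first exact: f0.
exact: ndf.
Qed.

End with_bound.

(** A bounded mean square distance of the two solutions is contracted by 1/16
    arbitrarily often. *)
Lemma uniqueness z : square T z -> {ae P, forall w, Y z w = Y' z w}.
Proof.
move=> sz; have [g g0 hg] := martingale_bound; have [q q0 hq] := square_bound g0 hg.
pose e x : R := expR (exponent T kl C * x.1).
have iter k : forall x, square T x ->
    (msq P [set: Omega] (fun w => Y x w - Y' x w)%R <= (q * (16 ^+ k)^-1 * e x)%:E)%E.
  elim: k => [|k ih] x sx.
    apply: le_trans (hq x sx) _; rewrite expr0 invr1 mulr1 lee_fin ler_peMr//.
    exact: (weight_ge1 T_gt0 kl0 C sx).
  have q'0 : 0 <= q * (16 ^+ k)^-1 by rewrite mulr_ge0// invr_ge0 exprn_ge0.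
  apply: le_trans (picard_contraction P_complete B_sheet T_gt0 kl0 law_lip ra rb q'0
    jY jY' solY solY' ih sx) _.
  by rewrite lee_fin ler_wpM2r ?expR_ge0// exprS invfM; lra.
have : {ae P, forall w, Y z w - Y' z w = 0}.
  apply: msq0_ae; first exact: measurable_funB.
  move=> eps eps0; have [n hn] := geometric_small (q * e z) eps0.
  by apply: le_trans (iter n z sz) _; rewrite lee_fin mulrAC.
by apply: filterS => w /eqP; rewrite subr_eq0 => /eqP.
Qed.

End uniqueness.

Unset Implicit Arguments.

Theorem theorem4p3 (R : realType) (d : measure_display)
  (Omega : measurableType d) (P : probability Omega R)
  (P_complete : measure_is_complete P)
  (B : R * R -> Omega -> R) (B_sheet : brownian_sheet P B)
  (M : completeNormedModType R) (iota : completionM P M)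
  (T : R) (T_gt0 : 0 < T) (y : R) (alpha beta : R * R -> R -> M -> R)
  (alpha_bounded : locally_bounded T alpha)
  (alpha_borel : borel_coef T alpha)
  (beta_bounded : locally_bounded T beta)
  (beta_borel : borel_coef T beta)
  (lipschitz : exists C : R, forall z, square T z ->
     forall (y1 y2 : R) (mu mu' : M),
       `|alpha z y1 mu - alpha z y2 mu'| + `|beta z y1 mu - beta z y2 mu'|
       <= C * (`|y1 - y2| + `|mu - mu'|))
  (integrable0 : forall z, square T z ->
     (\int[P]_w \int[leb2]_(x in Rz z)
        (`|alpha x 0 (iota rm_dirac0)| ^+ 2 + `|beta x 0 (iota rm_dirac0)| ^+ 2)%:E
      < +oo)%E) :
  (exists Y, strong_solution iota B T alpha beta y Y) /\
  (forall Y Y', strong_solution iota B T alpha beta y Y ->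
     strong_solution iota B T alpha beta y Y' ->
     forall z, square T z -> {ae P, forall w, Y z w = Y' z w}).
Proof.
have [kn kn0 law_bd] := law_norm_bounded iota.
have [kl kl0 law_lip] := law_lipschitz iota.
have [C lip] := lipschitz.
have [Ka Ka0 ha] := locally_bounded_base alpha_bounded.
have [Kb Kb0 hb] := locally_bounded_base beta_bounded.
have CC (z : R * R) (y1 y2 : R) (m m' : M) (u v : R) : 0 <= v ->
    u + v <= C * (`|y1 - y2| + `|m - m'|) -> u <= `|C| * (`|y1 - y2| + `|m - m'|).
  move=> v0 h; apply: (@le_trans _ _ (u + v)); first by rewrite lerDl.
  by apply: (le_trans h); apply: ler_wpM2r; [rewrite addr_ge0|exact: ler_norm].
have ra : regular_coef T alpha `|C| (Ka + Kb).
  split => //; first exact: addr_ge0.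
  - by move=> z sz y1 y2 m m'; apply: CC (lip z sz y1 y2 m m').
  - by move=> z sz; apply: (le_trans (ha z sz)); rewrite lerDl.
  - by move=> m; exact: borel_coef_section.
have rb : regular_coef T beta `|C| (Ka + Kb).
  split => //; first exact: addr_ge0.
  - move=> z sz y1 y2 m m'; apply: (CC z y1 y2 m m' _ `|alpha z y1 m - alpha z y2 m'|) => //.
    by rewrite addrC; exact: lip.
  - by move=> z sz; apply: (le_trans (hb z sz)); rewrite lerDr.
  - by move=> m; exact: borel_coef_section.
split; first exact: (existence P_complete B_sheet T_gt0 kl0 kn0 law_lip law_bd y ra rb).
move=> Y Y' sY sY' z sz.
exact: (uniqueness P_complete B_sheet T_gt0 kl0 kn0 law_lip law_bd ra rb sY sY' sz).
Qed.
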